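(* Let $B$ be a discrete abelian group (written additively), $\alpha\in \mathrm{Aut}(B)$, $G=B\rtimes_\alpha\mathbb{Z}$, $K=\widehat{B}$, $\chi\in K$, and let $\mathrm{Ind}_B^G(\chi)$ be the unitary representation of $G$ induced from $\chi$. (1) $\mathrm{Ind}_B^G(\chi)$ is irreducible if and only if $\chi$ has no finite period, i.e. there is no integer $k\ge 1$ with $\widehat{\alpha}^k\chi=\chi$. (2) Suppose the orbit of $\chi$ under $\widehat{\alpha}$ has finite order $p$, i.e. $\widehat{\alpha}^p\chi=\chi$ and $\widehat{\alpha}^k\chi\neq\chi$ for $1\le k<p$. Then the commutant $M_p:=\{\mathrm{Ind}_B^G(\chi)\}'$ is unitarily equivalent to $\{f(z^p) : f\in L^\infty(\mathbb{T})\}$, where the functions $z\mapsto f(z^p)$ act as multiplication operators on $L^2(\mathbb{T})$; that is, there is a unitary $W$ from the space of $\mathrm{Ind}_B^G(\chi)$ onto $L^2(\mathbb{T})$ such that $W M_p W^*$ is the set of all multiplication operators by functions $z\mapsto f(z^p)$ with $f\in L^\infty(\mathbb{T})$.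
   Context: $G=B\rtimes_\alpha\mathbb{Z}$ is the set of pairs $(j,b)$, $j\in\mathbb{Z}$, $b\in B$, with multiplication $(k,c)(j,b)=(k+j,\alpha^k(b)+c)$; $B$ is identified with the subgroup $\{(0,b)\}$. $K=\widehat{B}$ is the compact group of characters $\chi:B\to\mathbb{T}=\{z\in\mathbb{C}:|z|=1\}$, and $\widehat{\alpha}\in\mathrm{Aut}(K)$ is the dual action $(\widehat{\alpha}\chi)(b)=\chi(\alpha(b))$. The induced representation $\mathrm{Ind}_B^G(\chi)$ acts on the Hilbert space of functions $f:G\to\mathbb{C}$ with $f(j,b)=\chi(b)f(j,0)$ and $\|f\|^2=\sum_{j\in\mathbb{Z}}|f(j,0)|^2<\infty$, by right translation: $(\mathrm{Ind}_B^G(\chi)_{g}f)(x)=f(xg)$ for $x,g\in G$. Equivalently, on $l^2(\mathbb{Z})$ it is given by $(\mathrm{Ind}_B^G(\chi)_{(j,b)}\xi)_k=\chi(\alpha^k(b))\xi_{k+j}$. The commutant of a representation is the algebra of all bounded operators commuting with every operator of the representation. $\mathbb{T}$ carries normalized Lebesgue (Haar) measure. *)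

(* Defs.v *)
From HB Require Import structures.
From mathcomp Require Import all_boot all_order all_algebra.
From mathcomp Require Import complex.
From mathcomp Require Import all_classical all_reals all_analysis.
From mathcomp Require Import measurable_realfun.
From mathcomp Require Import ring lra.

Set Implicit Arguments.
Unset Strict Implicit.
Unset Printing Implicit Defensive.

Import Order.TTheory GRing.Theory Num.Theory.
Import numFieldNormedType.Exports.
Import Normc.

Local Open Scope classical_set_scope.
Local Open Scope ring_scope.
Local Open Scope complex_scope.

Local Notation Re := (@complex.Re _).
Local Notation Im := (@complex.Im _).

Record circle (R : realType) := Circle {
  circle_val :> R[i];
  _ : `|circle_val| == 1 }.

HB.instance Definition _ (R : realType) := [isSub for @circle_val R].
HB.instance Definition _ (R : realType) := [Choice of circle R by <:].

Section CircleGroup.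
Variable R : realType.
Implicit Types z w : circle R.

Lemma circle_norm1 z : `|circle_val z| = 1.
Proof. exact: (eqP (valP z)). Qed.

Lemma circle_neq0 z : circle_val z != 0.
Proof. by rewrite -normr_eq0 circle_norm1 oner_neq0. Qed.

Fact circle_one_subproof : `|1 : R[i]| == 1.
Proof. by rewrite normr1. Qed.

Fact circle_mul_subproof z w : `|circle_val z * circle_val w| == 1.
Proof. by rewrite normrM !circle_norm1 mulr1. Qed.

Fact circle_inv_subproof z : `|(circle_val z)^-1| == 1.
Proof. by rewrite normfV circle_norm1 invr1. Qed.

Definition circle_one : circle R := Circle circle_one_subproof.
Definition circle_mul z w : circle R := Circle (circle_mul_subproof z w).
Definition circle_inv z : circle R := Circle (circle_inv_subproof z).

Fact circle_mulA : associative circle_mul.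
Proof. by move=> x y z; apply: val_inj; rewrite /= mulrA. Qed.

Fact circle_mul1 : left_id circle_one circle_mul.
Proof. by move=> x; apply: val_inj; rewrite /= mul1r. Qed.

Fact circle_mulr1 : right_id circle_one circle_mul.
Proof. by move=> x; apply: val_inj; rewrite /= mulr1. Qed.

Fact circle_mulV : left_inverse circle_one circle_inv circle_mul.
Proof. by move=> x; apply: val_inj; rewrite /= mulVf ?circle_neq0. Qed.

Fact circle_mulrV : right_inverse circle_one circle_inv circle_mul.
Proof. by move=> x; apply: val_inj; rewrite /= mulfV ?circle_neq0. Qed.

HB.instance Definition _ := isGroup.Build (circle R)
  circle_mulA circle_mul1 circle_mulr1 circle_mulV circle_mulrV.

HB.instance Definition _ := isPointed.Build (circle R) circle_one.

(* The Borel sigma-algebra of the circle is the trace of that of R * R. *)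
Definition circle_coord z : R * R := (Re z, Im z).

HB.instance Definition _ :=
  Measurable.copy (circle R) (g_sigma_algebra_preimageType circle_coord).

Fact expi_subproof (t : R) :
  `|cos (2 * pi * t) +i* sin (2 * pi * t) : R[i]| == 1.
Proof. by rewrite normc_def /= cos2Dsin2 sqrtr1. Qed.

Definition expi (t : measurableTypeR R) : circle R := Circle (expi_subproof t).

Fact measurable_expi : measurable_fun [set: measurableTypeR R] expi.
Proof.
have mc : measurable_fun [set: measurableTypeR R] (circle_coord \o expi).
  apply/measurable_fun_pairP; split.
    apply: (measurableT_comp (continuous_measurable_fun (@continuous_cos R))).
    exact: measurable_funM.
  apply: (measurableT_comp (continuous_measurable_fun (@continuous_sin R))).
  exact: measurable_funM.
move=> _ _ [A mA <-]; rewrite setTI.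
by have := mc measurableT A mA.
Qed.

HB.instance Definition _ := isMeasurableFun.Build _ _ (measurableTypeR R) (circle R)
    expi measurable_expi.

(* Normalized Haar measure: the image of Lebesgue measure on [0, 1] under
   t |-> exp (2 i pi t). *)
Definition haar : set (circle R) -> \bar R :=
  distribution (uniform_prob (@ltr01 R))
    expi.

HB.instance Definition _ := Probability.on haar.

End CircleGroup.

Section ComplexL2.
Context d (T : measurableType d) (R : realType).
Variable mu : {measure set T -> \bar R}.
Implicit Types f g h : T -> R[i].

Definition cmeasurable f :=
  measurable_fun [set: T] (Re \o f) /\
  measurable_fun [set: T] (Im \o f).

Definition cintegral f : R[i] :=
  (\int[mu]_x Re (f x)) +i* (\int[mu]_x Im (f x)).

Definition square_integrable f :=
  cmeasurable f /\ (\int[mu]_x (normc (f x) ^+ 2)%:E < +oo)%E.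

Definition cintegrable f :=
  mu.-integrable [set: T] (EFin \o (Re \o f)) /\
  mu.-integrable [set: T] (EFin \o (Im \o f)).

Lemma normcE2 (z : R[i]) :
  normc z ^+ 2 = Re z ^+ 2 + Im z ^+ 2.
Proof. by case: z => a b /=; rewrite sqr_sqrtr// addr_ge0// sqr_ge0. Qed.

Lemma cmeasurableZD c f g :
  cmeasurable f -> cmeasurable g -> cmeasurable (fun x => c * f x + g x).
Proof.
case: c => a b [mf1 mf2] [mg1 mg2]; split.
  rewrite (_ : _ \o _ = (fun x => a * Re (f x) - b * Im (f x)
                           + Re (g x))); last first.
    by apply/funext => x /=; case: (f x) => ? ?; case: (g x) => ? ?.
  apply: measurable_funD => //; apply: measurable_funB;
    by apply: measurable_funM => //; exact: measurable_cst.
rewrite (_ : _ \o _ = (fun x => a * Im (f x) + b * Re (f x)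
                         + Im (g x))); last first.
  by apply/funext => x /=; case: (f x) => ? ?; case: (g x) => ? ?.
apply: measurable_funD => //; apply: measurable_funD;
  by apply: measurable_funM => //; exact: measurable_cst.
Qed.

Lemma cmeasurable_mulJ f g :
  cmeasurable f -> cmeasurable g -> cmeasurable (fun x => f x * (g x)^*).
Proof.
move=> [mf1 mf2] [mg1 mg2]; split.
  rewrite (_ : _ \o _ = (fun x => Re (f x) * Re (g x)
                           + Im (f x) * Im (g x))); last first.
    apply/funext => x /=; case: (f x) => ? ?; case: (g x) => ? ? /=; ring.
  by apply: measurable_funD; apply: measurable_funM.
rewrite (_ : _ \o _ = (fun x => Im (f x) * Re (g x)
                         - Re (f x) * Im (g x))); last first.
  apply/funext => x /=; case: (f x) => ? ?; case: (g x) => ? ? /=; ring.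
by apply: measurable_funB; apply: measurable_funM.
Qed.

Lemma measurable_normc2 f :
  cmeasurable f -> measurable_fun [set: T] (fun x => normc (f x) ^+ 2).
Proof.
move=> [m1 m2]; under eq_fun do rewrite normcE2.
by apply: measurable_funD; apply: measurable_funX.
Qed.

Lemma square_integrable_int f : square_integrable f ->
  mu.-integrable [set: T] (fun x => (normc (f x) ^+ 2)%:E).
Proof.
move=> [mf foo]; apply/integrableP; split.
  by apply/measurable_EFinP; exact: measurable_normc2.
by under eq_integral do rewrite /= ger0_norm ?sqr_ge0//.
Qed.

Lemma square_integrableZD c f g : square_integrable f ->
  square_integrable g -> square_integrable (fun x => c * f x + g x).
Proof.
move=> sf sg; have mfg := cmeasurableZD c sf.1 sg.1; split => //.
have ifg : mu.-integrable [set: T]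
    (fun x => (2 * normc c ^+ 2 * normc (f x) ^+ 2)%:E
              + (2 * normc (g x) ^+ 2)%:E)%E.
  apply: integrableD => //.
    under eq_fun do rewrite EFinM.
    by apply: integrableZl => //; exact: square_integrable_int.
  under eq_fun do rewrite EFinM.
  by apply: integrableZl => //; exact: square_integrable_int.
have /integrableP[_] : mu.-integrable [set: T]
    (fun x => (normc (c * f x + g x) ^+ 2)%:E).
  apply: le_integrable ifg => //.
    by apply/measurable_EFinP; exact: measurable_normc2.
  move=> x _; rewrite /= lee_fin !ger0_norm ?sqr_ge0//; last first.
    have h1 := sqr_ge0 (normc c * normc (f x)).
    have h2 := sqr_ge0 (normc (g x)); rewrite exprMn in h1; lra.
  rewrite -mulrA -exprMn -normcM !normcE2 !raddfD/=.
  move: (c * f x) (g x) => [u v] [y z] /=.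
  have h1 := sqr_ge0 (u - y); have h2 := sqr_ge0 (v - z).
  rewrite !expr2 in h1 h2 *; nra.
by under eq_integral do rewrite /= ger0_norm ?sqr_ge0//.
Qed.

Lemma cintegrable_mulJ f g : square_integrable f -> square_integrable g ->
  cintegrable (fun x => f x * (g x)^*).
Proof.
move=> sf sg; have [m1 m2] := cmeasurable_mulJ sf.1 sg.1.
have ifg : mu.-integrable [set: T]
    (fun x => (normc (f x) ^+ 2)%:E + (normc (g x) ^+ 2)%:E)%E.
  by apply: integrableD => //; exact: square_integrable_int.
split; (apply: le_integrable ifg => //; first exact/measurable_EFinP);
  move=> x _ /=; rewrite lee_fin [leRHS]ger0_norm ?addr_ge0 ?sqr_ge0//;
  rewrite !normcE2 ler_norml;
  case: (f x) => a b; case: (g x) => a' b' /=;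
  have h1 := sqr_ge0 (a - a'); have h2 := sqr_ge0 (b - b');
  have h3 := sqr_ge0 (a + a'); have h4 := sqr_ge0 (b + b');
  have h5 := sqr_ge0 (a - b'); have h6 := sqr_ge0 (b - a');
  have h7 := sqr_ge0 (a + b'); have h8 := sqr_ge0 (b + a');
  rewrite !expr2 in h1 h2 h3 h4 h5 h6 h7 h8 *; apply/andP; split; lra.
Qed.

Lemma cintegralZD c f g : cintegrable f -> cintegrable g ->
  cintegral (fun x => c * f x + g x) = c * cintegral f + cintegral g.
Proof.
move=> [if1 if2] [ig1 ig2]; case: c => a b; rewrite /cintegral.
have Zi (r : R) (h : T -> R) : mu.-integrable [set: T] (EFin \o h) ->
    mu.-integrable [set: T] (EFin \o (fun x => r * h x)).
  move=> ih; rewrite (_ : _ \o _ = fun x => (r%:E * (EFin \o h) x)%E)//.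
  exact: integrableZl.
have lin3 (r s : R) (h1 h2 h3 : T -> R) :
    mu.-integrable [set: T] (EFin \o h1) ->
    mu.-integrable [set: T] (EFin \o h2) ->
    mu.-integrable [set: T] (EFin \o h3) ->
    \int[mu]_x (r * h1 x + s * h2 x + h3 x) =
    r * \int[mu]_x h1 x + s * \int[mu]_x h2 x + \int[mu]_x h3 x.
  move=> i1 i2 i3; rewrite -!RintegralZl// -!RintegralD//; do ?exact: Zi.
  by apply: (integrableD measurableT (Zi r h1 i1) (Zi s h2 i2)).
have reE x : Re ((a +i* b) * f x + g x) =
    a * Re (f x) + (- b) * Im (f x) + Re (g x).
  by case: (f x) => ? ?; case: (g x) => ? ? /=; ring.
have imE x : Im ((a +i* b) * f x + g x) =
    a * Im (f x) + b * Re (f x) + Im (g x).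
  by case: (f x) => ? ?; case: (g x) => ? ? /=; ring.
rewrite (eq_Rintegral _ (fun x _ => reE x)) (eq_Rintegral _ (fun x _ => imE x)).
rewrite !lin3//; simpc; congr (_ +i* _); ring.
Qed.

Lemma ae_eq_cintegral f g : cmeasurable f -> cmeasurable g ->
  f = g %[ae mu] -> cintegral f = cintegral g.
Proof.
move=> [mf1 mf2] [mg1 mg2] fg; rewrite /cintegral /Rintegral.
have fg1 : (EFin \o (Re \o f)) = (EFin \o (Re \o g)) %[ae mu].
  by apply: filterS fg => x /= h ?; rewrite h.
have fg2 : (EFin \o (Im \o f)) = (EFin \o (Im \o g)) %[ae mu].
  by apply: filterS fg => x /= h ?; rewrite h.
congr (fine _ +i* fine _).
  by apply: ae_eq_integral fg1 => //; exact/measurable_EFinP.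
by apply: ae_eq_integral fg2 => //; exact/measurable_EFinP.
Qed.

Lemma cintegral_mulJC f g : square_integrable f -> square_integrable g ->
  cintegral (fun x => f x * (g x)^*) = (cintegral (fun x => g x * (f x)^*))^*.
Proof.
move=> sf sg; have [_ i2] := cintegrable_mulJ sg sf.
rewrite /cintegral; congr (_ +i* _).
  apply: eq_Rintegral => x _.
  by case: (f x) => ? ?; case: (g x) => ? ? /=; ring.
rewrite -mulN1r -RintegralZl//; apply: eq_Rintegral => x _.
by case: (f x) => ? ?; case: (g x) => ? ? /=; ring.
Qed.

Lemma cintegral_mulJ f :
  cintegral (fun x => f x * (f x)^*) = (\int[mu]_x (normc (f x) ^+ 2))%:C.
Proof.
rewrite /cintegral; congr (_ +i* _).
  apply: eq_Rintegral => x _; rewrite normcE2.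
  by case: (f x) => ? ? /=; ring.
rewrite (_ : (fun x => _) = cst 0); first by rewrite /Rintegral integral0.
by apply/funext => x; case: (f x) => ? ? /=; ring.
Qed.

Lemma square_integrable_eq0 f : square_integrable f ->
  \int[mu]_x (normc (f x) ^+ 2) = 0 -> f = cst 0 %[ae mu].
Proof.
move=> sf f0; have If := square_integrable_int sf.
have mf := measurable_int _ If.
have : (\int[mu]_x `|(normc (f x) ^+ 2)%:E| = 0)%E.
  under eq_integral do rewrite /= ger0_norm ?sqr_ge0//.
  by rewrite -[LHS]fineK ?integrable_fin_num// [fine _]f0.
move=> /(ae_eq_integral_abs _ measurableT mf).1.
apply: filterS => x /= /[apply] -[] /eqP.
by rewrite sqrf_eq0 => /eqP /eq0_normc.
Qed.

Definition L2_pred : {pred T -> R[i]} := fun f => `[< square_integrable f >].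

Fact L2_pred_submod_closed : submod_closed L2_pred.
Proof.
split.
  apply/asboolP; split.
    by split; exact: measurable_cst.
  rewrite (_ : (fun x => _) = cst 0%E) ?integral0 ?ltry//.
  by apply/funext => x; rewrite (@normc0 R) expr0n.
move=> a f g /asboolP sf /asboolP sg; apply/asboolP.
exact: square_integrableZD.
Qed.

HB.instance Definition _ :=
  GRing.isSubmodClosed.Build _ _ L2_pred L2_pred_submod_closed.

Record L2fun := MkL2fun { L2fun_val :> T -> R[i]; _ : L2fun_val \in L2_pred }.

HB.instance Definition _ := [isSub for L2fun_val].
HB.instance Definition _ := [Choice of L2fun by <:].
HB.instance Definition _ := [SubChoice_isSubLmodule of L2fun by <:].

Lemma L2funP (u : L2fun) : square_integrable u.
Proof. exact: (asboolP _ (valP u)). Qed.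

Definition L2_null : {pred L2fun} :=
  fun u => `[< (u : T -> R[i]) = cst 0 %[ae mu] >].

Fact L2_null_submod_closed : submod_closed L2_null.
Proof.
split; first by apply/asboolP/aeW => x.
move=> a u v /asboolP u0 /asboolP v0; apply/asboolP.
apply: filterS2 u0 v0 => x /(_ Logic.I) u0 /(_ Logic.I) v0 _.
by change (a * u x + v x = 0); rewrite u0 v0 mulr0 addr0.
Qed.

HB.instance Definition _ :=
  GRing.isSubmodClosed.Build _ _ L2_null L2_null_submod_closed.

Local Open Scope quotient_scope.

(* Square-integrable functions modulo almost everywhere equality. *)
Definition L2 := Quotient.quot L2_null.

HB.instance Definition _ := GRing.Zmodule.on L2.
HB.instance Definition _ := EqQuotient.on L2.

Lemma repr_pi (u : L2fun) : repr (\pi_L2 u) = u %[ae mu].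
Proof.
have /eqP : \pi_L2 (repr (\pi_L2 u)) = \pi_L2 u by rewrite reprK.
rewrite -Quotient.idealrBE => /asboolP.
by apply: filterS => x /= /[apply] /eqP; rewrite subr_eq0 => /eqP.
Qed.

Lemma eq_L2P (u v : L2) : u = v <-> repr u = repr v %[ae mu].
Proof.
split=> [->|uv]; first exact: ae_eq_refl.
rewrite -[u]reprK -[v]reprK; apply/eqP; rewrite -Quotient.idealrBE.
apply/asboolP; apply: filterS uv => x /(_ Logic.I) uv _.
by change (repr u x - repr v x = 0); rewrite uv subrr.
Qed.

Definition L2_scale (a : R[i]) (u : L2) : L2 := \pi_L2 (a *: repr u).

Lemma repr_scale a u : repr (L2_scale a u) = (fun x => a * repr u x) %[ae mu].
Proof. exact: repr_pi. Qed.

Lemma repr_add (u v : L2) :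
  repr (u + v) = (fun x => repr u x + repr v x) %[ae mu].
Proof.
have -> : u + v = \pi_L2 (repr u + repr v) by rewrite Quotient.pi_add !reprK.
exact: repr_pi.
Qed.

Fact L2_scaleA a b u : L2_scale a (L2_scale b u) = L2_scale (a * b) u.
Proof.
apply/eq_L2P; apply: filterS3 (repr_scale a (L2_scale b u)) (repr_scale b u)
  (repr_scale (a * b) u) => x /(_ Logic.I) e1 /(_ Logic.I) e2 /(_ Logic.I) e3 _.
by rewrite e1 e2 e3 mulrA.
Qed.

Fact L2_scale1 : left_id 1 L2_scale.
Proof.
move=> u; apply/eq_L2P; apply: filterS (repr_scale 1 u) => x /(_ Logic.I) e _.
by rewrite e mul1r.
Qed.

Fact L2_scaleDr : right_distributive L2_scale +%R.
Proof.
move=> a u v; apply/eq_L2P.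
near=> x => _.
rewrite (near (repr_scale a (u + v)) x _ Logic.I)//.
rewrite (near (repr_add u v) x _ Logic.I)//.
rewrite (near (repr_add (L2_scale a u) (L2_scale a v)) x _ Logic.I)//.
rewrite (near (repr_scale a u) x _ Logic.I)//.
rewrite (near (repr_scale a v) x _ Logic.I)//.
by rewrite mulrDr.
Unshelve. all: by end_near. Qed.

Fact L2_scaleDl u : {morph L2_scale^~ u : a b / a + b}.
Proof.
move=> a b; apply/eq_L2P.
near=> x => _.
rewrite (near (repr_scale (a + b) u) x _ Logic.I)//.
rewrite (near (repr_add (L2_scale a u) (L2_scale b u)) x _ Logic.I)//.
rewrite (near (repr_scale a u) x _ Logic.I)//.
rewrite (near (repr_scale b u) x _ Logic.I)//.
by rewrite mulrDl.
Unshelve. all: by end_near. Qed.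

HB.instance Definition _ := GRing.Zmodule_isLmodule.Build R[i] L2
  L2_scaleA L2_scale1 L2_scaleDr L2_scaleDl.

Definition L2_dot (u v : L2) : R[i] :=
  cintegral (fun x => repr u x * (repr v x)^*).

Fact L2_dot_linearl (v : L2) : linear_for *%R (L2_dot^~ v).
Proof.
move=> a u w; rewrite /L2_dot -cintegralZD; do ?exact: cintegrable_mulJ (L2funP _) (L2funP _).
apply: ae_eq_cintegral.
- by apply: cmeasurable_mulJ; exact: (L2funP _).1.
- by apply: cmeasurableZD; apply: cmeasurable_mulJ; exact: (L2funP _).1.
near=> x => _.
rewrite (near (repr_add (a *: u) w) x _ Logic.I)//.
rewrite (near (repr_scale a u) x _ Logic.I)//.
by rewrite mulrDl mulrA.
Unshelve. all: by end_near. Qed.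

Fact L2_dot_herm (u v : L2) : L2_dot u v = (-1) ^+ false * Num.conj (L2_dot v u).
Proof. by rewrite expr0 mul1r; exact: cintegral_mulJC (L2funP _) (L2funP _). Qed.

Fact L2_dot_linearr (u : L2) : linear_for (Num.conj \; *%R) (L2_dot u).
Proof.
move=> a v w; rewrite L2_dot_herm L2_dot_linearl [in RHS](L2_dot_herm u v).
by rewrite [in RHS](L2_dot_herm u w) !expr0 !mul1r rmorphD rmorphM.
Qed.

Fact L2_dot_gt0 (u : L2) : u != 0 -> 0 < L2_dot u u.
Proof.
move=> u0; rewrite /L2_dot cintegral_mulJ ltcR lt_neqAle.
rewrite Rintegral_ge0 ?andbT; last by move=> x _; exact: sqr_ge0.
apply: contra u0 => /eqP /esym /(square_integrable_eq0 (L2funP _)) u0.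
apply/eqP/eq_L2P; apply: ae_eq_trans u0 _; apply: ae_eq_sym.
by have := repr_pi 0; rewrite raddf0.
Qed.

HB.instance Definition _ := @bilinear_isBilinear.Build R[i] L2 L2 R[i]
  *%R (Num.conj \; *%R) L2_dot (conj L2_dot_linearl L2_dot_linearr).
HB.instance Definition _ :=
  @isHermitianSesquilinear.Build R[i] L2 false Num.conj L2_dot L2_dot_herm.
HB.instance Definition _ := @isDotProduct.Build R[i] L2 L2_dot L2_dot_gt0.


End ComplexL2.

Section DotNorm.
Variables (C : numClosedFieldType) (U : lmodType C).
Variable form : {dot U for Num.conj}.

Definition dot_norm (u : U) : C := sqrtC (form u u).

Lemma dot_CauchySchwarz u v :
  `|form u v| <= dot_norm u * dot_norm v.
Proof.
have [->|v0] := eqVneq v 0.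
  by rewrite /dot_norm !linear0r normr0 sqrtC0 mulr0.
rewrite /dot_norm -sqrtCM ?nnegrE ?dnorm_ge0//.
rewrite -[leLHS]sqrCK ?normr_ge0// ler_sqrtC ?nnegrE ?exprn_ge0 ?mulr_ge0 ?dnorm_ge0//.
pose a := form u v / form v v.
have vv0 : form v v != 0 by rewrite dnorm_eq0.
pose w := u - a *: v.
have wv : form w v = 0 by rewrite linearBl/= linearZl_LR/= divfK// subrr.
have := dnorm_ge0 form w.
have -> : form w w = form u u - a * form v u.
  rewrite {2}/w linearBr/= linearZr_LR/= wv mulr0 subr0.
  by rewrite linearBl/= linearZl_LR.
rewrite subr_ge0 -(ler_pM2r (_ : 0 < form v v)) ?dnorm_gt0//.
rewrite [form v u]hermC expr0 mul1r.
by rewrite normCK mulrAC divfK.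
Qed.

Lemma dot_norm_triangle u v : dot_norm (u + v) <= dot_norm u + dot_norm v.
Proof.
have n0 w : 0 <= dot_norm w by rewrite sqrtC_ge0 dnorm_ge0.
rewrite -ler_sqr ?nnegrE ?addr_ge0// sqrrD /dot_norm !sqrtCK dnormD/=.
rewrite addrAC lerD2r lerD2l.
have := dot_CauchySchwarz u v.
have -> : form u v + (form u v)^* = 'Re (form u v) *+ 2.
  by rewrite ReE -mulr_natr divfK ?pnatr_eq0.
rewrite lerMn2r/=; apply: le_trans.
by apply: le_trans (real_ler_norm _) (leif_normC_Re_Creal _).1; rewrite Creal_Re.
Qed.

Lemma dot_normZ a u : dot_norm (a *: u) = `|a| * dot_norm u.
Proof.
by rewrite /dot_norm dnormZ rootCMl ?exprn_ge0// sqrCK.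
Qed.

Lemma dot_norm_eq0 u : dot_norm u = 0 -> u = 0.
Proof. by move=> /eqP; rewrite sqrtC_eq0 dnorm_eq0 => /eqP. Qed.

End DotNorm.

(* int is given the discrete sigma-algebra: sums over the integers are written
   as integrals against the counting measure. *)
HB.instance Definition _ := isPointed.Build int 0.

HB.instance Definition _ := @isMeasurable.Build default_measure_display
  int discrete_measurable discrete_measurable0
  discrete_measurableC discrete_measurableU.

Lemma counting_preimage (T : choiceType) (R : realType) (e e' : T -> T)
    (A : set T) : cancel e e' -> cancel e' e ->
  counting (e @^-1` A) = counting A :> \bar R.
Proof.
move=> ee' e'e; have -> : e @^-1` A = e' @` A.
  apply/seteqP; split=> [x Aex|_ [y Ay <-]]; last by rewrite /= e'e.
  by exists (e x).
have cA : (e' @` A #= A)%card.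
  by apply: inj_card_eq => x y _ _; exact: (can_inj e'e).
rewrite /counting (eq_finite_set cA); case: ifPn => // /asboolP finA.
by rewrite ((fcard_eq (finite_image e' finA) finA) cA).
Qed.

Lemma ge0_integral_counting_shift (R : realType) (f : int -> \bar R) (j : int) :
  (forall k, 0 <= f k)%E ->
  (\int[counting]_k f ((k : int) + j)%R = \int[counting]_k f k)%E.
Proof.
move=> f0; pose e (k : int) : int := k + j.
have me : measurable_fun [set: int] e by [].
rewrite -[LHS]/(\int[counting]_(k in e @^-1` [set: int]) (f \o e) k)%E.
rewrite -(ge0_integral_pushforward me)//.
apply: eq_measure_integral => A _ _.
by apply: (@counting_preimage _ _ e (fun k => k - j)) => k; rewrite /e ?addrK ?subrK.
Qed.

Record zmodAut (B : zmodType) := ZmodAut {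
  aut_fun :> {additive B -> B};
  aut_inv : B -> B;
  aut_funK : cancel aut_fun aut_inv;
  aut_invK : cancel aut_inv aut_fun }.

(* The pair (j, b) is the element of the semidirect product with integer part j;
   B embeds as the pairs (0, b). *)
Definition semidirect (B : zmodType) (alpha : zmodAut B) : Type :=
  (int * B)%type.

Section Semidirect.
Variables (B : zmodType) (alpha : zmodAut B).

Definition aut_exp (k : int) (b : B) : B :=
  match k with
  | Posz n => iter n alpha b
  | Negz n => iter n.+1 (aut_inv alpha) b
  end.

Fact aut_exp_is_additive k : additive (aut_exp k).
Proof.
have iterB (g : B -> B) n : additive g -> additive (iter n g).
  by move=> gB; elim: n => [|n IH] a b //=; rewrite IH gB.
case: k => n; apply: iterB => a b; first exact: raddfB.
by apply: (can_inj (aut_funK alpha)); rewrite raddfB !aut_invK.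
Qed.

HB.instance Definition _ k :=
  GRing.isZmodMorphism.Build B B (aut_exp k) (aut_exp_is_additive k).

Lemma aut_expS k b : aut_exp (k + 1) b = alpha (aut_exp k b).
Proof.
case: k => n; first by rewrite -PoszD addn1.
case: n => [|n]; first by rewrite /= aut_invK.
rewrite (_ : Negz n.+1 + 1 = Negz n)/= ?aut_invK//.
by rewrite !NegzE -addn1 PoszD opprD addrNK.
Qed.

Lemma aut_expN1 k b : aut_exp (k - 1) b = aut_inv alpha (aut_exp k b).
Proof. by rewrite -{2}[k](subrK 1) aut_expS aut_funK. Qed.

Lemma aut_expD j k b : aut_exp (j + k) b = aut_exp j (aut_exp k b).
Proof.
elim/int_rect: j => [|n IH|n IH]; first by rewrite add0r.
  by rewrite -addn1 PoszD addrAC aut_expS IH -aut_expS.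
by rewrite -addn1 PoszD opprD addrAC aut_expN1 IH -aut_expN1.
Qed.

Local Notation semidirect := (semidirect alpha).

HB.instance Definition _ := Choice.copy semidirect (int * B)%type.

Implicit Types x y z : semidirect.

Definition semidirect_one : semidirect := (0, 0).

Definition semidirect_mul x y : semidirect :=
  (x.1 + y.1, aut_exp x.1 y.2 + x.2).

Definition semidirect_inv x : semidirect := (- x.1, - aut_exp (- x.1) x.2).

Fact semidirect_mulA : associative semidirect_mul.
Proof.
move=> [k c] [j b] [i a]; congr pair => /=; first by rewrite addrA.
by rewrite raddfD aut_expD addrA.
Qed.

Fact semidirect_mul1 : left_id semidirect_one semidirect_mul.
Proof. by move=> [k c]; congr pair => /=; rewrite ?add0r ?addr0. Qed.

Fact semidirect_mulr1 : right_id semidirect_one semidirect_mul.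
Proof.
move=> [k c]; congr pair => /=; first by rewrite addr0.
by rewrite raddf0 add0r.
Qed.

Fact semidirect_mulV : left_inverse semidirect_one semidirect_inv semidirect_mul.
Proof. by move=> [k c]; congr pair => /=; rewrite ?addNr ?subrr. Qed.

Fact semidirect_mulrV : right_inverse semidirect_one semidirect_inv semidirect_mul.
Proof.
move=> [k c]; congr pair => /=; first by rewrite subrr.
by rewrite raddfN /= -aut_expD subrr addNr.
Qed.

HB.instance Definition _ := isGroup.Build semidirect
  semidirect_mulA semidirect_mul1 semidirect_mulr1
  semidirect_mulV semidirect_mulrV.

End Semidirect.

(* B is discrete, so characters carry no continuity condition. *)
Record character (R : realType) (B : zmodType) := Character {
  char_fun :> B -> circle R;
  charD : forall a b, char_fun (a + b) = (char_fun a * char_fun b)%g }.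

Section Induced.
Variables (R : realType) (B : zmodType) (alpha : zmodAut B).
Implicit Types chi : character R B.
Local Notation G := (semidirect alpha).

Fact dual_aut_subproof chi a b :
  chi (alpha (a + b)) = (chi (alpha a) * chi (alpha b))%g.
Proof. by rewrite raddfD charD. Qed.

Definition dual_aut chi : character R B := Character (dual_aut_subproof chi).

Variable chi : character R B.

Definition ind_pred : {pred G -> R[i]} := fun f => `[<
  (forall (j : int) (b : B), f (j, b) = (chi b : R[i]) * f (j, 0)) /\
  square_integrable (@counting int R) (fun j : int => f (j, 0)) >].

Fact ind_pred_submod_closed : submod_closed ind_pred.
Proof.
split.
  apply/asboolP; split=> [j b|]; first by rewrite mulr0.
  exact: (L2funP (0 : L2fun (@counting int R))).
move=> a f g /asboolP[ef sf] /asboolP[eg sg]; apply/asboolP; split.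
  move=> j b; change (a * f (j, b) + g (j, b) =
    (chi b : R[i]) * (a * f (j, 0) + g (j, 0))).
  by rewrite ef eg mulrDr mulrCA.
exact: square_integrableZD.
Qed.

HB.instance Definition _ :=
  GRing.isSubmodClosed.Build _ _ ind_pred ind_pred_submod_closed.

Record ind_space := IndSpace {
  ind_fun :> G -> R[i];
  _ : ind_fun \in ind_pred }.

HB.instance Definition _ := [isSub for ind_fun].
HB.instance Definition _ := [Choice of ind_space by <:].
HB.instance Definition _ := [SubChoice_isSubLmodule of ind_space by <:].

Implicit Types f g h : ind_space.

Lemma ind_funE f (j : int) (b : B) : f (j, b) = (chi b : R[i]) * f (j, 0).
Proof. by have /asboolP[] := valP f. Qed.

Lemma ind_funP f :
  square_integrable (@counting int R) (fun j : int => f (j, 0)).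
Proof. by have /asboolP[] := valP f. Qed.

Definition ind_dot f g : R[i] :=
  cintegral (@counting int R) (fun j : int => f (j, 0) * (g (j, 0))^*).

Fact ind_dot_linearl g : linear_for *%R (ind_dot^~ g).
Proof.
move=> a f h; rewrite /ind_dot.
rewrite -cintegralZD; do ?exact: cintegrable_mulJ (ind_funP _) (ind_funP _).
congr (cintegral _ _); apply/funext => j.
change ((a * f (j, 0) + h (j, 0)) * (g (j, 0))^* =
  a * (f (j, 0) * (g (j, 0))^*) + h (j, 0) * (g (j, 0))^*).
by rewrite mulrDl mulrA.
Qed.

Fact ind_dot_herm f g : ind_dot f g = (-1) ^+ false * Num.conj (ind_dot g f).
Proof.
by rewrite expr0 mul1r; exact: cintegral_mulJC (ind_funP _) (ind_funP _).
Qed.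

Fact ind_dot_linearr f : linear_for (Num.conj \; *%R) (ind_dot f).
Proof.
move=> a g h; rewrite ind_dot_herm ind_dot_linearl [in RHS](ind_dot_herm f g).
by rewrite [in RHS](ind_dot_herm f h) !expr0 !mul1r rmorphD rmorphM.
Qed.

Fact ind_dot_gt0 f : f != 0 -> 0 < ind_dot f f.
Proof.
move=> f0; rewrite /ind_dot cintegral_mulJ ltcR lt_neqAle.
rewrite Rintegral_ge0 ?andbT; last by move=> j _; exact: sqr_ge0.
apply: contra f0 => /eqP /esym /(square_integrable_eq0 (ind_funP f)).
move=> [N [_ N0 fN]]; apply/eqP/val_inj/funext => -[j b] /=.
rewrite ind_funE; suff -> : f (j, 0) = 0 by rewrite mulr0.
have [//|/eqP fj0] := eqVneq (f (j, 0)) 0.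
have Nj : N j by apply: fN => /= /(_ Logic.I).
have : counting N = 0 :> \bar R := N0.
rewrite /counting; case: ifP => // /asboolP finN [] /eqP.
rewrite pnatr_eq0 finmap.cardfs_eq0 => /eqP /(fset_set_set0 finN) NE.
by move: Nj; rewrite NE.
Qed.

HB.instance Definition _ := @bilinear_isBilinear.Build R[i]
  ind_space ind_space R[i] *%R (Num.conj \; *%R) ind_dot
  (conj ind_dot_linearl ind_dot_linearr).
HB.instance Definition _ := @isHermitianSesquilinear.Build R[i] ind_space
  false Num.conj ind_dot ind_dot_herm.
HB.instance Definition _ :=
  @isDotProduct.Build R[i] ind_space ind_dot ind_dot_gt0.

HB.instance Definition _ := @Lmodule_isNormed.Build R[i] ind_space
  (dot_norm (ind_dot : {dot ind_space for Num.conj}))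
  (dot_norm_triangle _) (dot_normZ _) (@dot_norm_eq0 _ _ _).

Lemma ind_transE f (j k : int) (b c : B) :
  f (((k, c) : G) * ((j, b) : G))%g =
  (chi (aut_exp alpha k b) : R[i]) * (chi c : R[i]) * f (k + j, 0).
Proof.
transitivity ((chi (aut_exp alpha k b + c) : R[i]) * f (k + j, 0)).
  exact: (ind_funE f (k + j) (aut_exp alpha k b + c)).
by rewrite charD.
Qed.

Fact ind_trans_subproof (g : G) f : (fun x : G => f (x * g)%g) \in ind_pred.
Proof.
case: g => j b; apply/asboolP; split=> [k c|].
  have chi0 : (chi 0 : R[i]) = 1.
    have : (chi (0 + 0) : R[i]) = (chi 0 : R[i]) * (chi 0 : R[i]).
      by rewrite charD.
    rewrite addr0 => chi00; apply: (mulfI (circle_neq0 (chi 0))).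
    by rewrite mulr1 -chi00.
  by rewrite (ind_transE f j k b c) (ind_transE f j k b 0) chi0 mulr1 mulrCA mulrA.
split; first by split.
have [_] := ind_funP f.
rewrite -(@ge0_integral_counting_shift R
  (fun k => (normc (f (k, 0)) ^+ 2)%:E) j); last first.
  by move=> k; rewrite lee_fin sqr_ge0.
apply: le_lt_trans; rewrite le_eqVlt; apply/orP; left; apply/eqP.
apply: eq_integral => k _; congr (_ ^+ 2)%:E.
rewrite (ind_transE f j k b 0) !normcM.
have n1 (z : circle R) : normc (z : R[i]) = 1.
  by have := circle_norm1 z; rewrite normc_def; case: (circle_val z) => ? ? [].
by rewrite !n1 !mul1r.
Qed.

Definition ind_rep (g : G) (f : ind_space) : ind_space :=
  IndSpace (ind_trans_subproof g f).

End Induced.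

Definition bounded_operator (R : realType) (V : normedModType R[i])
    (A : V -> V) :=
  linear A /\ exists M : R, forall x, `|A x| <= M%:C * `|x|.

Section Representation.
Variables (R : realType) (V : normedModType R[i]) (G : Type).
Variable rho : G -> V -> V.

Definition commutant : set (V -> V) :=
  [set A | bounded_operator A /\ forall g, A \o rho g = rho g \o A].

Definition irreducible_rep :=
  (exists v : V, v != 0) /\
  forall W : set V, closed W ->
    W 0 -> (forall a u v, W u -> W v -> W (a *: u + v)) ->
    (forall g v, W v -> W (rho g v)) ->
    W = [set 0] \/ W = [set: V].

End Representation.

(* W is unitary: Wstar is its adjoint, W Wstar = 1 and Wstar W = 1. *)
Definition unitary_map (C : numClosedFieldType) (U V : lmodType C)
    (dU : {dot U for Num.conj}) (dV : {dot V for Num.conj})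
    (W : U -> V) (Wstar : V -> U) :=
  [/\ linear W, forall u v, dV (W u) v = dU u (Wstar v),
      cancel W Wstar & cancel Wstar W].

Section Multiplication.
Context d (T : measurableType d) (R : realType).
Variable mu : {measure set T -> \bar R}.

(* Essentially bounded functions, as representatives of the elements of
   L^infinity(mu). *)
Definition Linfty (f : T -> R[i]) :=
  cmeasurable f /\ exists M : R, \forall x \ae mu, normc (f x) <= M.

(* A is the operator of multiplication by m on L2 mu. *)
Definition is_mulop (m : T -> R[i]) (A : L2 mu -> L2 mu) :=
  forall u, repr (A u) = (fun x => m x * repr u x) %[ae mu].

End Multiplication.

(* Main.v *)
From HB Require Import structures.
Require Import Defs.
From mathcomp Require Import all_boot all_order all_algebra.
From mathcomp Require Import complex.
From mathcomp Require Import all_classical all_reals all_analysis.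
From mathcomp Require Import measurable_realfun.
From mathcomp Require Import ring lra zify.

(** In the coordinates f (k, 0), k an integer, the induced space is l^2(Z), and (j, b)
    acts by the shift by j followed by the diagonal operator with entries chi_k b,
    where chi_k = chi \o alpha^k.

    The commutant. The Fourier transform identifies L^2 of the circle with l^2(Z) and
    multiplication by z with a shift. So an operator of the commutant becomes an
    operator on L^2 commuting with multiplication by z, and such an operator is
    multiplication by an essentially bounded function phi, its value at the constant
    function 1 ([symbol_bounded], [commute_mulop]). Commutation with the diagonal
    operators annihilates the n-th Fourier coefficient of phi whenever chi_n and chi
    differ. If the orbit of chi has p elements, this leaves the multiples of p, and phi
    is a function of z^p ([commutant_is_mulop]). Conversely the diagonal entries are
    p-periodic in k, so the representation commutes with multiplication by z^p, hence
    by bounded functions of z^p ([mulop_in_commutant]).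

    Irreducibility. If chi has a period, let p be the least one: the indicator function
    of {Im z^p > 0} gives an operator of the commutant whose kernel is a nontrivial
    closed invariant subspace ([irreducible_no_period]). If chi has no period, every
    chi_k with k nonzero differs from chi at some b. There the mean of the identity and
    of the suitably normalized operator of (0, b) multiplies the k-th coordinate by a
    number of modulus less than 1; it fixes the coordinate at the origin and does not
    increase the others. Products of powers of these means, applied to a vector of a
    closed invariant subspace, converge to its component at the origin, so the subspace
    contains a basis vector if it is nonzero, then everything ([K_full]).

    Two analytic results carry this. Completeness of L^2 ([L2_complete]) makes the
    Fourier transform onto. The monotone class theorem [circle_monotone_class] extends
    a property from the constants, z and z^* to all bounded measurable functions, if it
    is stable under sums, products and pointwise limits of functions with values in
    [0, 1]. It shows that Fourier coefficients determine a function ([fourier_total]),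
    that z |-> z^p preserves Haar measure ([cintegral_powC]), and that an operator
    commuting with multiplication by z^p commutes with multiplication by functions of
    z^p ([commute_mulL2_powC]). *)

Set Implicit Arguments.
Unset Strict Implicit.
Unset Printing Implicit Defensive.

Import Order.TTheory GRing.Theory Num.Theory.
Import numFieldNormedType.Exports.
Import Normc.

Local Open Scope classical_set_scope.
Local Open Scope complex_scope.
Local Open Scope ring_scope.

Local Notation Re := (@complex.Re _).
Local Notation Im := (@complex.Im _).

(** * Complex moduli and real limits *)

Section ComplexAux.
Variable R : realType.
Implicit Types z w : R[i].

Lemma normr_normc z : `|z| = (normc z)%:C.
Proof. by rewrite normc_def; case: z. Qed.

Lemma normc_ge0 z : 0 <= normc z.
Proof. by case: z => a b; exact: sqrtr_ge0. Qed.

Lemma mulJc z : z * z^* = (normc z ^+ 2)%:C.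
Proof. by rewrite -normCK normr_normc -rmorphXn. Qed.

Lemma mulcJ z : z^* * z = (normc z ^+ 2)%:C.
Proof. by rewrite mulrC mulJc. Qed.

Lemma normc_conj z : normc (z^*) = normc z.
Proof. by case: z => a b /=; rewrite sqrrN. Qed.

Lemma normc_real (x : R) : normc x%:C = `|x|.
Proof. by rewrite /= expr0n /= addr0 sqrtr_sqr. Qed.

Lemma normc_circle (z : circle R) : normc (z : R[i]) = 1.
Proof. by have := circle_norm1 z; rewrite normr_normc => -[]. Qed.

Lemma Re_le_normc z : `|Re z| <= normc z.
Proof.
case: z => a b /=; rewrite -(ler_sqr (normr_ge0 _)) ?nnegrE ?sqrtr_ge0//.
by rewrite real_normK ?num_real// sqr_sqrtr ?addr_ge0 ?sqr_ge0// lerDl sqr_ge0.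
Qed.

Lemma Im_le_normc z : `|Im z| <= normc z.
Proof.
case: z => a b /=; rewrite -(ler_sqr (normr_ge0 _)) ?nnegrE ?sqrtr_ge0//.
by rewrite real_normK ?num_real// sqr_sqrtr ?addr_ge0 ?sqr_ge0// lerDr sqr_ge0.
Qed.

Lemma complex_ext z w : Re z = Re w -> Im z = Im w -> z = w.
Proof. by case: z => a b; case: w => c d /= -> ->. Qed.

End ComplexAux.

Lemma le_cvg0_eq0 (R : realType) (h : nat -> R) (x : R) : 0 <= x ->
  (\forall n \near \oo, x <= h n) -> h n @[n --> \oo] --> (0 : R) -> x = 0.
Proof.
move=> x0 xh h0; apply/eqP; rewrite eq_le x0 andbT leNgt; apply/negP => xp.
have hx : \forall n \near \oo, h n < x by exact: (cvgr_lt _ h0).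
have [n [/= h1 h2]] := filter_ex (filterI xh hx).
by move: (le_lt_trans h1 h2); rewrite ltxx.
Qed.

Lemma cvgn_eq_lim (R : realType) (a b : nat -> R) (x y : R) : a =1 b ->
  a n @[n --> \oo] --> x -> b n @[n --> \oo] --> y -> x = y.
Proof. by move=> /funext-> /cvg_lim <- // /cvg_lim <-. Qed.

Lemma cvgn_unit_interval (R : realType) (a : nat -> R) (x : R) :
  (forall n, 0 <= a n <= 1) -> a n @[n --> \oo] --> x -> 0 <= x <= 1.
Proof.
move=> a01 ax; have ca : cvgn a by apply/cvg_ex; exists x.
rewrite -(cvg_lim _ ax)//; apply/andP; split.
  by apply: limr_ge ca _; apply: nearW => n; case/andP: (a01 n).
by apply: limr_le ca _; apply: nearW => n; case/andP: (a01 n).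
Qed.

(** * Orthonormal sequences in a space with a scalar product *)

Section DotForm.
Variables (R : realType) (U : lmodType R[i]).
Variable form : {dot U for Num.conj}.
Implicit Types (u v : U) (a : R[i]).

Definition nrm2 u : R := Re (form u u).
Definition nrm u : R := Num.sqrt (nrm2 u).

Lemma form_nrm2 u : form u u = (nrm2 u)%:C.
Proof.
by have /ger0_Im := dnorm_ge0 form u; rewrite /nrm2; case: (form u u) => x y /= ->.
Qed.

Lemma nrm2_ge0 u : 0 <= nrm2 u.
Proof. by have := dnorm_ge0 form u; rewrite form_nrm2 lecR. Qed.

Lemma nrm_ge0 u : 0 <= nrm u. Proof. exact: sqrtr_ge0. Qed.

Lemma sqr_nrm u : nrm u ^+ 2 = nrm2 u.
Proof. by rewrite sqr_sqrtr ?nrm2_ge0. Qed.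

Lemma dot_normE u : dot_norm form u = (nrm u)%:C.
Proof.
apply/eqP; rewrite -(@eqrXn2 _ 2)//; last 2 first.
  by rewrite sqrtC_ge0 dnorm_ge0.
  by rewrite lecR nrm_ge0.
by rewrite sqrtCK -rmorphXn /= sqr_nrm form_nrm2.
Qed.

Lemma nrm_triangle u v : nrm (u + v) <= nrm u + nrm v.
Proof. by have := dot_norm_triangle form u v; rewrite !dot_normE -rmorphD lecR. Qed.

Lemma nrmZ a u : nrm (a *: u) = normc a * nrm u.
Proof.
have := dot_normZ form a u; rewrite !dot_normE normr_normc.
by rewrite -rmorphM => -[].
Qed.

Lemma nrmN u : nrm (- u) = nrm u.
Proof. by rewrite -scaleN1r nrmZ normcN normc_real normr1 mul1r. Qed.

Lemma nrm_triangle_sub u v : nrm u <= nrm v + nrm (u - v).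
Proof. by rewrite -{1}(subrK v u) addrC nrm_triangle. Qed.

Lemma nrm0 : nrm 0 = 0.
Proof. by rewrite -(scale0r 0) nrmZ normc0 mul0r. Qed.

Lemma nrm_eq0 u : nrm u = 0 -> u = 0.
Proof. by move=> u0; apply: (@dot_norm_eq0 _ _ form); rewrite dot_normE u0. Qed.

Lemma nrm_CauchySchwarz u v : normc (form u v) <= nrm u * nrm v.
Proof.
by have := dot_CauchySchwarz form u v; rewrite !dot_normE normr_normc -rmorphM lecR.
Qed.

Lemma formC u v : form u v = (form v u)^*.
Proof. by rewrite hermC expr0 mul1r. Qed.

Lemma nrm2D u v : nrm2 (u + v) = nrm2 u + nrm2 v + Re (form u v) *+ 2.
Proof.
rewrite {1}/nrm2 linearDl !linearDr /= !raddfD /= -/(nrm2 u) -/(nrm2 v).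
by rewrite [form v u]formC; case: (form u v) => x y /=; ring.
Qed.

(** Squared norms are used because they are what integrals and orthonormal
    expansions produce. *)
Definition cvg_form (u_ : nat -> U) (u : U) :=
  nrm2 (u_ n - u) @[n --> \oo] --> (0 : R).

Lemma cvg_formP (u_ : nat -> U) u :
  cvg_form u_ u <-> nrm (u_ n - u) @[n --> \oo] --> (0 : R).
Proof.
split=> h.
  have := @cvg_comp _ _ _ _ (@Num.sqrt R) _ _ _ h (@sqrt_continuous R 0).
  by rewrite sqrtr0.
rewrite /cvg_form; under eq_fun do rewrite -sqr_nrm expr2.
by rewrite -[0](mulr0 0); exact: cvgM.
Qed.

Lemma cvg_form_dotl (u_ : nat -> U) u v c : cvg_form u_ u ->
  (\forall n \near \oo, form (u_ n) v = c) -> form u v = c.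
Proof.
move=> /cvg_formP u_u uc.
apply/eqP; rewrite eq_sym -subr_eq0; apply/eqP/eq0_normc.
apply: (@le_cvg0_eq0 _ (fun n => nrm (u_ n - u) * nrm v)).
- exact: normc_ge0.
- apply: filterS uc => n <-; rewrite -linearBl /=; exact: nrm_CauchySchwarz.
- by rewrite -(mul0r (nrm v)); exact: cvgMl.
Qed.

Lemma cvg_form_nrm2 (u_ : nat -> U) u :
  cvg_form u_ u -> nrm2 (u_ n) @[n --> \oo] --> nrm2 u.
Proof.
move=> /cvg_formP u_u.
have h : nrm (u_ n) @[n --> \oo] --> nrm u.
  apply/cvgrPdist_le => eps e0; have /cvgrPdist_le /(_ eps e0) := u_u.
  apply: filterS => n; rewrite sub0r normrN (ger0_norm (nrm_ge0 _)) => h.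
  have h1 := nrm_triangle_sub (u_ n) u; have h2 := nrm_triangle_sub u (u_ n).
  by rewrite -(nrmN (_ - _)) opprB in h2; rewrite ler_norml; apply/andP; split; lra.
under eq_fun do rewrite -sqr_nrm expr2.
by rewrite -sqr_nrm expr2; exact: cvgM.
Qed.

(** Completeness, with the Cauchy condition on squared norms of ordered pairs:
    this is the form in which blocks of an orthonormal series satisfy it. *)
Definition form_complete := forall u_ : nat -> U,
  (forall eps : R, 0 < eps -> exists N, forall m n, (N <= m <= n)%N ->
    nrm2 (u_ n - u_ m) <= eps) ->
  exists u, cvg_form u_ u.

Section Orthonormal.
Variable e : nat -> U.
Hypothesis eON : forall i j, form (e i) (e j) = (i == j)%:R.
Implicit Types c : nat -> R[i].

Definition psum c n : U := \sum_(i < n) c i *: e i.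

Lemma psum0 c : psum c 0 = 0. Proof. exact: big_ord0. Qed.

Lemma psumS c n : psum c n.+1 = c n *: e n + psum c n.
Proof. by rewrite /psum big_ord_recr /= addrC. Qed.

Lemma form_psum c n j : form (psum c n) (e j) = if (j < n)%N then c j else 0.
Proof.
rewrite linear_sumlz.
under eq_bigr do rewrite linearZl_LR /= eON.
case: ltnP => jn.
  rewrite (bigD1 (Ordinal jn)) //= eqxx mulr1 big1 ?addr0// => i ij.
  by rewrite (_ : (_ == _) = false) ?mulr0//; apply/negbTE; apply: contra ij.
rewrite big1// => i _; rewrite (_ : (_ == _) = false) ?mulr0//.
by apply/negbTE; rewrite neq_ltn (leq_trans (ltn_ord i) jn).
Qed.

Lemma nrm2_sum c (r : seq nat) : uniq r ->
  nrm2 (\sum_(i <- r) c i *: e i) = \sum_(i <- r) normc (c i) ^+ 2.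
Proof.
elim: r => [|i r IH] /=; first by rewrite !big_nil -sqr_nrm nrm0 expr0n.
move=> /andP[ir ur]; rewrite !big_cons nrm2D IH// linearZl_LR /=.
rewrite (_ : form _ _ = 0) ?mulr0 /= ?mul0rn ?addr0; last first.
  rewrite linear_sumr /= big_seq big1// => j jr.
  rewrite linearZr_LR /= eON (_ : (_ == _) = false) ?mulr0//.
  by apply/negbTE; apply: contraNneq ir => ->.
by rewrite -sqr_nrm nrmZ /nrm /nrm2 eON eqxx /= sqrtr1 mulr1.
Qed.

Lemma nrm2_psum c n : nrm2 (psum c n) = \sum_(i < n) normc (c i) ^+ 2.
Proof.
rewrite /psum -(big_mkord xpredT (fun i => c i *: e i)) nrm2_sum ?iota_uniq//.
by rewrite big_mkord.
Qed.

Lemma nrm2_psumB c m n : (m <= n)%N ->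
  nrm2 (psum c n - psum c m) = \sum_(m <= i < n) normc (c i) ^+ 2.
Proof.
move=> mn; rewrite /psum -!(big_mkord xpredT (fun i => c i *: e i)).
by rewrite (big_cat_nat (leq0n m) mn) /= addrAC subrr add0r nrm2_sum ?iota_uniq.
Qed.

Local Notation coef u := (fun n => form u (e n)).

Lemma nrm2_sub_psum u n :
  nrm2 (u - psum (coef u) n) = nrm2 u - \sum_(i < n) normc (form u (e i)) ^+ 2.
Proof.
rewrite nrm2D -(nrm2_psum (coef u)).
have -> : nrm2 (- psum (coef u) n) = nrm2 (psum (coef u) n).
  by rewrite -!sqr_nrm nrmN.
have -> : form u (- psum (coef u) n) = - (nrm2 (psum (coef u) n))%:C.
  rewrite linearNr; congr (- _); rewrite linear_sumr /=.
  under eq_bigr do rewrite linearZr_LR /= mulcJ.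
  by rewrite -rmorph_sum /= (nrm2_psum (coef u)).
by rewrite raddfN /= mulr2n; lra.
Qed.

Lemma bessel u n : \sum_(i < n) normc (form u (e i)) ^+ 2 <= nrm2 u.
Proof. by rewrite -subr_ge0 -nrm2_sub_psum nrm2_ge0. Qed.

(** The squared distance between two partial sums is a block of the convergent
    series of squared moduli, so the partial sums are Cauchy. *)
Lemma riesz_fischer c : form_complete ->
  cvgn (series (fun n => normc (c n) ^+ 2)) ->
  exists u, cvg_form (psum c) u.
Proof.
move=> cU cc; apply: cU => eps e0.
set S := series _ in cc.
have Snd : {homo S : n m / (n <= m)%N >-> n <= m}.
  by apply: nondecreasing_series => n _ _; exact: sqr_ge0.
have /cvgrPdist_le /(_ eps e0) [N _ hN] := cc.
exists N => m n /andP[Nm mn]; rewrite nrm2_psumB//.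
have -> : \sum_(m <= i < n) normc (c i) ^+ 2 = S n - S m.
  by rewrite /S sub_series_geq.
have /= := hN _ Nm.
have := nondecreasing_cvgn_le Snd cc n; have := nondecreasing_cvgn_le Snd cc m.
by rewrite ler_norml => h1 h2 /andP[h3 h4]; lra.
Qed.

Lemma cvg_psum_coef c u j : cvg_form (psum c) u -> form u (e j) = c j.
Proof.
move=> h; apply: (cvg_form_dotl h); near=> n.
by rewrite form_psum ifT//; near: n; exact: nbhs_infty_gt.
Unshelve. all: by end_near. Qed.

Lemma cvg_series_coef u : cvgn (series (fun n => normc (form u (e n)) ^+ 2)).
Proof.
apply: nondecreasing_is_cvgn.
  by apply: nondecreasing_series => n _ _; exact: sqr_ge0.
by exists (nrm2 u) => _ [n _ <-]; rewrite /series /= big_mkord bessel.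
Qed.

Hypothesis complete : form_complete.
Hypothesis total : forall u, (forall n, form u (e n) = 0) -> u = 0.

(** By Bessel's inequality the expansion of u converges; its sum has the
    coefficients of u, hence equals u by totality. *)
Lemma cvg_psum u : cvg_form (psum (coef u)) u.
Proof.
have [v hv] := riesz_fischer complete (@cvg_series_coef u).
suff uv : u = v by rewrite {2}uv.
apply/eqP; rewrite -subr_eq0; apply/eqP/total => n.
by rewrite linearBl /= (cvg_psum_coef n hv) subrr.
Qed.

Lemma parseval u :
  series (fun n => normc (form u (e n)) ^+ 2) n @[n --> \oo] --> nrm2 u.
Proof.
have := cvg_form_nrm2 (cvg_psum u); under eq_fun do rewrite nrm2_psum.
by rewrite /series /=; under [X in _ -> X @ _ --> _]eq_fun do rewrite big_mkord.
Qed.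

End Orthonormal.

End DotForm.

Section LinearFunction.
Variables (K : nzRingType) (U V : lmodType K) (T : U -> V).
Hypothesis lT : linear T.

Lemma linear_funD u v : T (u + v) = T u + T v.
Proof. by rewrite -[u in LHS]scale1r lT scale1r. Qed.

Lemma linear_fun0 : T 0 = 0.
Proof. by apply: (addrI (T 0)); rewrite -linear_funD !addr0. Qed.

Lemma linear_funZ a u : T (a *: u) = a *: T u.
Proof. by rewrite -[a *: u in LHS]addr0 lT linear_fun0 addr0. Qed.

Lemma linear_funB u v : T (u - v) = T u - T v.
Proof. by rewrite -scaleN1r addrC lT scaleN1r addrC. Qed.

End LinearFunction.

Section FormConvergence.
Variables (R : realType) (U V : lmodType R[i]).
Variables (dU : {dot U for Num.conj}) (dV : {dot V for Num.conj}).

Lemma cvg_form_unique (u_ : nat -> U) (u v : U) :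
  cvg_form dU u_ u -> cvg_form dU u_ v -> u = v.
Proof.
move=> /cvg_formP u_u /cvg_formP u_v; apply/eqP; rewrite -subr_eq0; apply/eqP.
apply: (@nrm_eq0 _ _ dU).
apply: (@le_cvg0_eq0 _ (fun n => nrm dU (u_ n - v) + nrm dU (u_ n - u))).
- exact: nrm_ge0.
- apply: nearW => n; rewrite -(nrmN _ (u_ n - u)).
  apply: le_trans (nrm_triangle _ _ _); rewrite (_ : _ + _ = u - v)//.
  by rewrite opprB [LHS]addrC addrA subrK.
- by rewrite -[0](addr0 0); exact: cvgD.
Qed.

Lemma cvg_form_bounded (T : U -> V) (M : R) (u_ : nat -> U) (u : U) :
  linear T -> (forall u, nrm dV (T u) <= M * nrm dU u) ->
  cvg_form dU u_ u -> cvg_form dV (T \o u_) (T u).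
Proof.
move=> lT hM /cvg_formP u_u; apply/cvg_formP.
apply: (@squeeze_cvgr _ _ _ _ (cst 0) (fun n => M * nrm dU (u_ n - u))).
- by apply: nearW => n; rewrite nrm_ge0 /= -linear_funB.
- exact: cvg_cst.
- by rewrite -[0](mulr0 M); exact: cvgMr.
Qed.

Lemma linear_psum (T : U -> V) (e : nat -> U) c n : linear T ->
  T (psum e c n) = psum (T \o e) c n.
Proof.
move=> lT; elim: n => [|n IH]; first by rewrite !psum0 (linear_fun0 lT).
by rewrite !psumS lT IH.
Qed.

Lemma form_psum_eq0 (e : nat -> U) c n v : (forall i, dU (e i) v = 0) ->
  dU (psum e c n) v = 0.
Proof.
move=> ev; rewrite /psum linear_sumlz /= big1// => i _.
by rewrite linearZl_LR /= ev mulr0.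
Qed.

End FormConvergence.

Section Isometry.
Variables (R : realType) (U V : lmodType R[i]).
Variables (dU : {dot U for Num.conj}) (dV : {dot V for Num.conj}).
Variable T : U -> V.
Hypothesis lT : linear T.

(** Polarization: the norms of u, v and u + v determine the real part of the
    scalar product of u and v, and replacing v by 'i v gives the imaginary part. *)
Lemma isometry_dot : (forall u, nrm2 dV (T u) = nrm2 dU u) ->
  forall u v, dV (T u) (T v) = dU u v.
Proof.
move=> iT; have iRe u v : Re (dV (T u) (T v)) = Re (dU u v).
  have := iT (u + v); rewrite (linear_funD lT) !nrm2D !iT => /addrI/eqP.
  by rewrite eqr_pMn2r// => /eqP.
move=> u v; apply: complex_ext; first exact: iRe.
have := iRe u ('i *: v); rewrite (linear_funZ lT) /= !linearZr_LR /=.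
by case: (dV _ _) => a b; case: (dU _ _) => c d /=; lra.
Qed.

End Isometry.

(** * Sums over the integers as series *)

Section CountingInt.

(** The enumeration 0, -1, 1, -2, 2, etc. *)
Definition int_of_idx (n : nat) : int := if odd n then Negz n./2 else Posz n./2.
Definition idx_of_int (k : int) : nat :=
  match k with Posz n => n.*2 | Negz n => n.*2.+1 end.

Lemma int_of_idxK : cancel int_of_idx idx_of_int.
Proof.
move=> n; rewrite /int_of_idx -[RHS](odd_double_half n).
by case: (odd n) => /=; rewrite ?add0n ?add1n.
Qed.

Lemma idx_of_intK : cancel idx_of_int int_of_idx.
Proof.
by case=> n; rewrite /int_of_idx /= odd_double /= ?doubleK ?uphalf_double.
Qed.

Lemma counting_preimage_bij (T1 T2 : choiceType) (R : realType) (e : T1 -> T2)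
    (e' : T2 -> T1) (A : set T2) : cancel e e' -> cancel e' e ->
  counting (e @^-1` A) = counting A :> \bar R.
Proof.
move=> ee' e'e; have -> : e @^-1` A = e' @` A.
  apply/seteqP; split=> [x Aex|_ [y Ay <-]]; last by rewrite /= e'e.
  by exists (e x).
have cA : (e' @` A #= A)%card.
  by apply: inj_card_eq => x y _ _; exact: (can_inj e'e).
rewrite /counting (eq_finite_set cA); case: ifPn => // /asboolP finA.
by rewrite ((fcard_eq (finite_image e' finA) finA) cA).
Qed.

(** The enumeration of the integers carries the counting measure of nat to that
    of int, so that orthonormal families indexed by int reduce to sequences. *)
Lemma ge0_integral_counting_int (R : realType) (f : int -> \bar R) :
  (forall k, 0 <= f k)%E ->
  (\int[counting]_k f k = \sum_(n <oo) f (int_of_idx n))%E.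
Proof.
move=> f0; rewrite -ge0_integral_count//.
have me : measurable_fun [set: nat] int_of_idx by [].
rewrite -[RHS]/(\int[counting]_(k in int_of_idx @^-1` [set: int])
  (f \o int_of_idx) k)%E.
rewrite -(ge0_integral_pushforward me)//.
apply: eq_measure_integral => A _ _.
apply/esym; exact: (counting_preimage_bij _ _ int_of_idxK idx_of_intK).
Qed.

End CountingInt.

(** * Square-integrable functions and dominated convergence *)

Section SquareIntegrable.
Context d (T : measurableType d) (R : realType).
Variable mu : {measure set T -> \bar R}.
Implicit Types f g h u : T -> R[i].

Lemma measurable_normc f : cmeasurable f ->
  measurable_fun [set: T] (fun x => normc (f x)).
Proof.
move=> mf; rewrite (_ : (fun _ => _) = Num.sqrt \o (fun x => normc (f x) ^+ 2)).
  apply: measurableT_comp (measurable_normc2 mf).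
  by apply: continuous_measurable_fun; exact: sqrt_continuous.
by apply/funext => x; rewrite /= sqrtr_sqr ger0_norm ?normc_ge0.
Qed.

Lemma cmeasurable_conj f : cmeasurable f -> cmeasurable (fun x => (f x)^*).
Proof.
move=> [m1 m2]; split.
  by rewrite (_ : _ \o _ = Re \o f)//; apply/funext => x /=; case: (f x).
rewrite (_ : _ \o _ = fun x => - Im (f x)); last first.
  by apply/funext => x /=; case: (f x).
exact: measurableT_comp.
Qed.

Lemma cmeasurableM f g : cmeasurable f -> cmeasurable g ->
  cmeasurable (fun x => f x * g x).
Proof.
move=> mf mg; have := cmeasurable_mulJ mf (cmeasurable_conj mg).
by under eq_fun do rewrite conjCK.
Qed.

Lemma cmeasurable_cst (c : R[i]) : cmeasurable (fun _ : T => c).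
Proof. by split; exact: measurable_cst. Qed.

Lemma cmeasurableD f g : cmeasurable f -> cmeasurable g ->
  cmeasurable (fun x => f x + g x).
Proof.
by move=> mf mg; have := cmeasurableZD 1 mf mg; under eq_fun do rewrite mul1r.
Qed.

Lemma cmeasurable_real (h : T -> R) : measurable_fun [set: T] h ->
  cmeasurable (fun x => (h x)%:C).
Proof. by move=> mh; split => //; exact: measurable_cst. Qed.

Lemma cmeasurableB f g : cmeasurable f -> cmeasurable g ->
  cmeasurable (fun x => f x - g x).
Proof.
move=> mf mg; have := cmeasurableZD (-1) mg mf.
by under eq_fun do rewrite mulN1r addrC.
Qed.

Lemma square_integrable_le f g (C : R) : cmeasurable f -> square_integrable mu g ->
  (\forall x \ae mu, normc (f x) <= C * normc (g x)) -> square_integrable mu f.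
Proof.
move=> mf sg fg; split=> //.
have Cg : mu.-integrable [set: T] (fun x => (C ^+ 2)%:E * (normc (g x) ^+ 2)%:E)%E.
  by apply: integrableZl => //; exact: square_integrable_int.
apply: (@le_lt_trans _ _ (\int[mu]_x ((C ^+ 2)%:E * (normc (g x) ^+ 2)%:E))%E).
  apply: ae_ge0_le_integral => //.
  - by move=> x _; rewrite lee_fin sqr_ge0.
  - by apply/measurable_EFinP; exact: measurable_normc2.
  - by move=> x _; rewrite -EFinM lee_fin mulr_ge0 ?sqr_ge0.
  - exact: measurable_int Cg.
  apply: filterS fg => x h _; rewrite -EFinM lee_fin -exprMn.
  by rewrite ler_pXn2r// nnegrE ?normc_ge0// (le_trans _ h) ?normc_ge0.
have /integrableP[_] := Cg; apply: le_lt_trans; rewrite le_eqVlt.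
apply/orP; left; apply/eqP/eq_integral => x _.
by rewrite -EFinM /= ger0_norm// mulr_ge0// sqr_ge0.
Qed.

(** Dominated convergence, the squared modulus of u being the dominating function. *)
Lemma cvg_mul_square_integrable (m_ : nat -> T -> R[i]) u :
  square_integrable mu u -> (forall n, cmeasurable (m_ n)) ->
  (forall n x, normc (m_ n x) <= 1) ->
  (forall x, normc (m_ n x * u x) @[n --> \oo] --> (0 : R)) ->
  \int[mu]_x (normc (m_ n x * u x) ^+ 2) @[n --> \oo] --> (0 : R).
Proof.
move=> su mm m1 m0.
have [] := @dominated_convergence _ _ _ mu _ measurableT
  (fun n x => (normc (m_ n x * u x) ^+ 2)%:E) (cst 0%E)
  (fun x => (normc (u x) ^+ 2)%:E).
- move=> n; apply/measurable_EFinP; apply: measurable_normc2.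
  by apply: cmeasurableM => //; exact: su.1.
- exact: measurable_cst.
- apply: aeW => x _ /=; apply: cvg_EFin; first exact: nearW.
  rewrite (_ : _ \o _ = fun n => normc (m_ n x * u x) * normc (m_ n x * u x)).
    by rewrite -[0](mulr0 0); exact: cvgM.
  by apply/funext => n /=; rewrite expr2.
- exact: square_integrable_int.
- apply: aeW => x n _; rewrite /= ger0_norm ?sqr_ge0// lee_fin normcM exprMn.
  rewrite ler_piMl ?sqr_ge0// expr_le1//; exact: normc_ge0.
move=> _ _; rewrite integral0 => /fine_cvg; exact.
Qed.

End SquareIntegrable.

(** * Completeness of L^2 *)

Lemma cvgn_geometric_increments (R : realType) (a : nat -> R) (c : R) :
  (forall k, `|a k.+1 - a k| <= c * 2^-1 ^+ k) -> cvgn a.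
Proof.
move=> ac; have c0 : 0 <= c.
  by have := ac 0%N; rewrite expr0 mulr1; apply: le_trans.
have cs : cvgn (series (telescope a)).
  apply: normed_cvg; apply: (@series_le_cvg _ _ (geometric c 2^-1)) => //.
  - by move=> n; exact: normr_ge0.
  - by move=> n; rewrite /geometric /= mulr_ge0// exprn_ge0// invr_ge0.
  - apply: is_cvg_geometric_series; rewrite ger0_norm// invf_lt1//; lra.
rewrite (_ : a = cst (a 0%N) \+ series (telescope a)).
  by apply: is_cvgD => //; exact: is_cvg_cst.
by apply/funext => n /=; rewrite [LHS]eq_sum_telescope.
Qed.

Section L2.
Context d (T : measurableType d) (R : realType).
Variable mu : {measure set T -> \bar R}.
Implicit Types f g : T -> R[i].
Local Notation L2 := (L2 mu).
Local Notation dot := (@L2_dot _ T R mu).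

(** The class of f when f is square-integrable, and 0 otherwise: totality spares
    a proof argument in every operator built from it. *)
Definition L2_of f : L2 := \pi_(L2)%qT (insubd (0 : L2fun mu) f).

Lemma repr_L2_of f : square_integrable mu f -> repr (L2_of f) = f %[ae mu].
Proof.
move=> sf; apply: ae_eq_trans (repr_pi _) _.
by rewrite insubdK; [exact: ae_eq_refl|exact/asboolP].
Qed.

Lemma L2_of_repr (u : L2) f : repr u = f %[ae mu] -> cmeasurable f -> u = L2_of f.
Proof.
move=> uf mf; apply/eq_L2P; apply: (ae_eq_trans uf).
apply: ae_eq_sym; apply: repr_L2_of.
apply: (square_integrable_le (C := 1) mf (L2funP (repr u))).
by apply: filterS uf => x /(_ Logic.I) ->; rewrite mul1r.
Qed.

Lemma nrm2_L2 (u : L2) f : cmeasurable f -> repr u = f %[ae mu] ->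
  nrm2 dot u = \int[mu]_x (normc (f x) ^+ 2).
Proof.
move=> mf uf. 
transitivity (Re (cintegral mu (fun x => repr u x * (repr u x)^*))) => //.
rewrite cintegral_mulJ /= /Rintegral; congr fine.
apply: ae_eq_integral => //.
- by apply/measurable_EFinP/measurable_normc2; exact: (L2funP _).1.
- by apply/measurable_EFinP/measurable_normc2.
by apply: filterS uf => x /(_ Logic.I) -> _.
Qed.

Lemma L2_dotE (u v : L2) f g : cmeasurable f -> cmeasurable g ->
  repr u = f %[ae mu] -> repr v = g %[ae mu] ->
  dot u v = cintegral mu (fun x => f x * (g x)^*).
Proof.
move=> mf mg uf vg; apply: ae_eq_cintegral.
- by apply: cmeasurable_mulJ; exact: (L2funP _).1.
- exact: cmeasurable_mulJ.
by apply: filterS2 uf vg => x /(_ Logic.I) -> /(_ Logic.I) -> _.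
Qed.

Lemma repr_sub (u v : L2) : repr (u - v) = (fun x => repr u x - repr v x) %[ae mu].
Proof.
have := repr_scale (-1) v; rewrite -[L2_scale _ _]/(-1 *: v) scaleN1r => h.
apply: filterS2 h (repr_add u (- v)) => x /(_ Logic.I) e /(_ Logic.I) -> _.
by rewrite e mulN1r.
Qed.

Lemma nrm2_L2_EFin (u : L2) :
  (nrm2 dot u)%:E = (\int[mu]_x (normc (repr u x) ^+ 2)%:E)%E.
Proof.
rewrite (nrm2_L2 (L2funP _).1 (ae_eq_refl _ _ _)) /Rintegral fineK//.
exact/integrable_fin_num/square_integrable_int/L2funP.
Qed.

Lemma nrm2_L2_subE (u v : L2) :
  (nrm2 dot (u - v))%:E = (\int[mu]_x (normc (repr u x - repr v x) ^+ 2)%:E)%E.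
Proof.
rewrite nrm2_L2_EFin; apply: ae_eq_integral => //.
- by apply/measurable_EFinP/measurable_normc2; exact: (L2funP _).1.
- by apply/measurable_EFinP/measurable_normc2/cmeasurableB; exact: (L2funP _).1.
by apply: filterS (repr_sub u v) => x /(_ Logic.I) -> _.
Qed.

Let normc2_emeasurable f : cmeasurable f ->
  measurable_fun [set: T] (fun x => (normc (f x) ^+ 2)%:E).
Proof. by move=> mf; apply/measurable_EFinP; exact: measurable_normc2. Qed.

Let cmeasurable_repr (u : L2) : cmeasurable (repr u).
Proof. exact: (L2funP _).1. Qed.

(** The sum over k of 4^k |v_(k+1) - v_k|^2 has integral at most the sum of the
    (1/2)^k, so it is finite almost everywhere, and there the increments of v are
    dominated by a multiple of (1/2)^k. *)
Lemma ae_cvg_fast_cauchy (v : nat -> L2) :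
  (forall k, nrm2 dot (v k.+1 - v k) <= 8^-1 ^+ k) ->
  {ae mu, forall x, cvgn (fun k => Re (repr (v k) x)) /\
                    cvgn (fun k => Im (repr (v k) x))}.
Proof.
move=> hv; pose D k x := normc (repr (v k.+1) x - repr (v k) x).
pose G x := (\sum_(k <oo) (4 ^+ k * D k x ^+ 2)%:E)%E.
have mD k : measurable_fun [set: T] (fun x => (D k x ^+ 2)%:E).
  by apply: normc2_emeasurable; exact: cmeasurableB.
have mt k : measurable_fun [set: T] (fun x => (4 ^+ k * D k x ^+ 2)%:E).
  by under eq_fun do rewrite EFinM; exact: emeasurable_funM.
have t0 k x : (0 <= (4 ^+ k * D k x ^+ 2)%:E)%E.
  by rewrite lee_fin mulr_ge0 ?sqr_ge0 ?exprn_ge0.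
have iG : mu.-integrable [set: T] G.
  apply/integrableP; split; first exact: ge0_emeasurable_sum.
  have -> : (\int[mu]_x `|G x| = \int[mu]_x G x)%E.
    by apply: eq_integral => x _; rewrite gee0_abs// nneseries_ge0.
  rewrite integral_nneseries//.
  apply: (@le_lt_trans _ _ 2%:E); last exact: ltry.
  apply: lime_le; first by apply: is_cvg_nneseries => n _ _; exact: integral_ge0.
  apply: nearW => n.
  apply: (@le_trans _ _ (\sum_(0 <= k < n) (2^-1 ^+ k)%:E)%E).
    apply: lee_sum => k _; under eq_integral do rewrite EFinM.
    rewrite ge0_integralZl//; last by move=> x _; rewrite lee_fin sqr_ge0.
    rewrite -nrm2_L2_subE -EFinM lee_fin.
    apply: (@le_trans _ _ (4 ^+ k * 8^-1 ^+ k)).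
      by rewrite ler_wpM2l// exprn_ge0.
    rewrite -exprMn (_ : 4 * 8^-1 = 2^-1)//; lra.
  rewrite sumEFin lee_fin.
  have := @geometric_le_lim R n 1 2^-1; rewrite /series /geometric /=.
  under eq_bigr do rewrite mul1r.
  move=> /(_ ler01); rewrite (_ : 1 - 2^-1 = 2^-1) ?div1r ?invrK; last by lra.
  by apply; [lra|rewrite ger0_norm; lra].
apply: filterS (integrable_ae measurableT iG) => x /(_ Logic.I) Gx.
pose g := fine (G x).
have Dg k : D k x <= Num.sqrt g * 2^-1 ^+ k.
  have h : 4 ^+ k * D k x ^+ 2 <= g.
    rewrite -lee_fin /g fineK//.
    apply: le_trans (nneseries_lim_ge k.+1 (fun n _ _ => t0 n x)).
    by rewrite big_nat_recr//= leeDr// sume_ge0.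
  have g0 : 0 <= g by apply: le_trans h; rewrite mulr_ge0 ?sqr_ge0 ?exprn_ge0.
  have s0 : 0 <= Num.sqrt g * 2^-1 ^+ k.
    by rewrite mulr_ge0 ?sqrtr_ge0 ?exprn_ge0 ?invr_ge0.
  rewrite -(@ler_pXn2r _ 2)// ?nnegrE ?normc_ge0//.
  rewrite exprMn sqr_sqrtr// -exprM mulnC exprM (_ : 2^-1 ^+ 2 = 4^-1); last by field.
  by rewrite exprVn ler_pdivlMr ?exprn_gt0// mulrC.
split; apply: (@cvgn_geometric_increments _ _ (Num.sqrt g)) => k.
  by apply: le_trans (Dg k); rewrite -raddfB; exact: Re_le_normc.
by apply: le_trans (Dg k); rewrite -raddfB; exact: Im_le_normc.
Qed.

(** A fast Cauchy subsequence converges almost everywhere; by Fatou's lemma, the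
    distance of a term of the sequence to the almost everywhere limit is at most the
    inferior limit of its distances to the terms of the subsequence. *)
Lemma L2_complete : form_complete dot.
Proof.
move=> u_ cau.
have /choice[N_ hN] : forall k, exists N, forall m n, (N <= m <= n)%N ->
    nrm2 dot (u_ n - u_ m) <= 8^-1 ^+ k.
  by move=> k; apply: cau; rewrite exprn_gt0.
pose phi k := (\sum_(i < k.+1) (N_ i).+1)%N.
have phiS k : (phi k <= phi k.+1)%N by rewrite /phi [leqRHS]big_ord_recr leq_addr.
have phiN k : (N_ k <= phi k)%N by rewrite /phi big_ord_recr /= addnS leqW// leq_addl.
have phik k : (k <= phi k)%N.
  elim: k => // k IH; rewrite /phi big_ord_recr /= addnS ltnS (leq_trans IH)//.
  exact: leq_addr.
pose w k := repr (u_ (phi k)).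
have cw : {ae mu, forall x, cvgn (fun k => Re (w k x)) /\ cvgn (fun k => Im (w k x))}.
  apply: (@ae_cvg_fast_cauchy (fun k => u_ (phi k))) => k; apply: hN.
  by rewrite phiN phiS.
(* The superior limit is a measurable function, whether or not the subsequence
   converges at every point. *)
pose lim_ (a : nat -> R) := fine (limn_esup (EFin \o a)).
have lim_E a : cvgn a -> a n @[n --> \oo] --> lim_ a.
  move=> ca; rewrite /lim_ (_ : limn_esup _ = (limn a)%:E)//.
  by apply: (cvg_limn_einf_sup _).2; apply: cvg_EFin => //; exact: nearW.
pose f x := lim_ (fun k => Re (w k x)) +i* lim_ (fun k => Im (w k x)).
have mf : cmeasurable f.
  have ml (a : nat -> T -> R) : (forall k, measurable_fun [set: T] (a k)) ->
      measurable_fun [set: T] (fun x => lim_ (fun k => a k x)).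
    move=> ma; apply: (measurableT_comp (@fine_measurable R setT _)) => //.
    by apply: measurable_fun_limn_esup => k; apply/measurable_EFinP.
  by split; apply: ml => k; [exact: (cmeasurable_repr _).1|exact: (cmeasurable_repr _).2].
have wf : {ae mu, forall x, forall z,
    normc (z - w k x) ^+ 2 @[k --> \oo] --> normc (z - f x) ^+ 2}.
  apply: filterS cw => x [/lim_E c1 /lim_E c2] z; under eq_fun do rewrite normcE2 !raddfB.
  rewrite normcE2 !raddfB !expr2.
  by apply: cvgD; apply: cvgM; apply: cvgB => //; exact: cvg_cst.
have key eps N n : (forall m n, (N <= m <= n)%N -> nrm2 dot (u_ n - u_ m) <= eps) ->
    (N <= n)%N -> (\int[mu]_x (normc (repr (u_ n) x - f x) ^+ 2)%:E <= eps%:E)%E.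
  move=> hNe Nn.
  have mg k : measurable_fun [set: T] (fun x => (normc (repr (u_ n) x - w k x) ^+ 2)%:E).
    exact: normc2_emeasurable (cmeasurableB (cmeasurable_repr _) (cmeasurable_repr _)).
  have := @fatou _ _ _ mu _ measurableT _ mg.
  have g0 k x : [set: T] x -> (0 <= (normc (repr (u_ n) x - w k x) ^+ 2)%:E)%E.
    by move=> _; rewrite lee_fin sqr_ge0.
  move=> /(_ g0).
  rewrite (_ : (\int[mu]_x limn_einf _)%E =
      (\int[mu]_x (normc (repr (u_ n) x - f x) ^+ 2)%:E)%E); last first.
    apply: ae_eq_integral => //.
    - under eq_fun do rewrite -[limn_einf _]oppeK -limn_esupN.
      apply: measurableT_comp => //; apply: measurable_fun_limn_esup => k /=.
      by under eq_fun do rewrite EFinN; exact: measurableT_comp (mg k).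
    - by apply: normc2_emeasurable; exact: cmeasurableB.
    apply: filterS wf => x /(_ (repr (u_ n) x)) h _.
    by apply: (cvg_limn_einf_sup _).1; apply: cvg_EFin => //; exact: nearW.
  move=> /le_trans; apply; rewrite limn_einf_lim; apply: lime_le.
    exact: is_cvg_einfs.
  apply: nearW => k.
  apply: (@le_trans _ _
    (\int[mu]_x (normc (repr (u_ n) x - w (k + n)%N x) ^+ 2)%:E)%E).
    by apply: ereal_inf_lbound; exists (k + n)%N => //=; rewrite leq_addr.
  rewrite -nrm2_L2_subE lee_fin -sqr_nrm -nrmN opprB sqr_nrm.
  by apply: hNe; rewrite Nn (leq_trans (leq_addl k n)).
have [N1 hN1] := cau 1 ltr01.
have sB : square_integrable mu (fun x => repr (u_ N1) x - f x).
  split; first exact: cmeasurableB.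
  by apply: le_lt_trans (key _ _ _ hN1 (leqnn _)) (ltry _).
have sf : square_integrable mu f.
  have := square_integrableZD (-1) sB (L2funP (repr (u_ N1))).
  by under eq_fun do rewrite mulN1r opprB subrK.
exists (L2_of f); apply/cvgrPdist_le => eps e0.
have [N hNe] := cau eps e0.
exists N => // n /= Nn; rewrite sub0r normrN ger0_norm ?nrm2_ge0//.
rewrite -lee_fin nrm2_L2_subE.
apply: le_trans (key _ _ _ hNe Nn); rewrite le_eqVlt; apply/orP; left; apply/eqP.
apply: ae_eq_integral => //.
- by apply: normc2_emeasurable; exact: cmeasurableB.
- by apply: normc2_emeasurable; exact: cmeasurableB.
by apply: filterS (repr_L2_of sf) => x /(_ Logic.I) -> _.
Qed.

End L2.

(** * Integrals of the trigonometric monomials *)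

Section CircleIntegral.
Variable R : realType.
Local Notation haar := (@haar R).
Implicit Types (z : circle R) (k : int).

(** The trigonometric monomial of degree k. *)
Definition ez k z : R[i] := (z : R[i]) ^ k.

Lemma ezD j k z : ez (j + k) z = ez j z * ez k z.
Proof. by rewrite /ez expfzDr// circle_neq0. Qed.

Lemma ez0 z : ez 0 z = 1. Proof. by []. Qed.

Lemma ez1 z : ez 1 z = z. Proof. by []. Qed.

Lemma normc_ez k z : normc (ez k z) = 1.
Proof.
have h n : normc ((z : R[i]) ^+ n) = 1.
  have : `|(z : R[i]) ^+ n| = 1 by rewrite normrX circle_norm1 expr1n.
  by rewrite normr_normc => -[].
by case: k => n; [exact: h|rewrite /ez /= normcV h invr1].
Qed.

Lemma ezN k z : ez (- k) z = (ez k z)^*.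
Proof.
have ez_neq0 : ez k z != 0 by rewrite expfz_neq0 ?circle_neq0.
rewrite /ez -invr_expz -[_^-1]mulr1 -/(ez k z).
apply: (mulfI ez_neq0); rewrite mulrA mulfV// mul1r mulJc normc_ez.
by rewrite expr1n.
Qed.

Lemma circle_expg n z : ((z ^+ n)%g : R[i]) = (z : R[i]) ^+ n.
Proof. by elim: n => // n IH; rewrite expgS exprS /= IH. Qed.

Lemma ez_expg n k z : ez k (z ^+ n)%g = ez (n%:Z * k) z.
Proof. by rewrite /ez circle_expg exprnP exprz_exp. Qed.

Lemma cmeasurable_circle : cmeasurable (fun z => z : R[i]).
Proof.
have mc : measurable_fun [set: circle R] (@circle_coord R).
  move=> _ B mB; exists B => //; rewrite setTI//.
split.
  by have := measurableT_comp measurable_fst mc.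
by have := measurableT_comp measurable_snd mc.
Qed.

Lemma cmeasurable_ez k : cmeasurable (ez k).
Proof.
have h n : cmeasurable (ez (Posz n)).
  elim: n => [|n IH]; first by rewrite (_ : ez _ = fun=> 1)//; exact: cmeasurable_cst.
  rewrite (_ : ez _ = fun z => (z : R[i]) * ez n z).
    exact: cmeasurableM cmeasurable_circle IH.
  by apply/funext => z; rewrite /ez /= exprSz.
case: k => n //; rewrite NegzE.
rewrite (_ : ez _ = fun z => (ez n.+1 z)^*); first exact: cmeasurable_conj.
by apply/funext => z; exact: ezN.
Qed.

Lemma ez_expi n (t : R) :
  ez (Posz n) (expi t) = cos (2 * pi * n%:R * t) +i* sin (2 * pi * n%:R * t).
Proof.
elim: n => [|n IH]; first by rewrite ez0 mulr0 mul0r cos0 sin0.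
have -> : 2 * pi * n.+1%:R * t = 2 * pi * n%:R * t + 2 * pi * t.
  by rewrite -[n.+1%:R]natr1; ring.
rewrite intS addrC ezD IH ez1 cosD sinD /=.
by simpc; congr (_ +i* _); rewrite addrC.
Qed.

Lemma cos_sin_2pin n : cos (2 * pi * n%:R) = 1 :> R /\ sin (2 * pi * n%:R) = 0 :> R.
Proof.
have := ez_expi n 1; rewrite mulr1 => e.
suff : ez n (expi 1) = 1 by rewrite e => -[-> ->].
have e1 : circle_val (expi 1) = 1 :> R[i].
  by rewrite /expi /= mulr1 mulr_natl cos2pi sin2pi.
by rewrite /ez e1 exp1rz.
Qed.

(** Adding 1 makes the integrands nonnegative, so that the integral against the
    uniform distribution is a Lebesgue integral over [0, 1]. There the primitives
    t + sin (a t) / a and t - cos (a t) / a, where a = 2 pi n, increase by 1. *)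
Lemma integral_trig_affine n : (0 < n)%N ->
  (\int[haar]_z (1 + Re (ez n z))%:E = 1)%E /\
  (\int[haar]_z (1 + Im (ez n z))%:E = 1)%E.
Proof.
move=> n0; pose a : R := 2 * pi * n%:R.
have a0 : a != 0 by rewrite !mulf_neq0 ?pnatr_eq0 -?lt0n// gt_eqF// pi_gt0.
have [m1 m2] := cmeasurable_ez n.
have key (f : R[i] -> R) F : (forall w, `|f w| <= normc w) ->
    measurable_fun [set: circle R] (f \o ez n) ->
    (forall t : R, is_derive t 1 F (1 + f (cos (a * t) +i* sin (a * t)))) ->
    continuous (fun t => 1 + f (cos (a * t) +i* sin (a * t))) ->
    F 1 - F 0 = 1 ->
    (\int[haar]_z (1 + f (ez n z))%:E = 1)%E.
  move=> f1 mf dF cf F1.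
  have mf1 : measurable_fun [set: circle R] (fun z => (1 + f (ez n z))%:E).
    by apply/measurable_EFinP; exact: measurable_funD.
  have f0 z : (0 <= (1 + f (ez n z))%:E)%E.
    have := f1 (ez n z); rewrite normc_ez ler_norml lee_fin => /andP[+ _]; lra.
  rewrite /haar ge0_integral_pushforward// preimage_setT integral_uniform; last 2 first.
  - exact: (measurableT_comp mf1 (@measurable_expi R)).
  - by move=> t; exact: f0.
  rewrite subr0 invr1 mul1e.
  under eq_integral do rewrite /= ez_expi -/a.
  rewrite (@continuous_FTC2 _ _ F)//.
  - by rewrite -EFinB F1.
  - exact: continuous_subspaceT.
  - have cF : continuous F.
      by move=> t; apply/differentiable_continuous/derivable1_diffP.
    split; [by []|exact/cvg_at_right_filter/cF|exact/cvg_at_left_filter/cF].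
  - by move=> t _; rewrite derive1E derive_val.
have ca : continuous (fun t : R => a * t).
  by move=> t; apply: cvgM; [exact: cvg_cst|exact: cvg_id].
have [c1 s0] := cos_sin_2pin n.
split.
- apply: (key (fun w => Re w) (fun t => t + a^-1 * sin (a * t))) => //.
  + by move=> w; exact: Re_le_normc.
  + move=> t /=; apply: is_derive_eq.
    by rewrite /GRing.scale /=; field.
  + move=> t /=; apply: cvgD; first exact: cvg_cst.
    by apply: continuous_comp; [exact: ca|exact: continuous_cos].
  + by rewrite mulr1 mulr0 s0 sin0; ring.
- apply: (key (fun w => Im w) (fun t => t - a^-1 * cos (a * t))) => //.
  + by move=> w; exact: Im_le_normc.
  + move=> t /=; apply: is_derive_eq.
    by rewrite /GRing.scale /=; field.
  + move=> t /=; apply: cvgD; first exact: cvg_cst.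
    by apply: continuous_comp; [exact: ca|exact: continuous_sin].
  + by rewrite mulr1 mulr0 c1 cos0; ring.
Qed.

End CircleIntegral.

(** * Polynomials converging to the indicator function of an interval *)

Section Threshold.
Variable R : realType.
Implicit Types (x y u : R) (n m : nat).

Lemma bernoulli_le u m : -1 <= u -> 1 + m%:R * u <= (1 + u) ^+ m.
Proof.
move=> u1; elim: m => [|m IH]; first by rewrite mul0r addr0 expr0.
have u1' : 0 <= 1 + u by lra.
rewrite exprS; apply: le_trans (ler_wpM2l u1' IH).
rewrite -[m.+1%:R]natr1; have := mulr_ge0 (ler0n R m) (sqr_ge0 u); rewrite expr2; nra.
Qed.

(** For s the square root of y, Bernoulli's inequality bounds n s^n, and the
    remaining factor s^n tends to 0. *)
Lemma cvg_natmul_expr y : 0 <= y < 1 -> n%:R * y ^+ n @[n --> \oo] --> (0 : R).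
Proof.
move=> /andP[y0 y1]; have [->|yn0] := eqVneq y 0.
  apply: cvg_near_cst; exists 1%N => // n /= n0.
  by rewrite expr0n gtn_eqF// mulr0.
pose s := Num.sqrt y; have s0 : 0 < s by rewrite sqrtr_gt0 lt0r yn0.
have s1 : s < 1 by rewrite -sqrtr1 ltr_sqrt.
pose b := s^-1 - 1; have b0 : 0 < b by rewrite subr_gt0 invf_gt1.
apply: (@squeeze_cvgr _ _ _ _ (cst 0) (fun n => b^-1 * s ^+ n)).
- apply: nearW => n; rewrite mulr_ge0 ?exprn_ge0//=.
  rewrite -(sqr_sqrtr y0) -/s -exprM mulnC exprM expr2 mulrA ler_wpM2r//.
    exact/exprn_ge0/ltW.
  have := @bernoulli_le b n (le_trans (lerN10 R) (ltW b0)).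
  rewrite (_ : 1 + b = s^-1) ?exprVn => [h|]; last by rewrite /b addrC subrK.
  rewrite -ler_pdivlMr ?exprn_gt0//.
  by rewrite ler_pdivlMl// mulrC; apply: le_trans h; rewrite lerDr.
- exact: cvg_cst.
- by rewrite -[0](mulr0 b^-1); apply: cvgMr; apply: cvg_expr; rewrite ger0_norm ?ltW.
Qed.

(** By Bernoulli's inequality (1 - x^n)^(n 2^n) lies between 1 - n (2 x)^n and
    1 / (1 + n (2 x)^n). The factor n in the exponent makes the limit at x = 1/2
    equal to 0, so the limit is an indicator function everywhere. *)
Lemma cvg_threshold x : 0 <= x <= 1 ->
  (1 - x ^+ n) ^+ (n * 2 ^ n) @[n --> \oo] --> ((x < 2^-1)%R%:R : R).
Proof.
move=> /andP[x0 x1].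
have xn n : 0 <= x ^+ n <= 1 by rewrite exprn_ge0//= exprn_ile1.
have [xh|xh] := ltP x 2^-1.
  apply: (@squeeze_cvgr _ _ _ _ (fun n => 1 - n%:R * (2 * x) ^+ n) (cst 1)).
  - apply: nearW => n; have /andP[a b] := xn n.
    rewrite exprn_ile1 ?andbT; [|lra..].
    have := @bernoulli_le (- x ^+ n) (n * 2 ^ n); rewrite natrM natrX exprMn mulrN mulrA.
    by apply; lra.
  - rewrite -[X in _ --> X]subr0; apply: cvgB; first exact: cvg_cst.
    by apply: cvg_natmul_expr; apply/andP; split; lra.
  - exact: cvg_cst.
apply: (@squeeze_cvgr _ _ _ _ (cst 0) (fun n => n.+1%:R^-1)).
- apply: nearW => n; have /andP[a b] := xn n.
  have c : 0 <= 1 - x ^+ n by lra.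
  rewrite exprn_ge0//=.
  set m := (n * 2 ^ n)%N.
  have h : n.+1%:R <= (1 + x ^+ n) ^+ m.
    apply: (le_trans _ (bernoulli_le m _)); last by lra.
    rewrite -[n.+1%:R]natr1 addrC lerD2l /m natrM natrX -mulrA -exprMn.
    by rewrite ler_peMr// exprn_ege1//; lra.
  rewrite -[leRHS]mul1r ler_pdivlMr ?ltr0n//.
  apply: (@le_trans _ _ ((1 - x ^+ n) ^+ m * (1 + x ^+ n) ^+ m)).
    by rewrite ler_wpM2l// exprn_ge0.
  by rewrite -exprMn exprn_ile1//; nra.
- exact: cvg_cst.
- exact: cvg_harmonic.
Qed.

End Threshold.

(** * Bounded measurable functions *)

Section Bounded.
Context d (T : measurableType d) (R : realType).
Implicit Types f g h : T -> R[i].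

Definition bounded_cmeasurable h :=
  cmeasurable h /\ exists M : R, forall x, normc (h x) <= M.

Lemma bcm_cst (c : R[i]) : bounded_cmeasurable (fun=> c).
Proof. by split; [exact: cmeasurable_cst|exists (normc c)]. Qed.

Lemma bcmD f g : bounded_cmeasurable f -> bounded_cmeasurable g ->
  bounded_cmeasurable (fun x => f x + g x).
Proof.
move=> [mf [M fM]] [mg [N gN]]; split; first exact: cmeasurableD.
by exists (M + N) => x; apply: le_trans (le_normcD _ _) (lerD (fM x) (gN x)).
Qed.

Lemma bcmM f g : bounded_cmeasurable f -> bounded_cmeasurable g ->
  bounded_cmeasurable (fun x => f x * g x).
Proof.
move=> [mf [M fM]] [mg [N gN]]; split; first exact: cmeasurableM.
by exists (M * N) => x; rewrite normcM ler_pM ?normc_ge0.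
Qed.

Lemma bcm_real (h : T -> R) M : measurable_fun [set: T] h ->
  (forall x, `|h x| <= M) -> bounded_cmeasurable (fun x => (h x)%:C).
Proof.
move=> mh h1; split; first exact: cmeasurable_real.
by exists M => x; rewrite normc_real.
Qed.

Lemma bcm_real01 (h : T -> R) : measurable_fun [set: T] h ->
  (forall x, 0 <= h x <= 1) -> bounded_cmeasurable (fun x => (h x)%:C).
Proof.
move=> mh h01; apply: (bcm_real (M := 1)) => // x.
by have /andP[a b] := h01 x; rewrite ger0_norm.
Qed.

Lemma indic01 (A : set T) x : 0 <= (\1_A x : R) <= 1.
Proof. by rewrite indicE; case: (_ \in _); rewrite /= ?lexx ler01. Qed.

Lemma bcm_indic (A : set T) : measurable A ->
  bounded_cmeasurable (fun x => (\1_A x : R)%:C).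
Proof.
move=> mA; apply: bcm_real01; first exact: measurable_indic.
by move=> x; exact: indic01.
Qed.

Lemma bcm_conj f : bounded_cmeasurable f -> bounded_cmeasurable (fun x => (f x)^*).
Proof.
move=> [mf [M fM]]; split; first exact: cmeasurable_conj.
by exists M => x; rewrite normc_conj.
Qed.

Lemma square_integrableM (mu : {measure set T -> \bar R}) h u : bounded_cmeasurable h ->
  square_integrable mu u -> square_integrable mu (fun x => h x * u x).
Proof.
move=> [mh [M hM]] su; apply: (square_integrable_le (C := M) _ su).
  by apply: cmeasurableM => //; exact: su.1.
by apply: aeW => x; rewrite normcM ler_wpM2r// normc_ge0.
Qed.

Lemma square_integrable_bcm (mu : probability T R) h : bounded_cmeasurable h ->
  square_integrable mu h.
Proof.
move=> bh; rewrite (_ : h = fun x => h x * 1); last first.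
  by apply/funext => x; rewrite mulr1.
apply: square_integrableM => //; split; first exact: cmeasurable_cst.
rewrite (_ : (fun x => _) = cst 1%E).
  rewrite integral_cst// mul1e.
  exact: le_lt_trans (probability_le1 mu measurableT) (ltry _).
by apply/funext => x; rewrite normc1 expr1n.
Qed.

Lemma cintegrable_bcm (mu : probability T R) h :
  bounded_cmeasurable h -> cintegrable mu h.
Proof.
move=> bh; have := cintegrable_mulJ (square_integrable_bcm mu bh)
  (square_integrable_bcm mu (bcm_cst 1)).
rewrite (_ : (fun x => _) = h)//.
by apply/funext => x; rewrite rmorph1 mulr1.
Qed.

Lemma Rintegral_bounded_lim (mu : {measure set T -> \bar R})
    (h_ : nat -> T -> R) (h r : T -> R) :
  mu.-integrable [set: T] (EFin \o r) ->
  (forall n, measurable_fun [set: T] (h_ n)) -> measurable_fun [set: T] h ->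
  (forall n x, 0 <= h_ n x <= 1) -> (forall x, h_ n x @[n --> \oo] --> h x) ->
  \int[mu]_x (h_ n x * r x) @[n --> \oo] --> \int[mu]_x (h x * r x).
Proof.
move=> ir mh_ mh h01 h_h.
have mr : measurable_fun [set: T] r by apply/measurable_EFinP; exact: measurable_int ir.
have [] := @dominated_convergence _ _ _ mu _ measurableT
  (fun n x => (h_ n x * r x)%:E) (fun x => (h x * r x)%:E) (fun x => `|r x|%:E).
- by move=> n; apply/measurable_EFinP; exact: measurable_funM.
- by apply/measurable_EFinP; exact: measurable_funM.
- apply: aeW => x _ /=; apply: cvg_EFin; first exact: nearW.
  by apply: cvgMl; exact: h_h.
- exact: (integrable_abse ir).
- apply: aeW => x n _ /=; rewrite lee_fin normrM.
  have /andP[h0 h1] := h01 n x.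
  by rewrite ler_piMl// ger0_norm.
move=> ih _; rewrite -(fineK (integrable_fin_num measurableT ih)).
by move=> /fine_cvg.
Qed.

Lemma cintegral_bounded_cvg (mu : {measure set T -> \bar R})
    (h_ : nat -> T -> R) (h : T -> R) (w : T -> R[i]) :
  cintegrable mu w ->
  (forall n, measurable_fun [set: T] (h_ n)) -> measurable_fun [set: T] h ->
  (forall n x, 0 <= h_ n x <= 1) -> (forall x, h_ n x @[n --> \oo] --> h x) ->
  Re (cintegral mu (fun x => (h_ n x)%:C * w x)) @[n --> \oo] -->
    Re (cintegral mu (fun x => (h x)%:C * w x)) /\
  Im (cintegral mu (fun x => (h_ n x)%:C * w x)) @[n --> \oo] -->
    Im (cintegral mu (fun x => (h x)%:C * w x)).
Proof.
move=> [iw1 iw2] mh_ mh h01 h_h.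
have ReE (a : R) (z : R[i]) : Re (a%:C * z) = a * Re z.
  by case: z => ? ? /=; rewrite mul0r subr0.
have ImE (a : R) (z : R[i]) : Im (a%:C * z) = a * Im z.
  by case: z => ? ? /=; rewrite mul0r addr0.
rewrite /cintegral /=; split.
- under eq_fun do under eq_Rintegral do rewrite ReE.
  under eq_Rintegral do rewrite ReE.
  exact: Rintegral_bounded_lim iw1 mh_ mh h01 h_h.
- under eq_fun do under eq_Rintegral do rewrite ImE.
  under eq_Rintegral do rewrite ImE.
  exact: Rintegral_bounded_lim iw2 mh_ mh h01 h_h.
Qed.

End Bounded.

(** * A monotone class theorem on the circle *)

Section CircleClass.
Import HBNNSimple.
Variable R : realType.
Local Notation C := (circle R).
Variable P : (C -> R[i]) -> Prop.

Hypothesis Pcst : forall c, P (fun=> c).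
Hypothesis Pz : P (fun z => z).
Hypothesis PzJ : P (fun z => (z : R[i])^*).
Hypothesis PD : forall f g, bounded_cmeasurable f -> bounded_cmeasurable g ->
  P f -> P g -> P (fun z => f z + g z).
Hypothesis PM : forall f g, bounded_cmeasurable f -> bounded_cmeasurable g ->
  P f -> P g -> P (fun z => f z * g z).
Hypothesis Plim : forall (h_ : nat -> C -> R) (h : C -> R),
  (forall n, measurable_fun [set: C] (h_ n)) -> measurable_fun [set: C] h ->
  (forall n z, 0 <= h_ n z <= 1) -> (forall z, h_ n z @[n --> \oo] --> h z) ->
  (forall n, P (fun z => (h_ n z)%:C)) -> P (fun z => (h z)%:C).

Let bP h := bounded_cmeasurable h /\ P h.
Let rP (h : C -> R) := bP (fun z => (h z)%:C).

Let bP_cst c : bP (fun=> c). Proof. by split; [exact: bcm_cst|]. Qed.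

Let bPD f g : bP f -> bP g -> bP (fun z => f z + g z).
Proof. by move=> [? ?] [? ?]; split; [exact: bcmD|exact: PD]. Qed.

Let bPM f g : bP f -> bP g -> bP (fun z => f z * g z).
Proof. by move=> [? ?] [? ?]; split; [exact: bcmM|exact: PM]. Qed.

Let bcm_circle : bounded_cmeasurable (fun z : C => z : R[i]).
Proof.
split; first exact: cmeasurable_circle.
by exists 1 => z; rewrite normc_circle.
Qed.

Let rP_cst c : rP (fun=> c). Proof. exact: bP_cst. Qed.

Let rPD f g : rP f -> rP g -> rP (fun z => f z + g z).
Proof.
by move=> Pf Pg; have := bPD Pf Pg; rewrite /rP; under eq_fun do rewrite -rmorphD.
Qed.

Let rPM f g : rP f -> rP g -> rP (fun z => f z * g z).
Proof.
by move=> Pf Pg; have := bPM Pf Pg; rewrite /rP; under eq_fun do rewrite -rmorphM.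
Qed.

Let rPX f n : rP f -> rP (fun z => f z ^+ n).
Proof.
move=> Pf; elim: n => [|n IH]; first exact: rP_cst.
by under eq_fun do rewrite exprS; exact: rPM.
Qed.

Let rPB f g : rP f -> rP g -> rP (fun z => f z - g z).
Proof.
move=> Pf Pg; have := rPD Pf (rPM (rP_cst (-1)) Pg).
by under eq_fun do rewrite mulN1r.
Qed.

Let rP_Re : rP (fun z => Re (z : R[i])).
Proof.
have := bPM (bP_cst (2^-1)%:C)
  (bPD (conj bcm_circle Pz) (conj (bcm_conj bcm_circle) PzJ)).
rewrite /rP; congr bP; apply/funext => -[[a b] /= _]; apply: complex_ext => /=; by field.
Qed.

Let rP_Im : rP (fun z => Im (z : R[i])).
Proof.
have := bPM (bP_cst (0 +i* - 2^-1)) (bPD (conj bcm_circle Pz)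
  (bPM (bP_cst (-1)) (conj (bcm_conj bcm_circle) PzJ))).
rewrite /rP; congr bP; apply/funext => -[[a b] /= _]; apply: complex_ext => /=; by field.
Qed.

Let rP_measurable f : rP f -> measurable_fun [set: C] f.
Proof. by case=> -[[mf _] _] _; exact: mf. Qed.

Let rP_lim (h_ : nat -> C -> R) (h : C -> R) :
  (forall n, rP (h_ n)) -> measurable_fun [set: C] h ->
  (forall n z, 0 <= h_ n z <= 1) -> (forall z, h_ n z @[n --> \oo] --> h z) ->
  rP h.
Proof.
move=> Ph_ mh h01 h_h; split.
  apply: bcm_real01 => // z.
  exact: cvgn_unit_interval (fun n => h01 n z) (h_h z).
by apply: (Plim _ mh h01 h_h) => n; [exact: rP_measurable|exact: (Ph_ n).2].
Qed.

(** An affine change of variable brings g into [0, 1] and the threshold a to 1/2,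
    where polynomials converge to the indicator function. *)
Let rP_lt g M (a : R) : rP g -> (forall z, `|g z| <= M) -> rP (\1_[set z | g z < a]).
Proof.
move=> Pg gM; have M0 : 0 <= M := le_trans (normr_ge0 _) (gM point).
pose c := 2^-1 / (1 + M + `|a|).
have d0 : 0 < 1 + M + `|a| by rewrite -addrA ltr_pwDl// addr_ge0.
have c0 : 0 < c by rewrite divr_gt0.
pose g' z := 2^-1 + c * (g z - a).
have Pg' : rP g' by apply: rPD (rP_cst _) (rPM (rP_cst _) (rPB Pg (rP_cst _))).
have g'01 z : 0 <= g' z <= 1.
  have : `|c * (g z - a)| <= 2^-1.
    have cd : 2^-1 = c * (1 + M + `|a|) by rewrite /c divfK// gt_eqF.
    rewrite normrM (gtr0_norm c0) cd ler_wpM2l ?(ltW c0)//.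
    by apply: (le_trans (ler_normB _ _)); have := gM z; lra.
  by rewrite ler_norml /g' => /andP[h1 h2]; apply/andP; split; lra.
apply: (@rP_lim (fun n z => (1 - g' z ^+ n) ^+ (n * 2 ^ n))).
- by move=> n; apply: rPX; apply: rPB (rP_cst _) (rPX _ Pg').
- apply: measurable_indic; rewrite -[X in measurable X]setTI.
  have := rP_measurable Pg measurableT (measurable_itv `]-oo, a[).
  by congr measurable; apply/seteqP; split => z /=; rewrite in_itv.
- move=> n z; have /andP[h1 h2] := g'01 z.
  have [h3 h4] : 0 <= g' z ^+ n /\ g' z ^+ n <= 1 by rewrite exprn_ge0 ?exprn_ile1.
  by rewrite exprn_ge0 ?exprn_ile1//; lra.
- move=> z; have := cvg_threshold (g'01 z); rewrite indicE.
  suff -> : (g' z < 2^-1) = (z \in [set z | g z < a]) by [].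
  rewrite /g' -subr_lt0 addrAC subrr add0r pmulr_rlt0// subr_lt0.
  by apply/idP/idP; [move=> h; exact/mem_set|rewrite inE].
Qed.

Let Q (A : set C) := measurable A /\ rP (\1_A).

Let QI A B : Q A -> Q B -> Q (A `&` B).
Proof.
move=> [mA PA] [mB PB]; split; first exact: measurableI.
have := rPM PA PB; congr rP; apply/funext => z.
by rewrite !indicE in_setI; case: (_ \in _); case: (_ \in _); rewrite /= ?mul0r ?mul1r.
Qed.

Let Q_sigma : sigma_algebra [set: C] Q.
Proof.
have QC A : Q A -> Q (~` A).
  move=> [mA PA]; split; first exact: measurableC.
  have := rPB (rP_cst 1) PA; congr rP; apply/funext => z.
  by rewrite !indicE in_setC; case: (_ \in _); rewrite /= ?subrr ?subr0.
have Q0 : Q set0.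
  split; first exact: measurable0.
  have := rP_cst 0; congr rP; apply/funext => z.
  by rewrite !indicE in_set0.
have QU A B : Q A -> Q B -> Q (A `|` B).
  by move=> QA QB; rewrite -[A `|` B]setCK setCU; exact: QC (QI (QC _ QA) (QC _ QB)).
split => //; first by move=> A QA; rewrite setTD; exact: QC.
move=> F QF.
have QG n : Q (\big[setU/set0]_(i < n) F i).
  elim: n => [|n IH]; first by rewrite big_ord0.
  by rewrite big_ord_recr; exact: QU.
have mU : measurable (\bigcup_k F k) by apply: bigcupT_measurable => k; exact: (QF k).1.
split=> //; apply: (@rP_lim (fun n => \1_(\big[setU/set0]_(i < n) F i))).
- by move=> n; exact: (QG n).2.
- exact: measurable_indic.
- by move=> n z; exact: indic01.
- move=> z; have [[k _ Fkz]|nF] := pselect ((\bigcup_k F k) z).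
    apply: cvg_near_cst; exists k.+1 => // n /= kn.
    have Uz : (\bigcup_k F k) z by exists k.
    have Gz : (\big[setU/set0]_(i < n) F i) z by rewrite -bigcup_mkord; exists k.
    by rewrite !indicE !mem_set.
  apply: cvg_near_cst; apply: nearW => n.
  have nG : ~ (\big[setU/set0]_(i < n) F i) z.
    by rewrite -bigcup_mkord => -[k _ Fkz]; apply: nF; exists k.
  by rewrite !indicE !memNset.
Qed.

Let Q_measurable (A : set C) : measurable A -> Q A.
Proof.
have Qcoord (f : C -> R) : rP f -> (forall z, `|f z| <= 1) ->
    forall B, measurable B -> Q (f @^-1` B).
  move=> Pf f1 B mB.
  have {mB} : (@RGenInftyO.G R).-sigma.-measurable B.
    by rewrite -RGenInftyO.measurableE.
  have sub : <<s @RGenInftyO.G R >> `<=` image_set_system setT f Q.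
    apply: smallest_sub; first exact: sigma_algebra_image Q_sigma.
    move=> _ [a ->]; rewrite /image_set_system /= setTI.
    have -> : f @^-1` `]-oo, a[ = [set z | f z < a].
      by apply/seteqP; split => z /=; rewrite in_itv.
    have Pa := rP_lt a Pf f1; split => //.
    have := rP_measurable Pf measurableT (measurable_itv `]-oo, a[).
    by rewrite setTI; congr measurable; apply/seteqP; split => z /=; rewrite in_itv.
  by move=> mB; have := sub B mB; rewrite /image_set_system /= setTI.
have Re1 (z : C) : `|Re (z : R[i])| <= 1 by rewrite -(normc_circle z) Re_le_normc.
have Im1 (z : C) : `|Im (z : R[i])| <= 1 by rewrite -(normc_circle z) Im_le_normc.
have sub : @measurable _ (R * R)%type `<=` image_set_system setT (@circle_coord R) Q.
  rewrite measurable_prod_measurableType.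
  apply: smallest_sub; first exact: sigma_algebra_image Q_sigma.
  move=> _ [B mB [D mD <-]]; rewrite /image_set_system /= setTI.
  exact: QI (Qcoord _ rP_Re Re1 _ mB) (Qcoord _ rP_Im Im1 _ mD).
by move=> [B mB <-]; have := sub B mB.
Qed.

Let rP_sum I (r : seq I) (F : I -> C -> R) : (forall i, rP (F i)) ->
  rP (fun z => \sum_(i <- r) F i z).
Proof.
move=> PF; elim: r => [|i r IH].
  by under eq_fun do rewrite big_nil; exact: rP_cst.
by under eq_fun do rewrite big_cons; exact: rPD.
Qed.

Let rP01 (h : C -> R) : measurable_fun [set: C] h -> (forall z, 0 <= h z <= 1) -> rP h.
Proof.
move=> mh h01.
have mhE : measurable_fun [set: C] (EFin \o h) by apply/measurable_EFinP.
pose h_ := nnsfun_approx measurableT mhE.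
have h0 z : [set: C] z -> (0 <= (EFin \o h) z)%E.
  by move=> _; rewrite lee_fin; case/andP: (h01 z).
have h_h (z : C) : h_ n z @[n --> \oo] --> h z.
  by have /fine_cvg := cvg_nnsfun_approx measurableT mhE h0 (Logic.I : [set: C] z).
apply: (@rP_lim (fun n (z : C) => h_ n z)) => // [n|n z].
  pose s := finmap.enum_fset (fset_set (range (h_ n))).
  rewrite (_ : (fun z : C => h_ n z) = fun z : C =>
      \sum_(i < size s) s`_i * \1_(h_ n @^-1` [set s`_i]) z).
    apply: rP_sum => i; apply: rPM; first exact: rP_cst.
    by apply: (Q_measurable _).2; exact: measurable_sfunP.
  by apply/funext => z; rewrite fimfunEord.
have /andP[_ h1] := h01 z; rewrite fun_ge0 /=.
apply: le_trans h1; rewrite -(cvg_lim _ (h_h z))//.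
apply: nondecreasing_cvgn_le; last by apply/cvg_ex; exists (h z); exact: h_h.
by move=> i j ij; exact/(lefP _ _ (nd_nnsfun_approx measurableT mhE ij)).
Qed.

(** The sets whose indicator function has the property form a sigma-algebra, which
    contains the sets {Re z < a} and {Im z < a} because their indicator functions are
    limits of polynomials in z and z^*. Simple functions, then limits of simple
    functions, yield every bounded measurable function. *)
Lemma circle_monotone_class h : bounded_cmeasurable h -> P h.
Proof.
move=> [[m1 m2] [M hM]].
have M0 : 0 <= M := le_trans (normc_ge0 _) (hM point).
have rPh (g : C -> R) : measurable_fun [set: C] g -> (forall z, `|g z| <= M) -> rP g.
  move=> mg gM; pose g' z := (2 * (M + 1))^-1 * (g z + M).
  have d0 : 0 < 2 * (M + 1) by lra.
  have Pg' : rP g'.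
    apply: rP01.
      apply: measurable_funM; first exact: measurable_cst.
      by apply: measurable_funD.
    move=> z; have := gM z; rewrite ler_norml => /andP[h1 h2].
    by rewrite mulr_ge0 ?invr_ge0 ?(ltW d0)//= ?ler_pdivrMl//; lra.
  have := rPB (rPM (rP_cst (2 * (M + 1))) Pg') (rP_cst M); congr rP.
  by apply/funext => z; rewrite /g' mulrA mulfV ?gt_eqF// mul1r addrK.
have PR := rPh _ m1 (fun z => le_trans (Re_le_normc (h z)) (hM z)).
have PI := rPh _ m2 (fun z => le_trans (Im_le_normc (h z)) (hM z)).
have [_] := bPD PR (bPM (bP_cst (0 +i* 1)) PI); congr P.
by apply/funext => z /=; case: (h z) => a b; apply: complex_ext => /=; ring.
Qed.

End CircleClass.

(** * Fourier coefficients determine a square-integrable function *)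

Section Fourier.
Variable R : realType.
Local Notation haar := (@haar R).
Local Notation L2 := (L2 haar).
Local Notation dot := (@L2_dot _ _ R haar).
Local Notation C := (circle R).

Lemma bcm_ez k : bounded_cmeasurable (@ez R k).
Proof. by split; [exact: cmeasurable_ez|exists 1 => z; rewrite normc_ez]. Qed.

Lemma cintegral_conj (h : C -> R[i]) : bounded_cmeasurable h ->
  cintegral haar (fun z => (h z)^*) = (cintegral haar h)^*.
Proof.
move=> bh; have := cintegral_mulJC (square_integrable_bcm haar (bcm_cst _ 1))
  (square_integrable_bcm haar bh).
under eq_fun do rewrite mul1r.
by under [X in _ = (cintegral _ X)^* -> _]eq_fun do rewrite rmorph1 mulr1.
Qed.

Lemma cintegral_cst (c : R[i]) : cintegral haar (fun=> c) = c.
Proof.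
apply: complex_ext; rewrite /cintegral /= Rintegral_cst//;
  by rewrite [X in fine X](@probability_setT _ _ _ haar) mulr1.
Qed.

Lemma cintegral_ez k : cintegral haar (@ez R k) = (k == 0)%:R.
Proof.
have h n : cintegral haar (@ez R (Posz n)) = (Posz n == 0)%:R.
  case: n => [|n]; first by rewrite (_ : ez _ = fun=> 1)// cintegral_cst.
  have [i1 i2] := cintegrable_bcm haar (bcm_ez n.+1).
  have [h1 h2] := @integral_trig_affine R n.+1 isT.
  have i0 : haar.-integrable [set: C] (EFin \o cst 1).
    exact: finite_measure_integrable_cst.
  have e1 : \int[haar]_z 1 = 1 :> R.
    by rewrite Rintegral_cst// [X in fine X](@probability_setT _ _ _ haar) mulr1.
  apply: complex_ext; rewrite /cintegral /=.
  - have := RintegralD measurableT i0 i1; rewrite /Rintegral h1 /= -/(Rintegral _ _ _).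
    move: e1; rewrite /Rintegral => ->; lra.
  - have := RintegralD measurableT i0 i2; rewrite /Rintegral h2 /= -/(Rintegral _ _ _).
    move: e1; rewrite /Rintegral => ->; lra.
case: k => n //; rewrite NegzE.
rewrite (_ : ez _ = fun z => (ez n.+1 z)^*); last by apply/funext => z; exact: ezN.
rewrite cintegral_conj; last exact: bcm_ez.
by rewrite h oppr_eq0 -[Posz n.+1 == 0]/false rmorph0.
Qed.

Section Functional.
Variable L : (C -> R[i]) -> R[i].
Hypothesis LZD : forall c f g, bounded_cmeasurable f -> bounded_cmeasurable g ->
  L (fun z => c * f z + g z) = c * L f + L g.
Hypothesis Llim : forall (h_ : nat -> C -> R) (h : C -> R) g,
  (forall n, measurable_fun [set: C] (h_ n)) -> measurable_fun [set: C] h ->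
  (forall n z, 0 <= h_ n z <= 1) -> (forall z, h_ n z @[n --> \oo] --> h z) ->
  bounded_cmeasurable g -> (forall n, L (fun z => (h_ n z)%:C * g z) = 0) ->
  L (fun z => (h z)%:C * g z) = 0.
Hypothesis Lez : forall k, L (ez k) = 0.

(** Vanishing of L is not stable under products. The monotone class theorem is
    therefore applied to the multipliers of the space N of those g such that L
    vanishes at every product of g with a monomial; N contains 1, whence the claim. *)
Lemma functional_eq0 h : bounded_cmeasurable h -> L h = 0.
Proof.
move=> bh.
pose N g := bounded_cmeasurable g /\ forall k, L (fun z => ez k z * g z) = 0.
have N1 : N (fun=> 1).
  by split=> [|k]; [exact: bcm_cst|under eq_fun do rewrite mulr1; exact: Lez].
suff [_ /(_ 0)] : N (fun z => h z * 1).
  by under eq_fun do rewrite ez0 mul1r mulr1.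
apply: (circle_monotone_class
  (P := fun h => forall g, N g -> N (fun z => h z * g z))) bh _ N1.
- move=> c g [bg Lg]; split=> [|k]; first exact: bcmM (bcm_cst _ _) bg.
  have := LZD (c - 1) (bcmM (bcm_ez k) bg) (bcmM (bcm_ez k) bg).
  rewrite !Lg mulr0 addr0 => <-; congr L.
  by apply/funext => z; ring.
- move=> g [bg Lg]; split=> [|k]; first by rewrite -/(ez 1); exact: bcmM (bcm_ez 1) bg.
  rewrite -[RHS](Lg (k + 1)); congr L; apply/funext => z.
  by rewrite ezD ez1 mulrA.
- move=> g [bg Lg]; split=> [|k].
    rewrite (_ : (fun z => _) = fun z => ez (- 1) z * g z).
      exact: bcmM (bcm_ez _) bg.
    by apply/funext => z; rewrite ezN ez1.
  rewrite -[RHS](Lg (k - 1)); congr L; apply/funext => z.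
  by rewrite ezD ezN ez1 mulrA.
- move=> f1 f2 b1 b2 P1 P2 g Ng; have [c1 L1] := P1 g Ng; have [c2 L2] := P2 g Ng.
  split=> [|k]; first exact: bcmM (bcmD b1 b2) Ng.1.
  have := LZD 1 (bcmM (bcm_ez k) c1) (bcmM (bcm_ez k) c2).
  rewrite L1 L2 mulr0 addr0 => <-.
  by congr L; apply/funext => z; ring.
- move=> f1 f2 b1 b2 P1 P2 g Ng; have := P1 _ (P2 g Ng).
  by under eq_fun do rewrite mulrA.
- move=> h_ h' mh_ mh' h01 h_h Ph_ g Ng; split=> [|k].
    apply: bcmM Ng.1; apply: bcm_real01 => // z.
    exact: cvgn_unit_interval (fun n => h01 n z) (h_h z).
  have := Llim mh_ mh' h01 h_h (bcmM (bcm_ez k) Ng.1).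
  under [X in _ -> L X = _]eq_fun do rewrite mulrCA.
  apply => n; have [_ /(_ k)] := Ph_ n g Ng.
  by under eq_fun do rewrite mulrCA.
Qed.

End Functional.

End Fourier.

Section FourierBasis.
Variable R : realType.
Local Notation haar := (@haar R).
Local Notation L2 := (L2 haar).
Local Notation dot := (@L2_dot _ _ R haar).
Local Notation C := (circle R).

Lemma square_integrable_ez k : square_integrable haar (@ez R k).
Proof. exact/square_integrable_bcm/bcm_ez. Qed.

Definition eL2 k : L2 := L2_of haar (@ez R k).

Lemma repr_eL2 k : repr (eL2 k) = @ez R k %[ae haar].
Proof. exact/repr_L2_of/square_integrable_ez. Qed.

Lemma dot_eL2 j k : dot (eL2 j) (eL2 k) = (j == k)%:R.
Proof.
rewrite (L2_dotE (cmeasurable_ez _ _) (cmeasurable_ez _ _) (repr_eL2 j) (repr_eL2 k)).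
under [X in cintegral _ X]eq_fun do rewrite -ezN -ezD.
by rewrite (cintegral_ez R (j - k)) subr_eq0.
Qed.

Lemma cintegrableM (u : L2) h : bounded_cmeasurable h ->
  cintegrable haar (fun z => repr u z * h z).
Proof.
move=> bh; have := cintegrable_mulJ (L2funP (repr u))
  (square_integrable_bcm haar (bcm_conj bh)).
by under eq_fun do rewrite conjCK.
Qed.

(** The functional h |-> int u h vanishes on monomials, hence on bounded functions.
    Its value at h = u^* / (1 + |u|^2) is the integral of |u|^2 / (1 + |u|^2). *)
Lemma fourier_total (u : L2) : (forall k, dot u (eL2 k) = 0) -> u = 0.
Proof.
move=> u0; set f : C -> R[i] := repr u; have mf : cmeasurable f := (L2funP _).1.
have L0 h : bounded_cmeasurable h -> cintegral haar (fun z => f z * h z) = 0.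
  apply: (@functional_eq0 _ (fun h => cintegral haar (fun z => f z * h z))).
  - move=> c g1 g2 b1 b2; rewrite -cintegralZD; do ?exact: cintegrableM.
    by congr cintegral; apply/funext => z; ring.
  - move=> h_ h' g mh_ mh' h01 h_h bg h0.
    have [l1 l2] := cintegral_bounded_cvg (cintegrableM u bg) mh_ mh' h01 h_h.
    have E (a : C -> R) :
        (fun z => f z * ((a z)%:C * g z)) = fun z => (a z)%:C * (f z * g z).
      by apply/funext => z; rewrite mulrCA.
      have e n : cintegral haar (fun z => (h_ n z)%:C * (f z * g z)) = 0.
      by have := h0 n; rewrite E.
    rewrite E; apply: complex_ext.
      exact: (cvgn_eq_lim (fun n => congr1 Re (e n)) l1 (cvg_cst _)).
    exact: (cvgn_eq_lim (fun n => congr1 Im (e n)) l2 (cvg_cst _)).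
  - move=> k; have := u0 (- k).
    rewrite (L2_dotE mf (cmeasurable_ez _ _) (ae_eq_refl _ _ _) (repr_eL2 _)).
    by under [X in cintegral _ X = _ -> _]eq_fun do rewrite ezN conjCK.
(* The bounded function g = f sqrt b satisfies |g|^2 = f h for h = g^* sqrt b. *)
pose b (z : C) : R := (1 + normc (f z) ^+ 2)^-1.
have b0 z : 0 < b z by rewrite invr_gt0 ltr_pwDl// sqr_ge0.
have mb : measurable_fun [set: C] b.
  rewrite (_ : b = (fun t : R => (1 + t ^+ 2)^-1) \o (fun z => normc (f z)))//.
  apply: measurableT_comp (measurable_normc mf); apply: continuous_measurable_fun.
  move=> t; apply: cvgV; first by rewrite gt_eqF// ltr_pwDl// sqr_ge0.
  by apply: cvgD; [exact: cvg_cst|exact: exprn_continuous].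
have msb : measurable_fun [set: C] (fun z => Num.sqrt (b z)).
  apply: measurableT_comp mb; apply: continuous_measurable_fun.
  exact: sqrt_continuous.
have fb z : normc (f z) ^+ 2 * b z <= 1.
  by rewrite /b ler_pdivrMr ?mul1r ?lerDr// ltr_pwDl// sqr_ge0.
pose g z := f z * (Num.sqrt (b z))%:C.
have gg z : normc (g z) ^+ 2 = normc (f z) ^+ 2 * b z.
  by rewrite normcM exprMn normc_real real_normK ?num_real// sqr_sqrtr// ltW.
have bg : bounded_cmeasurable g.
  split.
    apply: cmeasurableM => //; apply: cmeasurable_real.
    exact: msb.
  by exists 1 => z; rewrite -(@ler_pXn2r _ 2)// ?nnegrE ?normc_ge0// gg expr1n.
have bh : bounded_cmeasurable (fun z => (g z)^* * (Num.sqrt (b z))%:C).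
  split.
    apply: cmeasurableM; first exact: cmeasurable_conj bg.1.
    apply: cmeasurable_real.
    exact: msb.
  exists 1 => z; rewrite normcM normc_conj normc_real ger0_norm ?sqrtr_ge0//.
  rewrite mulr_ile1 ?normc_ge0 ?sqrtr_ge0//.
    by rewrite -(@ler_pXn2r _ 2)// ?nnegrE ?normc_ge0// gg expr1n.
  rewrite -sqrtr1 ler_sqrt// /b invf_le1 ?ltr_pwDl ?sqr_ge0//.
  by rewrite lerDl sqr_ge0.
have g0 : g = cst 0 %[ae haar].
  apply: square_integrable_eq0; first exact: square_integrable_bcm.
  have := L0 _ bh; rewrite (_ : (fun z => _) = fun z => g z * (g z)^*); last first.
    by apply/funext => z; rewrite /g; ring.
  by rewrite cintegral_mulJ => -[].
apply/eq_L2P; apply: (@ae_eq_trans _ _ _ _ _ _ _ (cst 0)); last first.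
  by apply: ae_eq_sym; have := repr_pi (0 : L2fun haar); rewrite raddf0.
apply: filterS g0 => z /(_ Logic.I) gz _.
have : normc (g z) ^+ 2 = 0 by rewrite gz normc0 expr0n.
rewrite gg => /eqP; rewrite mulf_eq0 (gt_eqF (b0 z)) orbF sqrf_eq0 => /eqP.
exact: eq0_normc.
Qed.

Definition ebasis n : L2 := eL2 (int_of_idx n).

Lemma ebasisON i j : dot (ebasis i) (ebasis j) = (i == j)%:R.
Proof. by rewrite dot_eL2 (can_eq int_of_idxK). Qed.

Lemma ebasis_total u : (forall n, dot u (ebasis n) = 0) -> u = 0.
Proof.
by move=> h; apply: fourier_total => k; rewrite -(idx_of_intK k); exact: h.
Qed.

End FourierBasis.

(** * The p-th power map preserves Haar measure *)

Section Power.
Variables (R : realType) (p : nat).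
Hypothesis p0 : (0 < p)%N.
Local Notation haar := (@haar R).
Local Notation L2 := (L2 haar).
Local Notation dot := (@L2_dot _ _ R haar).
Local Notation C := (circle R).

Definition powC (z : C) : C := (z ^+ p)%g.

Lemma ez_powC k z : ez k (powC z) = ez (p%:Z * k) z.
Proof. exact: ez_expg. Qed.

Lemma measurable_powC : measurable_fun [set: C] powC.
Proof.
have [m1 m2] := @cmeasurable_ez R p.
have mc : measurable_fun [set: C] (@circle_coord R \o powC).
  apply/measurable_fun_pairP; split.
    by move: m1; congr measurable_fun; apply/funext => z /=; rewrite circle_expg.
  by move: m2; congr measurable_fun; apply/funext => z /=; rewrite circle_expg.
move=> _ _ [A mA <-]; rewrite setTI.
by have := mc measurableT A mA.
Qed.

Lemma cmeasurable_powC (f : C -> R[i]) : cmeasurable f -> cmeasurable (f \o powC).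
Proof.
move=> [m1 m2]; split; [exact: measurableT_comp m1 measurable_powC|
  exact: measurableT_comp m2 measurable_powC].
Qed.

Lemma bcm_powC (f : C -> R[i]) : bounded_cmeasurable f -> bounded_cmeasurable (f \o powC).
Proof.
move=> [mf [M fM]]; split; first exact: cmeasurable_powC.
by exists M => z; exact: fM.
Qed.

(** The two functionals agree on monomials: the p-th power map carries the degree k
    to p k, which is zero only if k is. *)
Lemma cintegral_powC h : bounded_cmeasurable h ->
  cintegral haar (h \o powC) = cintegral haar h.
Proof.
move=> bh; apply/eqP; rewrite -subr_eq0; apply/eqP; move: h bh.
apply: (@functional_eq0 _ (fun h => cintegral haar (h \o powC) - cintegral haar h)).
- move=> c f g bf bg.
  rewrite (cintegralZD c (cintegrable_bcm haar bf) (cintegrable_bcm haar bg)).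
  have := cintegralZD c (cintegrable_bcm haar (bcm_powC bf))
    (cintegrable_bcm haar (bcm_powC bg)).
  rewrite -[X in cintegral _ X = _]/((fun z => c * f z + g z) \o powC) => ->.
  by ring.
- move=> h_ h g mh_ mh h01 h_h bg h0.
  have [l1 l2] := cintegral_bounded_cvg (cintegrable_bcm haar bg) mh_ mh h01 h_h.
  have [k1 k2] := cintegral_bounded_cvg (cintegrable_bcm haar (bcm_powC bg))
    (fun n => measurableT_comp (mh_ n) measurable_powC)
    (measurableT_comp mh measurable_powC) (fun n z => h01 n (powC z))
    (fun z => h_h (powC z)).
  have e n := eqP (etrans (esym (subr_eq0 _ _)) (introT eqP (h0 n))).
  apply/eqP; rewrite subr_eq0; apply/eqP; apply: complex_ext.
    exact: (cvgn_eq_lim (fun n => congr1 Re (e n)) k1 l1).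
  exact: (cvgn_eq_lim (fun n => congr1 Im (e n)) k2 l2).
- move=> k; rewrite (_ : ez k \o powC = ez (p%:Z * k)); last first.
    by apply/funext => z; rewrite /= ez_powC.
  rewrite !cintegral_ez mulf_eq0 (_ : (p%:Z == 0) = false) ?subrr//.
  by rewrite eqz_nat gtn_eqF.
Qed.

Lemma haar_powC (A : set C) : measurable A -> haar (powC @^-1` A) = haar A.
Proof.
move=> mA; have mpA : measurable (powC @^-1` A).
  by rewrite -[X in measurable X]setTI; exact: measurable_powC.
have := congr1 Re (cintegral_powC (bcm_indic R mA)); rewrite /cintegral /= => h.
have iE (B : set C) : measurable B -> haar B = (\int[haar]_z (\1_B z : R))%:E.
  move=> mB; rewrite /Rintegral integral_indic// setIT fineK//.
  exact: fin_num_measure.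
rewrite (iE _ mpA) (iE _ mA) -h.
by congr ((Rintegral _ _ _)%:E).
Qed.

Lemma ge0_integral_powC (f : C -> \bar R) : measurable_fun [set: C] f ->
  (forall z, 0 <= f z)%E ->
  (\int[haar]_z f (powC z) = \int[haar]_z f z)%E.
Proof.
move=> mf f0.
rewrite -[LHS]/(\int[haar]_(z in powC @^-1` [set: C]) (f \o powC) z)%E.
rewrite -(ge0_integral_pushforward measurable_powC)//.
by apply: eq_measure_integral => [|mp A mA _]; [exact: measurable_powC|exact: haar_powC].
Qed.

Lemma ae_powC (Q : C -> Prop) : (\forall z \ae haar, Q z) ->
  \forall z \ae haar, Q (powC z).
Proof.
move=> [N [mN N0 NQ]]; exists (powC @^-1` N); split.
- by rewrite -[X in measurable X]setTI; exact: measurable_powC.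
- by rewrite haar_powC.
- by move=> z /= nQ; exact: NQ.
Qed.

Lemma square_integrable_powC (f : C -> R[i]) : square_integrable haar f ->
  square_integrable haar (f \o powC).
Proof.
move=> [mf foo]; split; first exact: cmeasurable_powC.
rewrite (ge0_integral_powC (f := fun z => (normc (f z) ^+ 2)%:E))//.
- by apply/measurable_EFinP; exact: measurable_normc2.
- by move=> z; rewrite lee_fin sqr_ge0.
Qed.

Definition comp_powC (u : L2) : L2 := L2_of haar (repr u \o powC).

Lemma repr_comp_powC u : repr (comp_powC u) = repr u \o powC %[ae haar].
Proof. exact/repr_L2_of/square_integrable_powC/L2funP. Qed.

Lemma comp_powC_linear : linear comp_powC.
Proof.
move=> a u v; apply/eq_L2P.
have h1 := repr_add (a *: comp_powC u) (comp_powC v).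
have h2 := repr_scale a (comp_powC u); rewrite -[L2_scale _ _]/(a *: comp_powC u) in h2.
have h3 := repr_scale a u; rewrite -[L2_scale _ _]/(a *: u) in h3.
have h4 := ae_powC h3; have h5 := ae_powC (repr_add (a *: u) v).
near=> z => _.
rewrite (near (repr_comp_powC (a *: u + v)) z _ Logic.I)//=.
rewrite (near h1 z _ Logic.I)// (near h2 z _ Logic.I)//.
rewrite (near (repr_comp_powC u) z _ Logic.I)// (near (repr_comp_powC v) z _ Logic.I)//=.
by rewrite (near h5 z _ Logic.I)// (near h4 z _ Logic.I).
Unshelve. all: by end_near. Qed.

Lemma nrm2_comp_powC u : nrm2 dot (comp_powC u) = nrm2 dot u.
Proof.
have mu' : cmeasurable (repr u) := (L2funP _).1.
rewrite (nrm2_L2 (cmeasurable_powC mu') (repr_comp_powC u)).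
rewrite (nrm2_L2 mu' (ae_eq_refl _ _ _)) /Rintegral; congr fine.
rewrite (ge0_integral_powC (f := fun z => (normc (repr u z) ^+ 2)%:E))//.
- by apply/measurable_EFinP; exact: measurable_normc2.
- by move=> z; rewrite lee_fin sqr_ge0.
Qed.

Lemma dot_comp_powC u v : dot (comp_powC u) (comp_powC v) = dot u v.
Proof. exact: (isometry_dot comp_powC_linear nrm2_comp_powC). Qed.

Lemma comp_powC_eL2 k : comp_powC (eL2 R k) = eL2 R (p%:Z * k).
Proof.
apply/eq_L2P.
apply: filterS3 (repr_comp_powC (eL2 R k)) (ae_powC (repr_eL2 R k))
  (repr_eL2 R (p%:Z * k)).
move=> z /(_ Logic.I) -> /(_ Logic.I) /= -> /(_ Logic.I) -> _.
exact: ez_powC.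
Qed.

End Power.

(** * The Fourier transform onto the induced space *)

Lemma char0 (R : realType) (B : zmodType) (chi : character R B) : (chi 0 : R[i]) = 1.
Proof.
have : (chi (0 + 0) : R[i]) = (chi 0 : R[i]) * (chi 0 : R[i]) by rewrite charD.
by rewrite addr0 => h; apply: (mulfI (circle_neq0 (chi 0))); rewrite mulr1 -h.
Qed.

Section IndSpace.
Variables (R : realType) (B : zmodType) (alpha : zmodAut B) (chi : character R B).
Local Notation haar := (@haar R).
Local Notation L2 := (L2 haar).
Local Notation dot := (@L2_dot _ _ R haar).
Local Notation H := (ind_space alpha chi).
Local Notation dotH := (@ind_dot R B alpha chi).
Local Notation cnt := (@counting int R).

Lemma ind_ext (f g : H) : (forall k : int, f (k, 0) = g (k, 0)) -> f = g.
Proof.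
move=> fg; apply/val_inj/funext => -[k b] /=.
by rewrite (ind_funE f k b) (ind_funE g k b) fg.
Qed.

Lemma ind_addE (f g : H) x : (f + g) x = f x + g x.
Proof. by []. Qed.

Lemma ind_scaleE a (f : H) x : (a *: f) x = a * f x.
Proof. by []. Qed.

Lemma nrm2_ind_EFin (f : H) :
  (nrm2 dotH f)%:E = (\int[cnt]_k (normc (f ((k : int), 0)) ^+ 2)%:E)%E.
Proof.
transitivity ((Re (cintegral cnt (fun j : int => f (j, 0) * (f (j, 0))^*)))%:E) => //.
rewrite cintegral_mulJ /= /Rintegral fineK//.
exact/integrable_fin_num/square_integrable_int/ind_funP.
Qed.

Lemma ind_of_proof (a : int -> R[i]) : square_integrable cnt a ->
  (fun x : semidirect alpha => (chi x.2 : R[i]) * a x.1) \in @ind_pred R B alpha chi.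
Proof.
move=> sa; apply/asboolP; split=> [j b /=|]; first by rewrite char0 mul1r.
by under eq_fun do rewrite /= char0 mul1r.
Qed.

Lemma ind_exists (a : int -> R[i]) : square_integrable cnt a ->
  exists f : H, forall k : int, f (k, 0) = a k.
Proof.
move=> sa; exists (IndSpace (ind_of_proof sa)) => k.
by rewrite /= char0 mul1r.
Qed.

Lemma cmeasurable_int (a : int -> R[i]) : cmeasurable a.
Proof. by split. Qed.

Lemma counting_parseval (u : L2) :
  (\int[cnt]_k (normc (dot u (eL2 R k)) ^+ 2)%:E = (nrm2 dot u)%:E)%E.
Proof.
rewrite ge0_integral_counting_int; last by move=> k; rewrite lee_fin sqr_ge0.
have h := parseval (@ebasisON R) (@L2_complete _ _ _ haar) (@ebasis_total R) (u := u).
apply/cvg_lim => //.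
rewrite (_ : (fun n => _) = EFin \o series (fun n => normc (dot u (ebasis R n)) ^+ 2)).
  by apply: cvg_EFin h; exact: nearW.
by apply/funext => n; rewrite /= /series /= -sumEFin.
Qed.

Lemma square_integrable_coef (u : L2) :
  square_integrable cnt (fun k => dot u (eL2 R k)).
Proof. by split; [exact: cmeasurable_int|rewrite counting_parseval ltry]. Qed.

Lemma cvg_series_ind (f : H) :
  cvgn (series (fun n => normc (f (int_of_idx n, 0)) ^+ 2)).
Proof.
apply: nondecreasing_is_cvgn.
  by apply: nondecreasing_series => n _ _; exact: sqr_ge0.
exists (nrm2 dotH f) => _ [n _ <-].
rewrite -lee_fin nrm2_ind_EFin ge0_integral_counting_int; last first.
  by move=> k; rewrite lee_fin sqr_ge0.
rewrite /series /= -sumEFin; apply: nneseries_lim_ge => k _ _.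
by rewrite lee_fin sqr_ge0.
Qed.

Definition fourier (u : L2) : H := projT1 (cid (ind_exists (square_integrable_coef u))).

Lemma fourierE u (k : int) : fourier u (k, 0) = dot u (eL2 R k).
Proof. by rewrite /fourier; case: cid. Qed.

Lemma fourier_linear : linear fourier.
Proof.
move=> a u v; apply: ind_ext => k.
by rewrite ind_addE ind_scaleE !fourierE linearDl linearZl_LR.
Qed.

Lemma nrm2_fourier u : nrm2 dotH (fourier u) = nrm2 dot u.
Proof.
apply: EFin_inj; rewrite nrm2_ind_EFin -counting_parseval.
by apply: eq_integral => k _; rewrite fourierE.
Qed.

Lemma dot_fourier u v : dotH (fourier u) (fourier v) = dot u v.
Proof. exact: (isometry_dot fourier_linear nrm2_fourier). Qed.

(** This is where completeness of L^2 enters: the orthonormal series with the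
    coefficients of f converges. *)
Lemma fourier_surj (f : H) : exists u, fourier u = f.
Proof.
have [u hu] := riesz_fischer (@ebasisON R) (@L2_complete _ _ _ haar) (@cvg_series_ind f).
exists u; apply: ind_ext => k; rewrite fourierE -(idx_of_intK k).
exact: (cvg_psum_coef (@ebasisON R) _ hu).
Qed.

Definition invfourier (f : H) : L2 := projT1 (cid (fourier_surj f)).

Lemma invfourierK : cancel invfourier fourier.
Proof. by move=> f; rewrite /invfourier; case: cid. Qed.

Lemma fourierK : cancel fourier invfourier.
Proof.
move=> u; apply/eqP; rewrite -subr_eq0; apply/eqP/fourier_total => k.
rewrite linearBl /= -!fourierE invfourierK subrr//.
Qed.

Lemma invfourier_linear : linear invfourier.
Proof.
move=> a f g; apply: (can_inj fourierK).
by rewrite fourier_linear !invfourierK.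
Qed.

Lemma fourier_unitary : unitary_map dotH dot invfourier fourier.
Proof.
split; [exact: invfourier_linear| |exact: invfourierK|exact: fourierK].
move=> f v; have := dot_fourier (invfourier f) v.
by rewrite invfourierK => h; exact: esym h.
Qed.

Lemma nrm2_invfourier f : nrm2 dot (invfourier f) = nrm2 dotH f.
Proof. by rewrite -nrm2_fourier invfourierK. Qed.

Lemma ind_normE (f : H) : `|f| = (nrm dotH f)%:C.
Proof. exact: dot_normE. Qed.

Lemma ind_repE j b (f : H) (k : int) :
  ind_rep (j, b) f (k, 0) = (chi (aut_exp alpha k b) : R[i]) * f (k + j, 0).
Proof. by rewrite -[LHS]/(f _) (ind_transE f j k b 0) char0 mulr1. Qed.

Lemma bounded_operator_indP (A : H -> H) : linear A ->
  (exists M : R, forall f, nrm dotH (A f) <= M * nrm dotH f) <-> bounded_operator A.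
Proof.
move=> lA; split=> [[M hM]|[_ [M hM]]].
  split=> //; exists M => f; rewrite !ind_normE -rmorphM lecR//.
by exists M => f; have := hM f; rewrite !ind_normE -rmorphM lecR.
Qed.

End IndSpace.

(** * Multiplication operators *)

Section MulL2.
Context d (T : measurableType d) (R : realType).
Variable mu : {measure set T -> \bar R}.
Implicit Types f g h : T -> R[i].
Local Notation L2 := (L2 mu).
Local Notation dot := (@L2_dot _ T R mu).

Definition mulL2 h (u : L2) : L2 := L2_of mu (fun x => h x * repr u x).

Lemma repr_mulL2 h u : bounded_cmeasurable h ->
  repr (mulL2 h u) = (fun x => h x * repr u x) %[ae mu].
Proof. by move=> bh; apply/repr_L2_of/square_integrableM => //; exact: L2funP. Qed.

Lemma mulL2_linear h : bounded_cmeasurable h -> linear (mulL2 h).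
Proof.
move=> bh a u v; apply/eq_L2P.
have h1 := repr_add (a *: mulL2 h u) (mulL2 h v).
have h2 := repr_scale a (mulL2 h u); rewrite -[L2_scale _ _]/(a *: mulL2 h u) in h2.
have h3 := repr_scale a u; rewrite -[L2_scale _ _]/(a *: u) in h3.
have h4 := repr_add (a *: u) v.
near=> z => _.
rewrite (near (repr_mulL2 (a *: u + v) bh) z _ Logic.I)//=.
rewrite (near h1 z _ Logic.I)// (near h2 z _ Logic.I)//.
rewrite (near (repr_mulL2 u bh) z _ Logic.I)// (near (repr_mulL2 v bh) z _ Logic.I)//=.
by rewrite (near h4 z _ Logic.I)// (near h3 z _ Logic.I)//; ring.
Unshelve. all: by end_near. Qed.

Lemma mulL2M f g u : bounded_cmeasurable f -> bounded_cmeasurable g ->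
  mulL2 (fun x => f x * g x) u = mulL2 f (mulL2 g u).
Proof.
move=> bf bg; apply/eq_L2P.
apply: filterS3 (repr_mulL2 u (bcmM bf bg)) (repr_mulL2 (mulL2 g u) bf) (repr_mulL2 u bg).
by move=> x /(_ Logic.I) -> /(_ Logic.I) -> /(_ Logic.I) -> _; rewrite mulrA.
Qed.

Lemma mulL2D f g u : bounded_cmeasurable f -> bounded_cmeasurable g ->
  mulL2 (fun x => f x + g x) u = mulL2 f u + mulL2 g u.
Proof.
move=> bf bg; apply/eq_L2P.
have h := repr_add (mulL2 f u) (mulL2 g u).
near=> x => _.
rewrite (near (repr_mulL2 u (bcmD bf bg)) x _ Logic.I)//= (near h x _ Logic.I)//.
rewrite (near (repr_mulL2 u bf) x _ Logic.I)// (near (repr_mulL2 u bg) x _ Logic.I)//.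
by rewrite mulrDl.
Unshelve. all: by end_near. Qed.

Lemma mulL2_cst c u : mulL2 (fun=> c) u = c *: u.
Proof.
apply/eq_L2P; have h := repr_scale c u; rewrite -[L2_scale _ _]/(c *: u) in h.
by apply: filterS2 (repr_mulL2 u (bcm_cst _ c)) h => x /(_ Logic.I) -> /(_ Logic.I) -> _.
Qed.

Lemma cvg_mulL2 (h_ : nat -> T -> R) (h : T -> R) u :
  (forall n, measurable_fun [set: T] (h_ n)) -> measurable_fun [set: T] h ->
  (forall n x, 0 <= h_ n x <= 1) -> (forall x, h_ n x @[n --> \oo] --> h x) ->
  cvg_form dot (fun n => mulL2 (fun x => (h_ n x)%:C) u) (mulL2 (fun x => (h x)%:C) u).
Proof.
move=> mh_ mh h01 h_h; rewrite /cvg_form.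
have hh01 x := cvgn_unit_interval (fun n => h01 n x) (h_h x).
have bh := bcm_real01 mh hh01.
have bh_ n := bcm_real01 (mh_ n) (h01 n).
have e n : nrm2 dot (mulL2 (fun x => (h_ n x)%:C) u - mulL2 (fun x => (h x)%:C) u) =
    \int[mu]_x (normc ((h_ n x - h x)%:C * repr u x) ^+ 2).
  apply: nrm2_L2.
    apply: cmeasurableM; last exact: (L2funP _).1.
    by apply: cmeasurable_real; exact: measurable_funB.
  have hB := repr_sub (mulL2 (fun x => (h_ n x)%:C) u) (mulL2 (fun x => (h x)%:C) u).
  apply: filterS3 hB (repr_mulL2 u (bh_ n)) (repr_mulL2 u bh).
  move=> x /(_ Logic.I) -> /(_ Logic.I) -> /(_ Logic.I) -> _.
  by rewrite -mulrBl -rmorphB.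
under eq_fun do rewrite e.
apply: cvg_mul_square_integrable; first exact: L2funP.
- by move=> n; apply: cmeasurable_real; exact: measurable_funB.
- move=> n x; rewrite normc_real; have /andP[a b] := h01 n x; have /andP[a' b'] := hh01 x.
  by rewrite ler_norml; apply/andP; split; lra.
- move=> x; under eq_fun do rewrite normcM normc_real.
  have h0 : h_ n x - h x @[n --> \oo] --> (0 : R) by apply/subr_cvg0; exact: h_h.
  have h1 : `|h_ n x - h x| @[n --> \oo] --> (0 : R).
    by rewrite -(@normr0 _ R); apply: (@cvg_norm _ R^o).
  by rewrite -(mul0r (normc (repr u x))); apply: cvgM h1 (cvg_cst _).
Qed.

End MulL2.

Section Commute.
Variables (R : realType) (p : nat).
Local Notation haar := (@haar R).
Local Notation L2 := (L2 haar).
Local Notation dot := (@L2_dot _ _ R haar).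
Local Notation C := (circle R).

Lemma mulL2_eL2 j k : mulL2 (@ez R j) (eL2 R k) = eL2 R (j + k).
Proof.
apply/eq_L2P.
apply: filterS3 (repr_mulL2 (eL2 R k) (bcm_ez R j)) (repr_eL2 R k) (repr_eL2 R (j + k)).
by move=> z /(_ Logic.I) -> /(_ Logic.I) -> /(_ Logic.I) -> _; rewrite ezD.
Qed.

Lemma mulL2_ez_powC k u : mulL2 (@ez R k \o powC p) u = mulL2 (@ez R (p%:Z * k)) u :> L2.
Proof. by congr mulL2; apply/funext => z; rewrite /= ez_powC. Qed.

Variable T : L2 -> L2.
Hypothesis lT : linear T.
Hypothesis bT : exists M : R, forall u, nrm dot (T u) <= M * nrm dot u.
Hypothesis Tez : forall u, T (mulL2 (@ez R p) u) = mulL2 (@ez R p) (T u).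

(** The functions h for which the conclusion holds satisfy the hypotheses of the
    monotone class theorem. They include z^* because multiplication by z^(-p) is
    inverse to multiplication by z^p, and they are closed under pointwise limits
    because T is continuous. *)
Lemma commute_mulL2_powC h : bounded_cmeasurable h ->
  forall u, T (mulL2 (h \o powC p) u) = mulL2 (h \o powC p) (T u).
Proof.
have ezNK (u : L2) : mulL2 (@ez R (- p%:Z)) (mulL2 (@ez R p) u) = u.
  rewrite -mulL2M; do ?exact: bcm_ez.
  under [X in mulL2 X]eq_fun do rewrite -ezD addNr ez0.
  by rewrite mulL2_cst scale1r.
have ezKN (u : L2) : mulL2 (@ez R p) (mulL2 (@ez R (- p%:Z)) u) = u.
  rewrite -mulL2M; do ?exact: bcm_ez.
  under [X in mulL2 X]eq_fun do rewrite -ezD subrr ez0.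
  by rewrite mulL2_cst scale1r.
have TezN (u : L2) : T (mulL2 (@ez R (- p%:Z)) u) = mulL2 (@ez R (- p%:Z)) (T u).
  by rewrite -[LHS]ezNK -Tez ezKN.
move=> bh; apply: (circle_monotone_class (P := fun h => forall u,
  T (mulL2 (h \o powC p) u) = mulL2 (h \o powC p) (T u))) bh.
- by move=> c u; rewrite !mulL2_cst (linear_funZ lT).
- by move=> u; have := Tez u; rewrite -[Posz p]mulr1 -!mulL2_ez_powC.
- rewrite (_ : (fun z : C => (z : R[i])^*) = @ez R (- 1)); last first.
    by apply/funext => z; rewrite ezN.
  by move=> u; have := TezN u; rewrite -[Posz p]mulr1 -mulrN -!mulL2_ez_powC.
- move=> f g bf bg Pf Pg u.
  have bf' := bcm_powC p bf; have bg' := bcm_powC p bg.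
  by rewrite (mulL2D u bf' bg') (mulL2D (T u) bf' bg') (linear_funD lT) Pf Pg.
- move=> f g bf bg Pf Pg u.
  have bf' := bcm_powC p bf; have bg' := bcm_powC p bg.
  by rewrite (mulL2M u bf' bg') (mulL2M (T u) bf' bg') Pf Pg.
- move=> h_ h' mh_ mh' h01 h_h Ph_ u.
  have mp := measurable_powC (R := R) p.
  have c v := @cvg_mulL2 _ _ _ haar
    (fun n z => h_ n (powC p z)) (fun z => h' (powC p z)) v
    (fun n => measurableT_comp (mh_ n) mp) (measurableT_comp mh' mp)
    (fun n z => h01 n _) (fun z => h_h _).
  have [M hM] := bT.
  apply: cvg_form_unique (c (T u)).
  have := cvg_form_bounded lT hM (c u); apply: cvg_trans.
  by apply: near_eq_cvg; apply: nearW => n /=; rewrite -Ph_.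
Qed.

End Commute.

(** * Periods of a character *)

Section Orbit.
Variables (R : realType) (B : zmodType) (alpha : zmodAut B) (chi : character R B).

Lemma character_ext (chi1 chi2 : character R B) : chi1 =1 chi2 -> chi1 = chi2.
Proof.
case: chi1 => f1 h1; case: chi2 => f2 h2 /= /funext e.
by subst f2; congr Character; exact: Prop_irrelevance.
Qed.

Lemma iter_dual_autE k b : iter k (dual_aut alpha) chi b = chi (aut_exp alpha (Posz k) b).
Proof. by elim: k b => // k IH b /=; rewrite IH /= -iterSr. Qed.

Lemma iter_dual_autP k : iter k (dual_aut alpha) chi = chi <->
  forall b, chi (aut_exp alpha (Posz k) b) = chi b.
Proof.
split=> [h b|h]; first by rewrite -iter_dual_autE h.
by apply: character_ext => b; rewrite iter_dual_autE.
Qed.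

Variable p : nat.
Hypothesis p0 : (0 < p)%N.
Hypothesis per : iter p (dual_aut alpha) chi = chi.

Lemma chi_aut_expMD (q k : int) b :
  chi (aut_exp alpha (q * p%:Z + k) b) = chi (aut_exp alpha k b).
Proof.
have hp c : chi (aut_exp alpha p c) = chi c by have /iter_dual_autP := per.
elim/int_rect: q => [|n IH|n IH]; first by rewrite mul0r add0r.
  by rewrite intS mulrDl mul1r -addrA aut_expD hp.
rewrite -IH -[LHS]hp -aut_expD; congr (chi (aut_exp _ _ _)).
by rewrite intS; ring.
Qed.

Hypothesis minp : forall k, (1 <= k < p)%N -> iter k (dual_aut alpha) chi <> chi.

(** The remainder of n modulo p may replace n, and it is not a period. *)
Lemma chi_separates (n : int) : ~~ (p%:Z %| n)%Z ->
  exists b, chi (aut_exp alpha n b) <> chi b.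
Proof.
move=> pn; apply/existsNP => h.
have r0 : (n %% p%:Z)%Z != 0 by apply: contra pn => /eqP/dvdz_mod0P.
have pz : p%:Z != 0 by rewrite eqz_nat -lt0n.
have rge := modz_ge0 n pz.
have rlt : ((n %% p%:Z)%Z < p%:Z) by apply: ltz_pmod.
case E : (n %% p%:Z)%Z r0 rge rlt => [r|//] r0 _ rlt.
apply: (minp (k := r)); first by move: r0 rlt; case: (r).
apply/iter_dual_autP => b.
by rewrite -E -(chi_aut_expMD (n %/ p%:Z)%Z) -divz_eq h.
Qed.

End Orbit.

(** * Operators commuting with multiplication by z *)

Section Trunc.
Context d (T : measurableType d) (R : realType).
Implicit Types f : T -> R[i].

(** A bounded representative of f when M is an essential bound of f. *)
Definition trunc (M : R) f x : R[i] := (\1_[set y | normc (f y) <= M] x : R)%:C * f x.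

Lemma measurable_normc_le M f : cmeasurable f -> measurable [set y | normc (f y) <= M].
Proof.
move=> mf; have := measurable_normc mf measurableT (measurable_itv `]-oo, M]).
by rewrite setTI; congr measurable; apply/seteqP; split => z /=; rewrite in_itv.
Qed.

Lemma truncE M f x : normc (f x) <= M -> trunc M f x = f x.
Proof. by move=> h; rewrite /trunc indicE mem_set// mul1r. Qed.

Lemma bcm_trunc M f : cmeasurable f -> bounded_cmeasurable (trunc M f).
Proof.
move=> mf; split.
  apply: cmeasurableM => //; apply: cmeasurable_real; apply: measurable_indic.
  exact: measurable_normc_le.
exists `|M| => x; rewrite /trunc indicE normcM normc_real.
have [h|h] := pselect (normc (f x) <= M).
  by rewrite mem_set// normr1 mul1r (le_trans h)// ler_norm.
by rewrite memNset// normr0 mul0r.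
Qed.

Lemma nrm_mulL2 (mu : {measure set T -> \bar R}) h M u : cmeasurable h ->
  (forall x, normc (h x) <= M) ->
  nrm (@L2_dot _ T R mu) (mulL2 h u) <= M * nrm (@L2_dot _ T R mu) u.
Proof.
move=> mh hM; have [M0|M0] := leP 0 M; last first.
  have := le_lt_trans (hM point) M0.
  by rewrite ltNge normc_ge0.
have bh : bounded_cmeasurable h by split=> //; exists M.
rewrite -(@ler_pXn2r _ 2)// ?nnegrE ?mulr_ge0 ?nrm_ge0// exprMn !sqr_nrm.
rewrite (nrm2_L2 _ (repr_mulL2 u bh)); last exact: cmeasurableM mh (L2funP _).1.
rewrite (nrm2_L2 (L2funP _).1 (ae_eq_refl _ _ _)).
have iu := square_integrable_int (L2funP (repr u)).
rewrite -RintegralZl//; apply: le_Rintegral => //.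
- exact/square_integrable_int/square_integrableM/L2funP.
- have := integrableZl measurableT (M ^+ 2) iu; congr integrable.
- move=> x _; rewrite normcM exprMn ler_wpM2r ?sqr_ge0//.
  by rewrite ler_pXn2r// nnegrE normc_ge0.
Qed.

End Trunc.

Section MulOperators.
Variable R : realType.
Local Notation haar := (@haar R).
Local Notation L2 := (L2 haar).
Local Notation dot := (@L2_dot _ _ R haar).
Local Notation C := (circle R).

Variable T : L2 -> L2.
Hypothesis lT : linear T.
Variable M : R.
Hypothesis bT : forall u, nrm dot (T u) <= M * nrm dot u.
Hypothesis Tez : forall u, T (mulL2 (@ez R 1) u) = mulL2 (@ez R 1) (T u).

Let Tmul h : bounded_cmeasurable h -> forall u, T (mulL2 h u) = mulL2 h (T u).
Proof.
move=> bh u; have := commute_mulL2_powC (p := 1) lT (ex_intro _ M bT) Tez bh u.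
by rewrite (_ : h \o powC 1 = h)//; apply/funext => z /=; rewrite /powC expg1.
Qed.

Let phi : C -> R[i] := repr (T (eL2 R 0)).

Let mphi : cmeasurable phi. Proof. exact: (L2funP _).1. Qed.

Let mul_eL20 h : bounded_cmeasurable h -> mulL2 h (eL2 R 0) = L2_of haar h.
Proof.
move=> bh; apply: L2_of_repr; last exact: bh.1.
apply: filterS2 (repr_mulL2 (eL2 R 0) bh) (repr_eL2 R 0).
by move=> z /(_ Logic.I) -> /(_ Logic.I) -> _; rewrite ez0 mulr1.
Qed.

(** Let phi = T 1 and let h be the indicator function of {|phi| > M}. As T commutes
    with multiplication by h, it maps the class of h to that of h phi, and
    int |h phi|^2 <= M^2 int |h|^2 forces h to vanish almost everywhere. *)
Lemma symbol_bounded : \forall z \ae haar, normc (repr (T (eL2 R 0)) z) <= M.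
Proof.
pose E := [set z | normc (phi z) <= M].
have mE : measurable (~` E) by apply: measurableC; exact: measurable_normc_le.
pose h (z : C) : R[i] := (\1_(~` E) z : R)%:C.
have bh : bounded_cmeasurable h by exact: bcm_indic.
have [M0|M0] := ltP M 0.
  have := le_trans (nrm_ge0 dot _) (bT (eL2 R 0)).
  have -> : nrm dot (eL2 R 0) = 1 
    by rewrite /nrm -[nrm2 _ _]/(Re (dot (eL2 R 0) (eL2 R 0))) dot_eL2 eqxx /= sqrtr1.
  by rewrite mulr1 leNgt M0.
have e1 : nrm2 dot (T (mulL2 h (eL2 R 0))) = \int[haar]_z (normc (h z * phi z) ^+ 2).
  by rewrite (Tmul bh) (nrm2_L2 _ (repr_mulL2 _ bh))//; exact: cmeasurableM bh.1 mphi.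
have e2 : nrm2 dot (mulL2 h (eL2 R 0)) = \int[haar]_z (normc (h z) ^+ 2).
  by rewrite mul_eL20// (nrm2_L2 bh.1)//; exact/repr_L2_of/square_integrable_bcm.
have le12 : \int[haar]_z (normc (h z * phi z) ^+ 2) <=
    M ^+ 2 * \int[haar]_z (normc (h z) ^+ 2).
  rewrite -e1 -e2 -!sqr_nrm -exprMn ler_pXn2r ?nnegrE ?mulr_ge0 ?nrm_ge0//.
pose G z := normc (h z * phi z) ^+ 2 - M ^+ 2 * normc (h z) ^+ 2.
have i1 : haar.-integrable [set: C] (EFin \o (fun z => normc (h z * phi z) ^+ 2)).
  by apply/square_integrable_int/square_integrableM => //; exact: L2funP.
have i2 : haar.-integrable [set: C] (EFin \o (fun z => normc (h z) ^+ 2)).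
  by apply/square_integrable_int/square_integrable_bcm.
have i3 : haar.-integrable [set: C] (EFin \o (fun z => M ^+ 2 * normc (h z) ^+ 2)).
  by have := integrableZl measurableT (M ^+ 2) i2; congr integrable.
have iG : haar.-integrable [set: C] (EFin \o G).
  by have := integrableB measurableT i1 i3; congr integrable.
have hE z : E z -> h z = 0 by move=> Ez; rewrite /h indicE memNset//= => /(_ Ez).
have hnE z : ~ E z -> h z = 1 by move=> nEz; rewrite /h indicE mem_set.
have G0 z : 0 <= G z.
  rewrite /G; have [/hE ->|nEz] := pselect (E z).
    by rewrite mul0r normc0 expr0n mulr0 subr0.
  rewrite hnE// mul1r normc1 expr1n mulr1 subr_ge0 ler_pXn2r ?nnegrE ?normc_ge0//.
  by apply/ltW; rewrite ltNge; exact/negP.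
have IG : \int[haar]_z G z = 0.
  apply/eqP; rewrite eq_le Rintegral_ge0 ?andbT//.
  rewrite (RintegralB measurableT i1 i3) (RintegralZl _ measurableT i2) subr_le0.
  exact: le12.
have : (\int[haar]_z `|(G z)%:E| = 0)%E.
  under eq_integral do rewrite /= ger0_norm//.
  by rewrite -[LHS]fineK ?integrable_fin_num// [fine _]IG.
move=> /(ae_eq_integral_abs _ measurableT (measurable_int _ iG)).1.
apply: filterS => z /(_ Logic.I) [Gz]; apply: contrapT => nEz.
move: Gz; rewrite /G hnE// mul1r normc1 expr1n mulr1 => /eqP.
rewrite subr_eq0 eqrXn2 ?normc_ge0// => /eqP h'.
by apply: nEz; rewrite /E /= h'.
Qed.

Let psi : C -> R[i] := trunc M phi.

Let psi_phi : psi = phi %[ae haar].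
Proof. by apply: filterS symbol_bounded => z h _; rewrite /psi truncE. Qed.

Let bpsi : bounded_cmeasurable psi. Proof. exact: bcm_trunc. Qed.

(** For bounded h one has T h = T (h 1) = h (T 1). The truncations of u are bounded
    and converge to u, and both sides are continuous in u. *)
Lemma commute_mulop u : T u = mulL2 psi u.
Proof.
pose h_ (n : nat) (z : C) : R := \1_[set z | normc (repr u z) <= n%:R] z.
have mu_ : cmeasurable (repr u) := (L2funP _).1.
have mh_ n : measurable_fun [set: C] (h_ n).
  by apply: measurable_indic; exact: measurable_normc_le.
have h01 n z : 0 <= h_ n z <= 1 by exact: indic01.
have h_h z : h_ n z @[n --> \oo] --> (1 : R).
  apply: cvg_near_cst; near=> n; rewrite /h_ indicE mem_set//=.
  by near: n; exact: nbhs_infty_ger.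
have m1 : measurable_fun [set: C] (fun=> 1 : R) by exact: measurable_cst.
have c : cvg_form dot (fun n => mulL2 (fun z => (h_ n z)%:C) u) u.
  by have := cvg_mulL2 u mh_ m1 h01 h_h; rewrite mulL2_cst scale1r.
have c1 := cvg_form_bounded lT bT c.
have [mpsi [N psiN]] := bpsi.
have c2 := cvg_form_bounded (mulL2_linear (mu := haar) bpsi)
  (fun v => nrm_mulL2 (mu := haar) v mpsi psiN) c.
apply: (cvg_form_unique c1); move: c2; rewrite /cvg_form.
suff E n : mulL2 psi (mulL2 (fun z => (h_ n z)%:C) u) =
    T (mulL2 (fun z => (h_ n z)%:C) u).
  by under eq_fun do rewrite /= E.
have bt : bounded_cmeasurable (trunc n%:R (repr u)) by exact: bcm_trunc.
have -> : mulL2 (fun z => (h_ n z)%:C) u = mulL2 (trunc n%:R (repr u)) (eL2 R 0).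
  by rewrite mul_eL20.
rewrite (Tmul bt); apply/eq_L2P.
apply: filterS3 (repr_mulL2 (mulL2 (trunc n%:R (repr u)) (eL2 R 0)) bpsi)
  (repr_mulL2 (T (eL2 R 0)) bt) (filterI psi_phi
  (filterI (repr_mulL2 (eL2 R 0) bt) (repr_eL2 R 0))).
move=> z /(_ Logic.I) e1 /(_ Logic.I) e2 [/(_ Logic.I) e3].
move=> [/(_ Logic.I) e4 /(_ Logic.I) e5] _.
by rewrite e1 e2 e3 e4 e5 ez0 mulr1 mulrC.
Unshelve. all: by end_near. Qed.

Lemma repr_commute_mulop u :
  repr (T u) = (fun z => repr (T (eL2 R 0)) z * repr u z) %[ae haar].
Proof.
rewrite commute_mulop; apply: filterS2 (repr_mulL2 u bpsi) psi_phi.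
by move=> z /(_ Logic.I) -> /(_ Logic.I) -> _.
Qed.

End MulOperators.

(** * The commutant of the induced representation *)

Section Commutant.
Variables (R : realType) (B : zmodType) (alpha : zmodAut B) (chi : character R B).
Local Notation haar := (@haar R).
Local Notation L2 := (L2 haar).
Local Notation dot := (@L2_dot _ _ R haar).
Local Notation H := (ind_space alpha chi).
Local Notation dotH := (@ind_dot R B alpha chi).
Local Notation C := (circle R).
Local Notation W := (@invfourier R B alpha chi).
Local Notation Wstar := (@fourier R B alpha chi).
Local Notation rho := (@ind_rep R B alpha chi).

Lemma dot_mulL2_ez j (u : L2) k :
  dot (mulL2 (@ez R j) u) (eL2 R k) = dot u (eL2 R (k - j)).
Proof.
have mu_ : cmeasurable (repr u) := (L2funP _).1.
rewrite (L2_dotE (cmeasurableM (cmeasurable_ez R j) mu_) (cmeasurable_ez R k)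
  (repr_mulL2 u (bcm_ez R j)) (repr_eL2 R k)).
rewrite (L2_dotE mu_ (cmeasurable_ez R (k - j)) (ae_eq_refl _ _ _) (repr_eL2 R (k - j))).
congr cintegral; apply/funext => z.
by rewrite -!ezN opprB ezD; ring.
Qed.

Lemma fourier_mulL2_ez j (u : L2) : Wstar (mulL2 (@ez R j) u) = rho (- j, 0) (Wstar u).
Proof.
apply: ind_ext => k.
by rewrite ind_repE !fourierE dot_mulL2_ez raddf0 char0 mul1r.
Qed.

Lemma ind_rep_linear g : linear (rho g).
Proof.
case: g => j b a f h; apply: ind_ext => k.
by rewrite ind_addE ind_scaleE !ind_repE ind_addE ind_scaleE mulrDr mulrCA.
Qed.

Lemma nrm2_ind_rep g f : nrm2 dotH (rho g f) = nrm2 dotH f.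
Proof.
case: g => j b; apply: EFin_inj; rewrite !nrm2_ind_EFin.
rewrite -(@ge0_integral_counting_shift R (fun k => (normc (f (k, 0)) ^+ 2)%:E) j).
  by apply: eq_integral => k _; rewrite ind_repE normcM normc_circle mul1r.
by move=> k; rewrite lee_fin sqr_ge0.
Qed.

Lemma fourier_eL2 (j k : int) : Wstar (eL2 R j) (k, 0) = (j == k)%:R.
Proof. by rewrite fourierE dot_eL2. Qed.

Variable p : nat.
Hypothesis p0 : (0 < p)%N.
Hypothesis per : iter p (dual_aut alpha) chi = chi.
Hypothesis minp : forall k, (1 <= k < p)%N -> iter k (dual_aut alpha) chi <> chi.

(** Since chi has period p, the operators of the representation commute with the
    shift by p, which the Fourier transform turns into multiplication by z^p. Hence
    they commute with multiplication by every bounded function of z^p. *)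
Lemma mulop_in_commutant f M : Linfty haar f ->
  is_mulop (mu := haar) (fun z : C => f (z ^+ p)%g) M ->
  commutant rho (Wstar \o M \o W).
Proof.
move=> [mf [K fK]] hM; pose f' := trunc K f.
have bf' : bounded_cmeasurable f' by exact: bcm_trunc.
have ff' : \forall z \ae haar, f' (powC p z) = f (powC p z).
  apply: (ae_powC p0 (Q := fun z => f' z = f z)).
  by apply: filterS fK => z; exact: truncE.
have bfp := bcm_powC p bf'.
have ME u : M u = mulL2 (f' \o powC p) u.
  apply/eq_L2P; apply: filterS3 (hM u) (repr_mulL2 u bfp) ff'.
  by move=> z /(_ Logic.I) e1 /(_ Logic.I) e2 e3 _; rewrite e1 e2 /= e3.
have lM : linear M.
  by move=> a u v; rewrite !ME (mulL2_linear (mu := haar) bfp).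
have [mfp [N hN]] := bfp.
have lA : linear (Wstar \o M \o W).
  by move=> a u v /=; rewrite invfourier_linear lM fourier_linear.
split.
  apply/bounded_operator_indP => //; exists N => h.
  have e1 : nrm dotH (Wstar (M (W h))) = nrm dot (M (W h)).
    by rewrite /nrm nrm2_fourier.
  have e2 : nrm dot (W h) = nrm dotH h by rewrite /nrm nrm2_invfourier.
  by rewrite /= e1 ME -e2; exact: nrm_mulL2.
move=> g; pose T := W \o rho g \o Wstar.
have lT : linear T.
  by move=> a u v; rewrite /T /= fourier_linear ind_rep_linear invfourier_linear.
have bT : exists K : R, forall u, nrm dot (T u) <= K * nrm dot u.
  by exists 1 => u; rewrite mul1r /nrm /T /= nrm2_invfourier nrm2_ind_rep nrm2_fourier.
have Tez u : T (mulL2 (@ez R p) u) = mulL2 (@ez R p) (T u).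
  apply: (can_inj (@fourierK R B alpha chi)).
  rewrite fourier_mulL2_ez /T /= !invfourierK fourier_mulL2_ez.
  apply: ind_ext => k; case: g {T lT bT} => j b.
  rewrite !ind_repE !raddf0 char0 !mul1r.
  congr (circle_val _ * _); last by rewrite addrAC.
  have := chi_aut_expMD per (- 1) k b; rewrite mulN1r addrC => <-.
  by congr (chi (aut_exp _ _ _)).
apply/funext => h /=; apply: (can_inj (@invfourierK R B alpha chi)).
rewrite fourierK.
have := commute_mulL2_powC lT bT Tez bf' (W h).
by rewrite -!ME /T /= invfourierK => <-.
Qed.

(** The operator T transported to L^2 commutes with multiplication by z, so it is
    multiplication by phi = T 1. Commutation with rho (0, b) shows that the n-th
    coefficient of phi can only be nonzero if chi (alpha^n b) = chi b for all b, that
    is, if p divides n. So phi is F (z^p), where the m-th coefficient of F is the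
    (p m)-th coefficient of phi. *)
Lemma commutant_is_mulop A : commutant rho A ->
  exists2 f, Linfty haar f &
    is_mulop (mu := haar) (fun z : C => f (z ^+ p)%g) (W \o A \o Wstar).
Proof.
move=> [bA comA]; have lA := bA.1.
have /(bounded_operator_indP lA)[M hM] := bA.
pose T := W \o A \o Wstar.
have lT : linear T.
  by move=> a u v; rewrite /T /= fourier_linear lA invfourier_linear.
have bT u : nrm dot (T u) <= M * nrm dot u.
  have e1 : nrm dot (T u) = nrm dotH (A (Wstar u)) by rewrite /nrm nrm2_invfourier.
  have e2 : nrm dotH (Wstar u) = nrm dot u by rewrite /nrm nrm2_fourier.
  by rewrite e1 -e2.
have comA' g h : A (rho g h) = rho g (A h) by exact: (congr1 (fun F => F h) (comA g)).
have Tez u : T (mulL2 (@ez R 1) u) = mulL2 (@ez R 1) (T u).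
  apply: (can_inj (@fourierK R B alpha chi)).
  by rewrite fourier_mulL2_ez /T /= !invfourierK fourier_mulL2_ez comA'.
pose phi := T (eL2 R 0).
have phi0 n : ~~ (p%:Z %| n)%Z -> dot phi (eL2 R n) = 0.
  move=> /(chi_separates p0 per minp)[b hb].
  pose d0 := Wstar (eL2 R 0).
  have E : rho (0, b) d0 = (chi b : R[i]) *: d0.
    apply: ind_ext => k; rewrite ind_scaleE ind_repE addr0 fourier_eL2.
    by have [<-|] := eqVneq 0 k; rewrite ?mulr0.
  have := congr1 (fun F : H => F (n, 0)) (comA' (0, b) d0).
  rewrite E (linear_funZ lA) ind_scaleE ind_repE addr0.
  have -> : A d0 (n, 0) = dot phi (eL2 R n).
    by rewrite -(fourierE alpha chi) /phi /T /= invfourierK.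
  move=> h; apply/eqP; apply/negPn/negP => nz; apply: hb; apply: val_inj => /=.
  by apply: (mulIf nz).
pose ep n := eL2 R (p%:Z * int_of_idx n).
have epON i j : dot (ep i) (ep j) = (i == j)%:R.
  rewrite dot_eL2 (inj_eq (mulfI _)) ?(can_eq int_of_idxK)//.
  by rewrite eqz_nat -lt0n.
have cc : cvgn (series (fun n => normc (dot phi (ep n)) ^+ 2)).
  exact: (@cvg_series_coef _ _ _ ep epON phi).
have [F hF] := riesz_fischer (@ebasisON R) (@L2_complete _ _ _ haar) cc.
have Fcoef m : dot F (eL2 R m) = dot phi (eL2 R (p%:Z * m)).
  by rewrite -(idx_of_intK m); exact: (cvg_psum_coef (@ebasisON R) _ hF).
(* Both sides have the same coefficients: at p m because composition with z^p
   preserves scalar products, and elsewhere because F (z^p) is a limit of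
   combinations of powers of z^p. *)
have Fphi : comp_powC p F = phi.
  apply/eqP; rewrite -subr_eq0; apply/eqP/fourier_total => k.
  rewrite linearBl /=; apply/eqP; rewrite subr_eq0; apply/eqP.
  have [/dvdzP[m ->]|pk] := boolP (p%:Z %| k)%Z.
    rewrite mulrC -Fcoef -(dot_comp_powC p0 F) comp_powC_eL2//.
  rewrite (phi0 _ pk).
  have cF := cvg_form_bounded (dV := dot) (M := 1) (comp_powC_linear p0) _ hF.
  apply: (cvg_form_dotl (cF _)).
    by move=> u; rewrite mul1r /nrm nrm2_comp_powC.
  apply: nearW => n /=; rewrite (linear_psum _ _ _ (comp_powC_linear p0)).
  apply: form_psum_eq0 => i; rewrite /= /ebasis comp_powC_eL2//.
  have := dot_eL2 R (p%:Z * int_of_idx i) k.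
  rewrite (_ : (_ == k) = false)//; apply/negbTE/eqP => e.
  by move: pk; rewrite -e dvdz_mulr.
have FT : repr phi = repr F \o powC p %[ae haar] by rewrite -Fphi; exact: repr_comp_powC.
exists (repr F).
  split; first exact: (L2funP _).1.
  exists M.
  have mE : measurable (~` [set z | normc (repr F z) <= M]).
    by apply: measurableC; apply: measurable_normc_le; exact: (L2funP _).1.
  exists (~` [set z | normc (repr F z) <= M]); split=> //.
  have [N [mN N0 hN]] : \forall z \ae haar, normc (repr F (powC p z)) <= M.
    apply: filterS2 FT (symbol_bounded lT bT Tez) => z /(_ Logic.I) e h.
    by rewrite -[X in normc X]e.
  suff E0 : haar (~` [set z | normc (repr F z) <= M]) = 0 by exact: E0.
  rewrite -(haar_powC p0 mE); apply: (subset_measure0 _ mN _ N0) => //.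
  by rewrite -[X in measurable X]setTI; exact: (measurable_powC p measurableT mE).
move=> u; apply: filterS2 (repr_commute_mulop lT bT Tez u) FT.
by move=> z /(_ Logic.I) e1 /(_ Logic.I) e2 _; rewrite e1 [X in X * _]e2.
Qed.

Lemma commutant_eq :
  [set W \o A \o Wstar | A in commutant rho] =
  [set M | exists2 f, Linfty haar f &
             is_mulop (mu := haar) (fun z : C => f (z ^+ p)%g) M].
Proof.
apply/seteqP; split=> [_ [A cA <-]|M [f Lf hM]]; first exact: commutant_is_mulop.
exists (Wstar \o M \o W); first exact: mulop_in_commutant hM.
by apply/funext => u /=; rewrite !fourierK.
Qed.

End Commutant.

(** * Irreducibility *)

Section Irreducible.
Variables (R : realType) (B : zmodType) (alpha : zmodAut B) (chi : character R B).
Local Notation haar := (@haar R).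
Local Notation L2 := (L2 haar).
Local Notation dot := (@L2_dot _ _ R haar).
Local Notation H := (ind_space alpha chi).
Local Notation dotH := (@ind_dot R B alpha chi).
Local Notation C := (circle R).
Local Notation W := (@invfourier R B alpha chi).
Local Notation Wstar := (@fourier R B alpha chi).
Local Notation rho := (@ind_rep R B alpha chi).
Local Notation cnt := (@counting int R).

Lemma closed_indP (K : set H) : closed K <->
  forall v, (forall e : R, 0 < e -> exists2 w, K w & nrm dotH (v - w) < e) -> K v.
Proof.
split=> [cK v hv|hK].
  apply: cK => A /nbhs_ballP[eps /= eps0 epsA].
  have /hv[w Kw vw] : 0 < Re eps by move: eps0; rewrite ltcE /= => /andP[].
  exists w; split=> //; apply: epsA; rewrite -ball_normE /= ind_normE.
  rewrite (_ : eps = (Re eps)%:C) ?ltcR//.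
  by move: eps0; rewrite ltcE /= => /andP[/eqP h _]; apply: complex_ext.
move=> v cv; apply: hK => e e0.
have e0' : 0 < e%:C by rewrite ltcR.
have [w [Kw]] := cv _ (nbhsx_ballx v _ e0').
by rewrite -ball_normE /= ind_normE ltcR => h; exists w.
Qed.

Lemma closed_kernel (A : H -> H) : bounded_operator A -> closed [set v | A v = 0].
Proof.
move=> bA; have lA := bA.1; have /(bounded_operator_indP lA)[M hM] := bA.
apply/closed_indP => v hv /=; apply: (@nrm_eq0 _ _ dotH).
apply/eqP; rewrite eq_le nrm_ge0 andbT; apply/ler_addgt0Pl => e e0.
rewrite addr0.
have d0 : 0 < e / (`|M| + 1) by rewrite divr_gt0// ltr_wpDl.
have [w /= Aw vw] := hv _ d0.
have := hM (v - w); rewrite (linear_funB lA) Aw subr0 => /le_trans; apply.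
apply: (@le_trans _ _ ((`|M| + 1) * nrm dotH (v - w))).
  by rewrite ler_wpM2r ?nrm_ge0//; apply: ler_wpDr => //; exact: ler_norm.
by rewrite mulrC -ler_pdivlMr ?ltr_wpDl// ltW.
Qed.

(** A function of constant sign with zero integral is zero almost everywhere, but
    Im z^p = 0 almost everywhere would identify the orthogonal vectors z^p and
    z^(-p). *)
Lemma Im_ez_not_signed p : (0 < p)%N ->
  ~ (\forall z \ae haar, 0 <= Im (@ez R p z)) /\
  ~ (\forall z \ae haar, Im (@ez R p z) <= 0).
Proof.
move=> p0; set g := fun z : C => Im (@ez R p z).
have [_ ig] := cintegrable_bcm haar (bcm_ez R p).
have g0 : \int[haar]_z g z = 0.
  have := congr1 Im (cintegral_ez R p); rewrite /cintegral /=.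
  by rewrite (_ : (Posz p == 0) = false)// eqz_nat gtn_eqF.
have key : g = cst 0 %[ae haar] -> False.
  move=> gz; suff e : eL2 R p = eL2 R (- p%:Z).
    have := dot_eL2 R p p; rewrite {2}e dot_eL2 eqxx.
    rewrite (_ : (_ == _) = false); last by apply/eqP; lia.
    by move=> /eqP; rewrite eq_sym oner_eq0.
  apply/eq_L2P; apply: filterS3 (repr_eL2 R p) (repr_eL2 R (- p%:Z)) gz.
  move=> z /(_ Logic.I) -> /(_ Logic.I) -> /(_ Logic.I) h _.
  rewrite ezN; move: h; rewrite /g; case: (ez p z) => a b /= ->.
  by apply: complex_ext; rewrite //= oppr0.
have iabs : (\int[haar]_z `|(g z)%:E| = 0)%E -> g = cst 0 %[ae haar].
  move=> /(ae_eq_integral_abs _ measurableT (measurable_int _ ig)).1.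
  by apply: filterS => z /[apply] -[].
have mg := measurable_int _ ig.
have g0E : (\int[haar]_z (g z)%:E = 0)%E.
  by rewrite -[LHS]fineK ?(integrable_fin_num measurableT ig)// [fine _]g0.
split=> hs; apply: key; apply: iabs.
- rewrite -g0E; apply: ae_eq_integral => //; first exact: measurableT_comp.
  by apply: filterS hs => z h _; rewrite /= ger0_norm.
- transitivity (\int[haar]_z ((-1)%:E * (g z)%:E))%E; last first.
    by rewrite (integralZl measurableT ig) [X in (_ * X)%E](_ : _ = 0%E) ?mule0.
  apply: ae_eq_integral => //; first exact: measurableT_comp.
    by apply: measurable_funeM.
  by apply: filterS hs => z h _; rewrite /= ler0_norm// -EFinM mulN1r.
Qed.

(** The kernel of an operator of the commutant is a closed invariant subspace. *)
Lemma irreducible_kernel (A : H -> H) : irreducible_rep rho -> commutant rho A ->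
  (forall v, A v = 0 -> v = 0) \/ (forall v, A v = 0).
Proof.
move=> [_ irr] [bA comA]; have lA := bA.1.
have comA' g v : A (rho g v) = rho g (A v) by exact: (congr1 (fun F => F v) (comA g)).
have [| | |K0|KT] := irr [set v : H | A v = 0] (closed_kernel bA).
- exact: (linear_fun0 lA).
- by move=> a u v /= Ku Kv; rewrite lA Ku Kv scaler0 addr0.
- by move=> g v /= Kv; rewrite comA' Kv (linear_fun0 (ind_rep_linear _)).
- by left=> v Av; have : [set v : H | A v = 0] v by []; rewrite K0.
- by right=> v; have : [set: H] v by []; rewrite -KT.
Qed.

(** For the least period p, multiplication by the indicator function of
    {Im z^p > 0} comes from the commutant; it is neither injective nor zero. *)
Lemma irreducible_no_period : irreducible_rep rho ->
  ~ exists k : nat, (1 <= k)%N /\ iter k (dual_aut alpha) chi = chi.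
Proof.
move=> irr [k0 [k01 hk0]].
have ex : exists k : nat, (0 < k)%N && `[< iter k (dual_aut alpha) chi = chi >].
  by exists k0; rewrite k01; apply/asboolP.
case: (ex_minnP ex) => p /andP[p0 /asboolP per] minp'.
have minp k : (1 <= k < p)%N -> iter k (dual_aut alpha) chi <> chi.
  move=> /andP[k1 kp] hk; have := minp' k; rewrite k1 leqNgt kp => /(_ _)/negP.
  by apply => //; apply/asboolP.
pose E := [set z : C | 0 < Im (z : R[i])].
have mE : measurable E.
  have := (@cmeasurable_circle R).2 measurableT _ (measurable_itv `]0, +oo[).
  rewrite setTI; congr measurable.
  by apply/seteqP; split => z /=; rewrite in_itv /= andbT.
pose f (z : C) : R[i] := (\1_E z : R)%:C.
pose f' (z : C) : R[i] := (\1_(~` E) z : R)%:C.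
have bf : bounded_cmeasurable f by exact: bcm_indic.
have bf' : bounded_cmeasurable f' by apply: bcm_indic; exact: measurableC.
have bfp := bcm_powC p bf; have bfp' := bcm_powC p bf'.
pose M (u : L2) := mulL2 (f \o powC p) u.
have cA : commutant rho (Wstar \o M \o W).
  apply: (mulop_in_commutant p0 per (f := f)).
    by case: bf => mf [K hK]; split=> //; exists K; exact: aeW.
  by move=> u; exact: repr_mulL2.
have h0 u : Wstar u = 0 -> u = 0.
  move=> e; rewrite -[LHS](fourierK alpha chi) e.
  exact: linear_fun0 (@invfourier_linear _ _ _ _).
have [K0|KT] := irreducible_kernel irr cA.
- have h : mulL2 (f' \o powC p) (eL2 R 0) = 0.
    apply: h0; apply: K0; rewrite /= fourierK /M -mulL2M//.
    rewrite (_ : (fun x => _) = fun=> 0).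
      by rewrite mulL2_cst scale0r (linear_fun0 (fourier_linear _ _)).
    apply/funext => z; rewrite /= /f /f' !indicE in_setC.
    by case: (_ \in E); rewrite /= ?mul0r ?mulr0.
  apply: (Im_ez_not_signed p0).1.
  have r0 : repr (0 : L2) = cst 0 %[ae haar].
    by have := repr_pi (0 : L2fun haar); rewrite raddf0.
  apply: filterS3 (repr_mulL2 (eL2 R 0) bfp') (repr_eL2 R 0) r0.
  move=> z /(_ Logic.I) e1 /(_ Logic.I) e2 /(_ Logic.I) e3.
  move: e1; rewrite h e3 e2 ez0 mulr1 /= /f' indicE in_setC.
  have [|] := boolP (powC p z \in E); last first.
    by move=> _ /= [] /eqP; rewrite eq_sym oner_eq0.
  by rewrite inE /E /= circle_expg => /ltW.
- have h : mulL2 (f \o powC p) (eL2 R 0) = 0.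
    by apply: h0; have := KT (Wstar (eL2 R 0)); rewrite /= fourierK.
  apply: (Im_ez_not_signed p0).2.
  have r0 : repr (0 : L2) = cst 0 %[ae haar].
    by have := repr_pi (0 : L2fun haar); rewrite raddf0.
  apply: filterS3 (repr_mulL2 (eL2 R 0) bfp) (repr_eL2 R 0) r0.
  move=> z /(_ Logic.I) e1 /(_ Logic.I) e2 /(_ Logic.I) e3.
  move: e1; rewrite h e3 e2 ez0 mulr1 /= /f indicE.
  have [|] := boolP (powC p z \in E).
    by move=> _ /= [] /eqP; rewrite eq_sym oner_eq0.
  by rewrite notin_setE /E /= circle_expg => /negP; rewrite -leNgt.
Qed.

(** The square of the left-hand side is (1 + Re w) / 2, and Re w < 1. *)
Lemma normc_half1 (w : R[i]) : normc w = 1 -> w != 1 ->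
  normc (2^-1%:C * (1 + w)) < 1.
Proof.
case: w => a b /= /(congr1 (fun x => x ^+ 2)).
rewrite sqr_sqrtr ?addr_ge0 ?sqr_ge0// expr1n => h w1.
have a1 : a < 1.
  rewrite lt_neqAle; apply/andP; split; last by have := sqr_ge0 b; nra.
  apply: contraNneq w1 => a1; apply/eqP; rewrite a1.
  have /eqP : b ^+ 2 = 0 by rewrite a1 in h; lra.
  by rewrite sqrf_eq0 => /eqP ->.
rewrite -[X in _ < X]sqrtr1 ltr_sqrt//.
rewrite [X in X < 1](_ : _ = (1 + 2 * a + (a ^+ 2 + b ^+ 2)) / 4); last by field.
by rewrite h; lra.
Qed.

Hypothesis nper : ~ exists k : nat, (1 <= k)%N /\ iter k (dual_aut alpha) chi = chi.

Lemma separates (n : int) : n != 0 -> exists b, chi (aut_exp alpha n b) <> chi b.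
Proof.
move=> n0; apply/existsNP => h; apply: nper.
case: n n0 h => [k|k] k0 h.
  exists k; split; first by rewrite lt0n.
  exact/iter_dual_autP.
exists k.+1; split=> //; apply/iter_dual_autP => b.
rewrite -h -aut_expD NegzE addrC; congr (chi _).
by rewrite [X in aut_exp _ X _](_ : _ = 0)//; ring.
Qed.

Variable K : set H.
Hypothesis KD : forall a u v, K u -> K v -> K (a *: u + v).
Hypothesis K0 : K 0.
Hypothesis Krho : forall g v, K v -> K (rho g v).

(** Such multipliers contract the coordinates of a vector of K, except the one at
    the origin, without leaving K. *)
Definition K_multiplier (m : int -> R[i]) :=
  [/\ forall k, normc (m k) <= 1, m 0 = 1 &
      forall v, K v -> exists2 w, K w & forall k : int, w (k, 0) = m k * v (k, 0)].

Lemma K_multiplier1 : K_multiplier (fun=> 1).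
Proof.
by split=> // [k|v Kv]; [rewrite normc1|exists v => // k; rewrite mul1r].
Qed.

Lemma K_multiplierM m1 m2 : K_multiplier m1 -> K_multiplier m2 ->
  K_multiplier (fun k => m1 k * m2 k).
Proof.
move=> [b1 e1 s1] [b2 e2 s2]; split=> [k||v Kv].
- by rewrite normcM mulr_ile1 ?normc_ge0.
- by rewrite e1 e2 mulr1.
have [w Kw wE] := s2 v Kv; have [x Kx xE] := s1 w Kw.
by exists x => // k; rewrite xE wE mulrA.
Qed.

Lemma K_multiplierX m n : K_multiplier m -> K_multiplier (fun k => m k ^+ n).
Proof.
move=> hm; elim: n => [|n IH]; first exact: K_multiplier1.
by have := K_multiplierM hm IH; under eq_fun do rewrite -exprS.
Qed.

(** The multiplier of the mean of the identity and of rho (0, b) normalized to fix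
    the coordinate at the origin. *)
Definition char_multiplier (b : B) (k : int) : R[i] :=
  2^-1%:C * (1 + (chi b : R[i])^* * (chi (aut_exp alpha k b) : R[i])).

Lemma K_multiplier_char b : K_multiplier (char_multiplier b).
Proof.
rewrite /char_multiplier; split=> [k||v Kv].
- rewrite normcM normc_real ger0_norm ?invr_ge0// -ler_pdivlMl ?invr_gt0// invrK mulr1.
  apply: le_trans (le_normcD _ _) _.
  by rewrite normcM normc_conj !normc_circle normc1; lra.
- rewrite /= mulcJ normc_circle expr1n.
  by apply: complex_ext => /=; field.
exists (2^-1%:C *: ((chi b : R[i])^* *: rho (0, b) v + v) + 0).
  by apply: KD => //; apply: KD => //; exact: Krho.
move=> k; rewrite addr0 !(ind_scaleE, ind_addE) ind_repE addr0; ring.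
Qed.

Lemma K_multiplier_small (k : int) (e : R) : k != 0 -> 0 < e ->
  exists2 m, K_multiplier m & normc (m k) <= e.
Proof.
move=> k0 e0; have [b hb] := separates k0.
pose t := char_multiplier b k.
have t1 : normc t < 1.
  apply: normc_half1; first by rewrite normcM normc_conj !normc_circle mulr1.
  apply: contra_not_neq hb => h; apply: val_inj => /=.
  have nz : (chi b : R[i])^* != 0 by rewrite conjC_eq0 circle_neq0.
  by apply: (mulfI nz); rewrite h mulcJ normc_circle expr1n.
have : (normc t) ^+ n @[n --> \oo] --> (0 : R).
  by apply: cvg_expr; rewrite ger0_norm ?normc_ge0.
move=> /cvgrPdist_le /(_ e e0) [N _ /(_ N (leqnn N)) /=].
rewrite sub0r normrN ger0_norm ?exprn_ge0 ?normc_ge0// => h.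
exists (fun k => char_multiplier b k ^+ N).
  exact: K_multiplierX (K_multiplier_char b).
apply: le_trans h; rewrite -/t le_eqVlt; apply/orP; left; apply/eqP.
by elim: N => [|N IH]; [rewrite !expr0 normc1|rewrite !exprS normcM IH].
Qed.

Lemma K_multiplier_small_seq (N : nat) (e : R) : 0 < e ->
  exists2 m, K_multiplier m &
    forall n, (n < N)%N -> int_of_idx n != 0 -> normc (m (int_of_idx n)) <= e.
Proof.
move=> e0; elim: N => [|N [m hm mN]].
  by exists (fun=> 1) => //; exact: K_multiplier1.
have [z0|nz] := eqVneq (int_of_idx N) 0.
  exists m => // n; rewrite ltnS leq_eqVlt => /predU1P[->|nN]; last exact: mN.
  by rewrite z0 eqxx.
have [m' hm' m'e] := K_multiplier_small nz e0.
exists (fun k => m k * m' k); first exact: K_multiplierM.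
have [[b1 _ _] [b2 _ _]] := (hm, hm').
move=> n; rewrite ltnS leq_eqVlt => /predU1P[-> _|nN n0]; rewrite normcM.
  by apply: le_trans m'e; rewrite ler_piMl ?normc_ge0.
by apply: le_trans (mN _ nN n0); rewrite ler_piMr ?normc_ge0.
Qed.

Hypothesis cK : closed K.

Lemma K_cvg (w_ : nat -> H) w : cvg_form dotH w_ w -> (forall n, K (w_ n)) -> K w.
Proof.
move=> /cvg_formP cw Kw; apply: ((closed_indP K).1 cK) => e e0.
have /cvgrPdist_lt /(_ e e0) [N _ /(_ N (leqnn N)) /=] := cw.
rewrite sub0r normrN ger0_norm ?nrm_ge0// => h.
by exists (w_ N) => //; rewrite -nrmN opprB.
Qed.

(** Multipliers bounded by 1 / (N + 1) at the first N integers of the enumeration,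
    the origin excepted, send v to vectors which tend to v (0, 0) times the basis
    vector of the origin, by dominated convergence. *)
Lemma K_origin v : K v -> v (0, 0) != 0 -> K (Wstar (eL2 R 0)).
Proof.
move=> Kv v0.
have /choice[m_ hm] : forall N : nat, exists m, K_multiplier m /\
    forall n, (n < N)%N -> int_of_idx n != 0 -> normc (m (int_of_idx n)) <= N.+1%:R^-1.
  move=> N; have e0 : 0 < N.+1%:R^-1 :> R by rewrite invr_gt0.
  by have [m h1 h2] := K_multiplier_small_seq N e0; exists m.
have /choice[w_ hw] : forall N, exists w, K w /\
    forall k : int, w (k, 0) = m_ N k * v (k, 0).
  by move=> N; have [[_ _ /(_ v Kv)[w]]] := hm N; exists w.
have cw : cvg_form dotH w_ (v (0, 0) *: Wstar (eL2 R 0)).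
  pose m' N k : R[i] := if k == 0 then 0 else m_ N k.
  rewrite /cvg_form.
  have e N : nrm2 dotH (w_ N - v (0, 0) *: Wstar (eL2 R 0)) =
      \int[cnt]_k (normc (m' N k * v (k, 0)) ^+ 2).
    rewrite -[LHS]/(fine (nrm2 dotH _)%:E) nrm2_ind_EFin /Rintegral; congr fine.
    apply: eq_integral => k _; congr ((normc _ ^+ 2)%:E).
    rewrite -scaleN1r ind_addE !ind_scaleE (hw N).2 fourier_eL2 /m'.
    have [->|k0] := eqVneq k 0.
      have [[_ -> _] _] := hm N.
      by rewrite mul0r ?eqxx mulr1 mul1r mulN1r subrr.
    by rewrite !mulr0 addr0.
  under eq_fun do rewrite e.
  apply: cvg_mul_square_integrable.
  - exact: ind_funP.
  - by move=> n; exact: cmeasurable_int.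
  - move=> n k; rewrite /m'; case: eqP => _; first by rewrite normc0.
    by have [[]] := hm n.
  - move=> k; have [->|k0] := eqVneq k 0.
      rewrite /m' eqxx mul0r normc0; exact: cvg_cst.
    apply: (@squeeze_cvgr _ _ _ _ (cst 0) (fun n => n.+1%:R^-1 * normc (v (k, 0)))).
    - near=> n; rewrite normc_ge0 /= normcM ler_wpM2r ?normc_ge0// /m' (negbTE k0).
      have [_] := hm n; rewrite -(idx_of_intK k); apply; last by rewrite idx_of_intK.
      by near: n; exact: nbhs_infty_gt.
    - exact: cvg_cst.
    - rewrite -(mul0r (normc (v (k, 0)))); apply: cvgM (cvg_cst _); exact: cvg_harmonic.
have := K_cvg cw (fun n => (hw n).1).
move=> /(KD (v (0, 0))^-1) /(_ K0); rewrite addr0 scalerA mulVf// scale1r.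
Unshelve. all: by end_near. Qed.

Lemma K_psum (e : nat -> H) c n : (forall i, K (e i)) -> K (psum e c n).
Proof.
move=> Ke; elim: n => [|n IH]; first by rewrite psum0.
by rewrite psumS; exact: KD (Ke n) IH.
Qed.

(** A translate of v has a nonzero coordinate at the origin, so K contains the basis
    vector of the origin, then all basis vectors, then the limits of their
    combinations. *)
Lemma K_full v : K v -> v != 0 -> forall f, K f.
Proof.
move=> Kv v0 f.
have [j vj] : exists j : int, v (j, 0) != 0.
  apply: contrapT => /forallNP h; move/negP: v0; apply; apply/eqP/ind_ext => j.
  by have /negP/negPn/eqP := h j.
have Kd0 : K (Wstar (eL2 R 0)).
  apply: (K_origin (Krho (j, 0) Kv)).
  by rewrite ind_repE raddf0 char0 mul1r add0r.
have Kd (k : int) : K (Wstar (eL2 R k)).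
  rewrite (_ : eL2 R k = mulL2 (@ez R k) (eL2 R 0)); last by rewrite mulL2_eL2 addr0.
  by rewrite fourier_mulL2_ez; exact: Krho.
have c := cvg_psum (@ebasisON R) (@L2_complete _ _ _ haar) (@ebasis_total R) (W f).
have lF := @fourier_linear R B alpha chi.
have bF u : nrm dotH (Wstar u) <= 1 * nrm dot u by rewrite mul1r /nrm nrm2_fourier.
have := cvg_form_bounded lF bF c; rewrite invfourierK => /K_cvg; apply => n.
by rewrite /= (linear_psum _ _ _ lF); apply: K_psum => i; exact: Kd.
Qed.

End Irreducible.

Lemma no_period_irreducible (R : realType) (B : zmodType) (alpha : zmodAut B)
    (chi : character R B) :
  ~ (exists k : nat, (1 <= k)%N /\ iter k (dual_aut alpha) chi = chi) ->
  irreducible_rep (@ind_rep R B alpha chi).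
Proof.
move=> nper; split.
  exists (fourier alpha chi (eL2 R 0)); apply/eqP => h.
  have := fourier_eL2 alpha chi 0 0; rewrite h eqxx => /eqP.
  by rewrite eq_sym oner_eq0.
move=> K cK K0 KD Krho; have [[v [Kv v0]]|h] := pselect (exists v, K v /\ v != 0).
  by right; apply/seteqP; split=> // f _; exact: (K_full nper KD K0 Krho cK Kv v0).
left; apply/seteqP; split=> [v Kv|_ ->//] /=.
by apply/eqP/negPn/negP => v0; apply: h; exists v.
Qed.

Theorem theorem3p8 (R : realType) (B : zmodType) (alpha : zmodAut B)
    (chi : character R B) :
  (irreducible_rep (@ind_rep R B alpha chi) <->
    ~ exists k : nat, (1 <= k)%N /\ iter k (dual_aut alpha) chi = chi) /\
  (forall p : nat, (1 <= p)%N ->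
    iter p (dual_aut alpha) chi = chi ->
    (forall k : nat, (1 <= k < p)%N -> iter k (dual_aut alpha) chi <> chi) ->
    exists (W : ind_space alpha chi -> L2 (@haar R))
           (Wstar : L2 (@haar R) -> ind_space alpha chi),
      unitary_map (@ind_dot R B alpha chi) (@L2_dot _ _ R (@haar R)) W Wstar /\
      [set W \o A \o Wstar | A in commutant (@ind_rep R B alpha chi)] =
      [set M | exists2 f, Linfty (@haar R) f &
                 is_mulop (fun z : circle R => f (z ^+ p)%g) M]).
Proof.
split.
  by split; [exact: irreducible_no_period|exact: no_period_irreducible].
move=> p p0 per minp.
exists (@invfourier R B alpha chi), (@fourier R B alpha chi); split.
  exact: fourier_unitary.
exact: commutant_eq p0 per minp.
Qed.
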